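(* Let $X$ be a smooth complex variety of dimension $n$ and $L$ an invertible sheaf on $X$. For any local system $S$ (of $\mathbb C$-vector spaces) on $X$, the complexes $P^\bullet_j(L)\otimes S$ are null-homotopic and exact for all $j>0$.
   Context: The principal parts sheaf of $L$ is $P(L)=p_{1*}\bigl(p_2^*L\otimes(\mathcal O_{X\times X}/\mathcal I_\Delta^2)\bigr)$, where $\Delta\subset X\times X$ is the diagonal and $p_1,p_2:X\times X\to X$ are the projections. It is locally free of rank $n+1$ and fits in $0\to\Omega^1_X\otimes L\to P(L)\to L\to0$. The map $P(L)\to L$ is split by the universal derivation $d_L:L\to P(L)$, which satisfies $d_L(fu)=f\,d_Lu+df\otimes u$. The normalized principal parts sheaf is $P_0(L)=P(L)\otimes L^{-1}$, an extension of $\mathcal O_X$ by $\Omega^1_X$. For a local generator $u$ of $L$ put $\mathrm{dlog}(u):=d_Lu\otimes u^{-1}\in P_0(L)$; such elements generate $P_0(L)$ over $\mathcal O_X$. For $j>0$ the $j$-th principal parts complex is $$P^\bullet_j(L):\ L^j\to P_0(L)L^j\to\wedge^2P_0(L)L^j\to\cdots\to\wedge^{n+1}P_0(L)L^j,$$ where juxtaposition denotes tensor product over $\mathcal O_X$. For local generators $u_1,\dots,u_i,v$ of $L$ its differential satisfies $$d\bigl(\mathrm{dlog}(u_1)\wedge\cdots\wedge\mathrm{dlog}(u_i)\,v^j\bigr)=j\,\mathrm{dlog}(u_1)\wedge\cdots\wedge\mathrm{dlog}(u_i)\wedge\mathrm{dlog}(v)\,v^j,$$ and it is extended by additivity and the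 derivation property, i.e. for a local function $f$, $$d\bigl(f\,\mathrm{dlog}(u_1)\wedge\cdots\wedge\mathrm{dlog}(u_i)\,v^j\bigr)=\mathrm{dlog}(u_1)\wedge\cdots\wedge\mathrm{dlog}(u_i)\wedge\bigl(df+jf\,\mathrm{dlog}(v)\bigr)v^j .$$ The complex $P^\bullet_j(L)\otimes S$ is the tensor product over $\mathbb C$, with differential $d\otimes\mathrm{id}_S$. *)

(* Defs.v *)
From HB Require Import structures.
From mathcomp Require Import all_boot all_order all_algebra complex.
From mathcomp Require Import mathcomp_extra boolp classical_sets functions.
From mathcomp Require Import cardinality reals topology normedtype sequences.
From mathcomp Require Import ring.
Set Implicit Arguments.
Unset Strict Implicit.
Unset Printing Implicit Defensive.
Import Order.TTheory GRing.Theory Num.Theory.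
Import numFieldNormedType.Exports.
Local Open Scope classical_set_scope.
Local Open Scope ring_scope.

(* The norm topology on an archimedean numerical field, set up as
   numFieldNormedType does for the other numerical structures. *)
Section ArchiNumField.
Variable K : archiNumFieldType.
#[non_forgetful_inheritance]
HB.instance Definition _ := GRing.ComAlgebra.copy K K^o.
#[non_forgetful_inheritance]
HB.instance Definition _ := Vector.copy K K^o.
#[non_forgetful_inheritance]
HB.instance Definition _ := NormedModule.copy K K^o.
#[non_forgetful_inheritance]
HB.instance Definition _ := Num.ArchiNumField.on K.
End ArchiNumField.

Section PowerSeries.
Context {K : archiNumFieldType}.

(* Partial sum of the power series sum_v a_v h^v, v ranging over the
   multi-indices all of whose entries are < N. *)
Definition box_sum n (a : ('I_n -> nat) -> K) (h : 'rV[K]_n) (N : nat) : K :=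
  \sum_(v : {ffun 'I_n -> 'I_N}) a (fun k => v k) * \prod_k h 0 k ^+ v k.

(* g is holomorphic near c in the sense of Weierstrass: it is the sum of a
   power series at c on a polydisc of radius r. The Cauchy bound makes the
   series absolutely convergent there, so the order of summation is
   immaterial. In K, 0 < r forces r to be real. *)
Definition analytic_at n (g : 'rV[K]_n -> K) (c : 'rV[K]_n) : Prop :=
  exists (a : ('I_n -> nat) -> K) (r M : K),
  [/\ 0 < r,
      forall v, `|a v| * r ^+ (\sum_k v k) <= M
    & forall h : 'rV[K]_n, (forall k, `|h 0 k| < r) ->
      box_sum a h @ \oo --> g (c + h)].

Lemma real_bound_le (r r' : K) (s : nat) : 0 < r -> r <= r' ->
  r ^+ s <= r' ^+ s.
Proof.
by move=> r0 rr'; apply: lerXn2r; rewrite ?nnegrE ?(ltW r0) ?(le_trans (ltW r0)).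
Qed.

Lemma common_radius (r s : K) : 0 < r -> 0 < s ->
  exists2 m, 0 < m & m <= r /\ m <= s.
Proof.
move=> r0 s0; have /orP[rs|sr] : r >=< s by apply: real_comparable; apply: gtr0_real.
  by exists r.
by exists s.
Qed.

Lemma analytic_atD n (f g : 'rV[K]_n -> K) c :
  analytic_at f c -> analytic_at g c -> analytic_at (fun z => f z + g z) c.
Proof.
move=> [a [r [M [r0 aM fa]]]] [b [s [L [s0 bL gb]]]].
have [m m0 [mr ms]] := common_radius r0 s0.
exists (fun v => a v + b v), m, (M + L).
split=> // [v|h hh].
  apply: (le_trans (ler_wpM2r _ (ler_normD _ _))).
    by rewrite exprn_ge0// ltW.
  rewrite mulrDl; apply: lerD.
    apply: le_trans (aM v); apply: ler_wpM2l => //; exact: real_bound_le.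
  apply: le_trans (bL v); apply: ler_wpM2l => //; exact: real_bound_le.
have -> : box_sum (fun v => a v + b v) h = box_sum a h + box_sum b h.
  apply/funext=> N; rewrite /box_sum [RHS]/GRing.add/= -big_split/=.
  by apply: eq_bigr => v _; rewrite mulrDl.
apply: cvgD; [apply: fa|apply: gb] => k; exact: lt_le_trans (hh k) _.
Qed.

Lemma analytic_at_cst n (x : K) (c : 'rV[K]_n) : analytic_at (fun=> x) c.
Proof.
exists (fun v => if [forall k, v k == 0%N] then x else 0), 1, `|x|.
split=> // [v|h _].
  rewrite expr1n mulr1.
  by case: ifP => // _; rewrite normr0.
rewrite -(@cvg_shiftS K); apply: cvg_near_cst; apply: nearW => N /=.
rewrite /box_sum (bigD1 [ffun=> ord0])//= [X in _ + X]big1 => [|v vn0].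
  rewrite ifT; last by apply/forallP => k; rewrite ffunE.
  by rewrite big1 ?mulr1 ?addr0// => k _; rewrite ffunE expr0.
case: ifPn => [/forallP v0|]; last by rewrite mul0r.
case/eqP: vn0; apply/ffunP => k; rewrite ffunE; apply/val_inj/eqP.
exact: v0.
Qed.

Definition conv n (a b : ('I_n -> nat) -> K) (v : 'I_n -> nat) : K :=
  \sum_(u : {ffun 'I_n -> 'I_(\sum_k v k).+1} | [forall k, u k <= v k]%N)
    a (fun k => u k) * b (fun k => v k - u k)%N.

Lemma convE n (a b : ('I_n -> nat) -> K) (v : 'I_n -> nat) N :
  (forall k, v k < N)%N ->
  conv a b v = \sum_(u : {ffun 'I_n -> 'I_N} | [forall k, u k <= v k]%N)
    a (fun k => u k) * b (fun k => v k - u k)%N.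
Proof.
case: N => [|N] vN.
  case: n a b v vN => [|n] a b v vN; last by have := vN ord0.
  rewrite /conv (big_pred1 [ffun=> ord0]); last first.
    move=> u /=; rewrite (_ : u == _ = true); first by apply/forallP => -[].
    by apply/eqP/ffunP => -[].
  rewrite (big_pred1 [ffun k : 'I_0 => match k with Ordinal m i => 
      False_rect _ (notF i) end]); last first.
    move=> u /=; rewrite (_ : u == _ = true); first by apply/forallP => -[].
    by apply/eqP/ffunP => -[].
  by congr (a _ * b _); apply/funext => -[].
pose h (u : {ffun 'I_n -> 'I_N.+1}) : {ffun 'I_n -> 'I_(\sum_k v k).+1} :=
  [ffun k => inord (u k)].
pose h' (u : {ffun 'I_n -> 'I_(\sum_k v k).+1}) : {ffun 'I_n -> 'I_N.+1} :=
  [ffun k => inord (u k)].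
have vS k : (v k <= \sum_k v k)%N by rewrite (bigD1 k)//= leq_addr.
rewrite /conv (reindex_onto h h')/=; last first.
  move=> u /forallP uv; apply/ffunP => k; apply/val_inj.
  rewrite !ffunE/= inordK.
    by rewrite inordK// (leq_ltn_trans (uv k)).
  by rewrite inordK ?ltn_ord// (leq_ltn_trans (uv k)).
have hE (u : {ffun 'I_n -> 'I_N.+1}) k : (u k <= v k)%N -> h u k = u k :> nat.
  by move=> uv; rewrite ffunE inordK// ltnS (leq_trans uv).
apply: eq_big => u.
  apply/andP/forallP => [[/forallP huv /eqP hu] k|uv].
    have := congr1 (fun w : {ffun _ -> 'I_N.+1} => val (w k)) hu; rewrite /= {1}/h' ffunE inordK => [<-//|].
    by rewrite (leq_ltn_trans (huv k)).
  split; first by apply/forallP => k; rewrite hE.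
  apply/eqP/ffunP => k; apply/val_inj; rewrite ffunE /= hE//.
  by rewrite inordK.
move=> /andP[/forallP huv /eqP hu].
have uE k : h u k = u k :> nat.
  have := congr1 (fun w : {ffun _ -> 'I_N.+1} => val (w k)) hu; rewrite /= {1}/h' ffunE inordK => [<-//|].
  by rewrite (leq_ltn_trans (huv k)).
by congr (a _ * b _); apply/funext => k; rewrite uE.
Qed.

Lemma box_sum_conv n (a b : ('I_n -> nat) -> K) h N :
  box_sum (conv a b) h N =
  \sum_(u : {ffun 'I_n -> 'I_N})
    \sum_(w : {ffun 'I_n -> 'I_N} | [forall k, u k + w k < N]%N)
      (a (fun k => u k) * \prod_k h 0 k ^+ u k) *
      (b (fun k => w k) * \prod_k h 0 k ^+ w k).
Proof.
rewrite /box_sum.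
transitivity (\sum_(v : {ffun 'I_n -> 'I_N})
    \sum_(u : {ffun 'I_n -> 'I_N} | [forall k, u k <= v k]%N)
    a (fun k => u k) * b (fun k => v k - u k)%N * \prod_k h 0 k ^+ v k).
  by apply: eq_bigr => v _; rewrite (@convE _ _ _ _ N)// mulr_suml.
rewrite (exchange_big_dep xpredT)//=; apply: eq_bigr => u _.
case: N u => [|N] u.
  case: n a b h u => [|n] a b h u; last by case: (u ord0).
  apply: eq_big => v; first by apply/forallP/forallP => _ [].
  move=> _; rewrite !big_ord0 !mulr1.
  by congr (_ * b _); apply/funext => -[].
pose f (w : {ffun 'I_n -> 'I_N.+1}) : {ffun 'I_n -> 'I_N.+1} :=
  [ffun k => inord (u k + w k)].
pose g (v : {ffun 'I_n -> 'I_N.+1}) : {ffun 'I_n -> 'I_N.+1} :=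
  [ffun k => inord (v k - u k)].
rewrite (reindex_onto f g)/=; last first.
  move=> v /forallP uv; apply/ffunP => k; apply/val_inj; rewrite !ffunE/=.
  rewrite [X in (_ + X)%N]inordK ?subnKC ?inord_val//.
  by rewrite (leq_ltn_trans (leq_subr _ _)).
apply: eq_big => w.
  apply/andP/forallP => [[/forallP uf /eqP gf] k|uw].
    rewrite ltnNge; apply/negP => Nuw.
    have := uf k; have := congr1 (fun w : {ffun _ -> 'I_N.+1} => w k) gf; rewrite !ffunE => gfk.
    rewrite /inord /insubd insubN -?leqNgt //= leqn0 => /eqP u0.
    by move: Nuw; rewrite u0 add0n leqNgt ltn_ord.
  have fE k : f w k = (u k + w k)%N :> nat by rewrite ffunE inordK.
  split; first by apply/forallP => k; rewrite fE leq_addr.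
  by apply/eqP/ffunP => k; apply/val_inj; rewrite ffunE /= fE addKn inordK.
move=> /andP[/forallP uf /eqP gf].
have fE k : f w k = (u k + w k)%N :> nat.
  have := congr1 (fun w : {ffun _ -> 'I_N.+1} => val (w k)) gf; rewrite ffunE/= inordK.
    by move=> <-; rewrite subnKC.
  by rewrite (leq_ltn_trans (leq_subr _ _)).
under [in LHS]eq_bigr do rewrite fE exprD.
rewrite big_split/= mulrACA; congr (_ * (b _ * _)).
by apply/funext => k; rewrite fE addKn.
Qed.

Lemma sum_half_le2 N : \sum_(p < N) (2^-1 : K) ^+ p <= 2.
Proof.
suff -> : \sum_(p < N) (2^-1 : K) ^+ p = 2 - 2 * 2^-1 ^+ N.
  by rewrite gerBl mulr_ge0// exprn_ge0// invr_ge0.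
elim: N => [|N IH]; first by rewrite big_ord0 expr0 mulr1 subrr.
rewrite big_ord_recr/= IH exprS mulrA divff ?pnatr_eq0// mul1r.
by ring.
Qed.

Lemma cvg_half : ((fun N => 2^-1 ^+ N) : nat -> K) @ \oo --> (0 : K).
Proof.
apply/cvgrPdist_lt => e e0; exists (Num.bound e^-1) => //= N eN.
rewrite sub0r normrN ger0_norm ?exprn_ge0 ?invr_ge0//.
rewrite exprVn -ltf_pV2 ?posrE ?invr_gt0 ?exprn_gt0// invrK.
have /archi_boundP eB : 0 <= e^-1 by rewrite invr_ge0 ltW.
apply: lt_trans eB _; rewrite -natrX ltr_nat (leq_ltn_trans eN)//.
exact: ltn_expl.
Qed.

Lemma prod_norm_le n (a : ('I_n -> nat) -> K) (r M : K) (h : 'rV[K]_n) t :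
  0 < r -> 0 <= t ->
  (forall v, `|a v| * r ^+ (\sum_k v k) <= M) ->
  (forall k, `|h 0 k| <= t * r) ->
  forall v, `|a v * \prod_k h 0 k ^+ v k| <= M * \prod_k t ^+ v k.
Proof.
move=> r0 t0 aM hr v; rewrite normrM normr_prod.
apply: le_trans (_ : `|a v| * \prod_k (t * r) ^+ v k <= _).
  apply: ler_wpM2l => //; apply: ler_prod => k _; rewrite normr_ge0/= normrX.
  by apply: lerXn2r; rewrite ?nnegrE// mulr_ge0// ltW.
have -> : \prod_k (t * r) ^+ v k = r ^+ (\sum_k v k) * \prod_k t ^+ v k.
  under eq_bigr do rewrite exprMn mulrC.
  by rewrite big_split/= expr_sum.
by rewrite mulrA; apply: ler_wpM2r => //; apply: prodr_ge0 => k _; apply: exprn_ge0.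
Qed.

Lemma bound_ge0 n (a : ('I_n -> nat) -> K) (r M : K) : 0 < r ->
  (forall v, `|a v| * r ^+ (\sum_k v k) <= M) -> 0 <= M.
Proof.
move=> r0 /(_ (fun=> 0%N)); apply: le_trans.
by rewrite mulr_ge0// exprn_ge0// ltW.
Qed.

Lemma conv_bound n (a b : ('I_n -> nat) -> K) (r M L : K) : 0 < r ->
  (forall v, `|a v| * r ^+ (\sum_k v k) <= M) ->
  (forall v, `|b v| * r ^+ (\sum_k v k) <= L) ->
  forall v, `|conv a b v| * (r / 4) ^+ (\sum_k v k) <= (M * L).
Proof.
move=> r0 aM bL v.
have M0 := bound_ge0 r0 aM; have L0 := bound_ge0 r0 bL.
have r00 : 0 <= r := ltW r0.
pose s := (\sum_k v k)%N.
have H : `|conv a b v| * r ^+ s <= (M * L) * \prod_k (v k).+1%:R.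
  apply: le_trans (ler_wpM2r _ (ler_norm_sum _ _ _)) _; first exact: exprn_ge0.
  rewrite mulr_suml.
  have -> : \prod_k (v k).+1%:R =
     \sum_(u : {ffun 'I_n -> 'I_s.+1} | [forall k, u k <= v k]%N) (1 : K).
    have -> : \prod_k (v k).+1%:R = \prod_k \sum_(p < s.+1 | (p <= v k)%N) (1:K).
      apply: eq_bigr => k _.
      have vS : (v k < s.+1)%N by rewrite ltnS /s (bigD1 k)//= leq_addr.
      rewrite -(big_ord_widen s.+1 (fun=> 1 : K) vS).
      by rewrite sumr_const card_ord.
    rewrite bigA_distr_big_dep/=; apply: eq_big => [u|u _]; last by rewrite big1.
    by apply/familyP/forallP.
  rewrite mulr_sumr; apply: ler_sum => u /forallP uv; rewrite mulr1.
  rewrite normrM.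
  have -> : s = (\sum_k u k + \sum_k (v k - u k))%N.
    by rewrite -big_split/=; apply: eq_bigr => k _; rewrite subnKC.
  by rewrite exprD mulrACA; apply: ler_pM; rewrite ?mulr_ge0 ?exprn_ge0.
have -> : (r / 4) ^+ s = r ^+ s * 4^-1 ^+ s.
  by rewrite exprMn.
rewrite mulrA; apply: le_trans (ler_wpM2r _ H) _; first by rewrite exprn_ge0// invr_ge0.
rewrite -!mulrA -[L in leRHS]mulr1; do 2 apply: ler_wpM2l => //.
rewrite /s expr_sum -big_split/=.
apply: prodr_ile1 => k _; rewrite mulr_ge0 ?exprn_ge0 ?invr_ge0//=.
rewrite exprVn ler_pdivrMr ?exprn_gt0// mul1r -natrX ler_nat.
exact: ltn_expl.
Qed.

Lemma analytic_at_radius n (a : ('I_n -> nat) -> K) (r s M : K) : 0 < s -> s <= r ->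
  (forall v, `|a v| * r ^+ (\sum_k v k) <= M) ->
  (forall v, `|a v| * s ^+ (\sum_k v k) <= M).
Proof.
move=> s0 sr aM v; apply: le_trans (aM v); apply: ler_wpM2l => //.
exact: real_bound_le.
Qed.

Lemma analytic_atM n (f g : 'rV[K]_n -> K) c :
  analytic_at f c -> analytic_at g c -> analytic_at (fun z => f z * g z) c.
Proof.
move=> [a [r1 [M [r10 aM fa]]]] [b [r2 [L [r20 bL gb]]]].
have [r r0 [rr1 rr2]] := common_radius r10 r20.
move: aM bL => /(analytic_at_radius r0 rr1) aM /(analytic_at_radius r0 rr2) bL.
exists (conv a b), (r / 4), (M * L); split; first by rewrite divr_gt0.
  exact: conv_bound.
move=> h hr.
have hr' k : `|h 0 k| <= 4^-1 * r.
  by rewrite mulrC; apply: le_trans (ltW (hr k)) _.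
have hr1 k : `|h 0 k| < r.
  by apply: lt_le_trans (hr k) _; rewrite ler_pdivrMr// ler_peMr ?(ltW r0)// ler1n.
have {}fa : box_sum a h @ \oo --> f (c + h).
  by apply: fa => k; exact: lt_le_trans (hr1 k) _.
have {}gb : box_sum b h @ \oo --> g (c + h).
  by apply: gb => k; exact: lt_le_trans (hr1 k) _.
have fg : (fun N => box_sum a h N * box_sum b h N) @ \oo --> f (c + h) * g (c + h).
  exact: cvgM.
pose D N := box_sum (conv a b) h N - box_sum a h N * box_sum b h N.
suff D0 : D @ \oo --> (0 : K).
  have -> : box_sum (conv a b) h = (fun N => D N + box_sum a h N * box_sum b h N).
    by apply/funext => N; rewrite /D subrK.
  by rewrite -[X in _ --> X]add0r; apply: cvgD.
have DE N : `|D N| <= (M * L) * 4 ^+ n * 2^-1 ^+ N.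
  have M0 := bound_ge0 r0 aM; have L0 := bound_ge0 r0 bL.
  rewrite /D box_sum_conv distrC /box_sum mulr_suml -sumrB.
  have q0 : 0 <= (4^-1 : K) by rewrite invr_ge0.
  have p0 : 0 <= (2^-1 : K) by rewrite invr_ge0.
  have T (u w : {ffun 'I_n -> 'I_N}) : ~~ [forall k, u k + w k < N]%N ->
     `|(a (fun k => u k) * \prod_k h 0 k ^+ u k) *
      (b (fun k => w k) * \prod_k h 0 k ^+ w k)| <=
      (M * L) * 2^-1 ^+ N * (\prod_k 2^-1 ^+ u k * \prod_k 2^-1 ^+ w k).
    move=> /forallPn[k0]; rewrite -leqNgt => Nk.
    rewrite normrM; apply: le_trans (ler_pM _ _ (prod_norm_le r0 q0 aM hr' _)
      (prod_norm_le r0 q0 bL hr' _)) _ => //.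
    rewrite mulrACA -[leRHS]mulrA; apply: ler_wpM2l.
      exact: mulr_ge0.
    rewrite -!expr_sum -!exprD.
    have -> : (4^-1 : K) = 2^-1 * 2^-1 by rewrite -invfM -natrM.
    rewrite exprMn [leRHS]exprD; apply: ler_wpM2r; first exact: exprn_ge0.
    apply: ler_wiXn2l => //; first by rewrite invf_le1// ler1n.
    by apply: leq_trans Nk _; apply: leq_add; rewrite (bigD1 k0)//= leq_addr.
  apply: le_trans (ler_norm_sum _ _ _) _.
  apply: le_trans (_ : \sum_(u : {ffun 'I_n -> 'I_N}) \sum_(w : {ffun 'I_n -> 'I_N})
      (M * L) * 2^-1 ^+ N * (\prod_k 2^-1 ^+ u k * \prod_k 2^-1 ^+ w k) <= _).
    apply: ler_sum => u _; rewrite mulr_sumr.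
    rewrite (bigID (fun w : {ffun 'I_n -> 'I_N} => [forall k, u k + w k < N]%N))/=.
    rewrite addrC addrK; apply: le_trans (ler_norm_sum _ _ _) _.
    rewrite big_mkcond/=; apply: ler_sum => w _.
    case: ifPn => [/T//|_]; apply: mulr_ge0.
      by rewrite !mulr_ge0// exprn_ge0.
    by apply: mulr_ge0; apply: prodr_ge0 => k _; apply: exprn_ge0.
  under eq_bigr do rewrite -mulr_sumr -mulr_sumr.
  rewrite -mulr_sumr -mulr_suml -[leLHS]mulrA -[leRHS]mulrA; apply: ler_wpM2l.
    exact: mulr_ge0.
  rewrite mulrC; apply: ler_wpM2r; first exact: exprn_ge0.
  have -> : \sum_(u : {ffun 'I_n -> 'I_N}) \prod_k (2^-1 : K) ^+ u k =
      (\sum_(p < N) 2^-1 ^+ p) ^+ n.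
    rewrite -(bigA_distr_bigA (fun _ (p : 'I_N) => 2^-1 ^+ p))/=.
    by rewrite prodr_const card_ord.
  rewrite -exprD addnn -mul2n exprM.
  apply: lerXn2r; rewrite ?nnegrE ?exprn_ge0//.
    by apply: sumr_ge0 => p _; apply: exprn_ge0.
  have -> : (4 : K) = 2 ^+ 2 by rewrite -natrX.
  apply: lerXn2r; rewrite ?nnegrE//.
    by apply: sumr_ge0 => p _; apply: exprn_ge0.
  exact: sum_half_le2.
apply/cvgrPdist_le => e e0.
have /cvgrPdist_le/(_ _ e0) :
    (fun N => (M * L) * 4 ^+ n * 2^-1 ^+ N : K) @ \oo --> (0 : K).
  rewrite -[X in _ --> X](mulr0 ((M * L) * 4 ^+ n)).
  by apply: cvgM; [exact: cvg_cst|exact: cvg_half].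
apply: filterS => N; rewrite !sub0r !normrN => He.
apply: le_trans (DE N) _; apply: le_trans He; apply: real_ler_norm.
apply: ger0_real; exact: le_trans (normr_ge0 _) (DE N).
Qed.

Lemma analytic_at_coords n m (s : 'I_n -> 'I_m) (g : 'rV[K]_n -> K) (c : 'rV[K]_m) :
  injective s -> analytic_at g (\row_k c 0 (s k)) ->
  analytic_at (fun z => g (\row_k z 0 (s k))) c.
Proof.
move=> sI [a [r [M [r0 aM ga]]]].
have M0 := bound_ge0 r0 aM.
exists (fun v => if [forall k, (k \in codom s) || (v k == 0%N)]
                 then a (fun k => v (s k)) else 0), r, M; split=> // [v|h hr].
  case: ifP => [/forallP v0|_]; last by rewrite normr0 mul0r.
  apply: le_trans (aM _) => /=; apply: ler_wpM2l => //.
  rewrite (bigID (mem (codom s)))/= [X in (_ + X)%N]big1 ?addn0; last first.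
    by move=> k ks; have := v0 k; rewrite (negPf ks) => /eqP.
  by rewrite -big_uniq/= ?big_map ?big_enum//= map_inj_uniq// enum_uniq.
have {}ga := ga (\row_k h 0 (s k)).
rewrite (_ : _ + _ = \row_k (c + h) 0 (s k)) in ga; last first.
  by apply/rowP => k; rewrite !mxE.
have {}ga : box_sum a (\row_k h 0 (s k)) @ \oo --> g (\row_k (c + h) 0 (s k)).
  by apply: ga => k; rewrite mxE.
apply: cvg_trans ga; apply: near_eq_cvg; exists 1%N => //= -[//|N] _.
pose ext (v : {ffun 'I_n -> 'I_N.+1}) : {ffun 'I_m -> 'I_N.+1} :=
  [ffun k => if [pick i | s i == k] is Some i then v i else ord0].
pose rst (v : {ffun 'I_m -> 'I_N.+1}) : {ffun 'I_n -> 'I_N.+1} :=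
  [ffun i => v (s i)].
have extE v i : ext v (s i) = v i.
  rewrite ffunE; case: pickP => [i' /eqP/sI->//|/(_ i)]; by rewrite eqxx.
have extN v k : k \notin codom s -> ext v k = ord0.
  rewrite ffunE; case: pickP => // i /eqP<-; by rewrite codom_f.
rewrite /box_sum [RHS](bigID
  (fun v : {ffun 'I_m -> 'I_N.+1} => [forall k, (k \in codom s) || (v k == 0%N :> nat)]))/=.
rewrite [X in _ + X]big1 ?addr0; last by move=> v /negPf ->; rewrite mul0r.
rewrite [RHS](reindex_onto ext rst)/=; last first.
  move=> v /forallP v0; apply/ffunP => k.
  have [/codomP[i ->]|ks] := boolP (k \in codom s); first by rewrite extE ffunE.
  rewrite extN//; apply/val_inj; have := v0 k.
  by rewrite (negPf ks) => /eqP.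
apply: eq_big => v.
  apply/esym/andP; split; last by apply/eqP/ffunP => i; rewrite ffunE extE.
  by apply/forallP => k; case: (boolP (k \in _)) => //= ks; rewrite extN.
move=> _; rewrite ifT; last first.
  by apply/forallP => k; case: (boolP (k \in _)) => //= ks; rewrite extN.
congr (_ * _); first by congr a; apply/funext => i; rewrite extE.
rewrite [RHS](bigID (mem (codom s)))/= [X in _ * X]big1 ?mulr1; last first.
  by move=> k ks; rewrite extN.
rewrite -[RHS]big_uniq/=; last exact/injectiveP.
rewrite big_map big_enum/=; apply: eq_bigr => i _.
by rewrite mxE extE.
Qed.
End PowerSeries.

Record opens (X : topologicalType) := Opens {
  oset :> set X;
  oset_open : open oset }.
Arguments Opens {X}.
Definition opens_mem (X : topologicalType) (U : opens X) (x : X) : Prop :=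
  oset U x.
Coercion opens_mem : opens >-> Funclass.

Definition opensI (X : topologicalType) (U V : opens X) : opens X :=
  Opens (U `&` V) (openI (oset_open U) (oset_open V)).

Definition preim_opens (X Y : topologicalType) (p : Y -> X)
    (pc : continuous p) (U : opens X) : opens Y :=
  Opens (p @^-1` U) (open_comp (fun y _ => pc y) (oset_open U)).

Record ringPresheaf (X : topologicalType) := RingPresheaf {
  rsec :> opens X -> comPzRingType;
  rres : forall U V : opens X, V `<=` U -> {rmorphism rsec U -> rsec V};
  rres_id : forall (U : opens X) (h : U `<=` U) f, rres h f = f;
  rres_comp : forall (U V W : opens X)
      (h1 : V `<=` U) (h2 : W `<=` V) (h3 : W `<=` U) f,
    rres h2 (rres h1 f) = rres h3 f }.
Arguments rres {X} r {U V} _.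

Record ringHom (X : topologicalType) (A B : ringPresheaf X) := RingHom {
  rhom :> forall U, {rmorphism A U -> B U};
  rhom_res : forall (U V : opens X) (h : V `<=` U) f,
    rres B h (rhom U f) = rhom V (rres A h f) }.

(* Sheaves of modules over a presheaf of rings. For the structure sheaf these
   are the sheaves of O-modules; for the constant presheaf K they are the
   sheaves of K-vector spaces. *)
Record modSheaf (X : topologicalType) (A : ringPresheaf X) := ModSheaf {
  msec :> forall U : opens X, lmodType (A U);
  mres : forall U V : opens X, V `<=` U -> msec U -> msec V;
  mresD : forall (U V : opens X) (h : V `<=` U) s t,
    mres h (s + t) = mres h s + mres h t;
  mresZ : forall (U V : opens X) (h : V `<=` U) a s,
    mres h (a *: s) = rres A h a *: mres h s;
  mres_id : forall (U : opens X) (h : U `<=` U) s, mres h s = s;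
  mres_comp : forall (U V W : opens X)
      (h1 : V `<=` U) (h2 : W `<=` V) (h3 : W `<=` U) s,
    mres h2 (mres h1 s) = mres h3 s;
  msec_separated : forall (U : opens X) (s t : msec U),
    (forall x, U x ->
       exists (V : opens X) (h : V `<=` U), V x /\ mres h s = mres h t) ->
    s = t;
  msec_glue : forall (U : opens X) (I : Type) (c : I -> opens X)
      (h : forall i, c i `<=` U) (s : forall i, msec (c i)),
    (forall x, U x -> exists i, c i x) ->
    (forall i j (W : opens X) (hi : W `<=` c i) (hj : W `<=` c j),
       mres hi (s i) = mres hj (s j)) ->
    exists t : msec U, forall i, mres (h i) t = s i }.
Arguments mres {X A} m {U V} _ _.

Record modHom (X : topologicalType) (A : ringPresheaf X) (F G : modSheaf A) :=
  ModHom {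
    mhom :> forall U, {linear F U -> G U};
    mhom_res : forall (U V : opens X) (h : V `<=` U) s,
      mres G h (mhom U s) = mhom V (mres F h s) }.

Record bilinearMap (X : topologicalType) (A : ringPresheaf X)
    (F G H : modSheaf A) := BilinearMap {
  bmap :> forall U, F U -> G U -> H U;
  bmap_linl : forall (U : opens X) (a : A U) (s s' : F U) (t : G U),
    bmap (a *: s + s') t = a *: bmap s t + bmap s' t;
  bmap_linr : forall (U : opens X) (a : A U) (s : F U) (t t' : G U),
    bmap s (a *: t + t') = a *: bmap s t + bmap s t';
  bmap_res : forall (U V : opens X) (h : V `<=` U) (s : F U) (t : G U),
    mres H h (bmap s t) = bmap (mres F h s) (mres G h t) }.
Arguments bmap {X A F G H} b U s t.

Record multilinearMap (k : nat) (X : topologicalType) (A : ringPresheaf X)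
    (F G : modSheaf A) := MultilinearMap {
  mmap :> forall U, ('I_k -> F U) -> G U;
  mmap_lin : forall (U : opens X) (s : 'I_k -> F U) (i : 'I_k) a x y,
    mmap [eta s with i |-> a *: x + y] =
    a *: mmap [eta s with i |-> x] + mmap [eta s with i |-> y];
  mmap_res : forall (U V : opens X) (h : V `<=` U) (s : 'I_k -> F U),
    mres G h (mmap s) = mmap (fun i => mres F h (s i)) }.
Arguments mmap {k X A F G} m U s.

(* Tensor products, tensor powers, exterior powers and inverse images of sheaves
   of modules are specified by their universal properties among sheaves, which
   determine them up to unique isomorphism (the sheafification of the
   sectionwise construction has the property). *)
Section UniversalModules.
Variables (X : topologicalType) (A : ringPresheaf X).
Implicit Types F G H : modSheaf A.

Definition is_tensor F G T (b : bilinearMap F G T) : Prop :=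
  forall H (b' : bilinearMap F G H),
    exists phi : modHom T H,
      (forall U s t, phi U (b U s t) = b' U s t) /\
      forall psi : modHom T H, (forall U s t, psi U (b U s t) = b' U s t) ->
        forall U x, psi U x = phi U x.

Definition is_tensor_power k F T (m : multilinearMap k F T) : Prop :=
  forall H (m' : multilinearMap k F H),
    exists phi : modHom T H,
      (forall U s, phi U (m U s) = m' U s) /\
      forall psi : modHom T H, (forall U s, psi U (m U s) = m' U s) ->
        forall U x, psi U x = phi U x.

Definition alternating k F G (m : multilinearMap k F G) : Prop :=
  forall U (s : 'I_k -> F U) (a b : 'I_k), a != b -> s a = s b -> m U s = 0.

Definition is_exterior_power k F T (m : multilinearMap k F T) : Prop :=
  alternating m /\
  forall H (m' : multilinearMap k F H), alternating m' ->
    exists phi : modHom T H,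
      (forall U s, phi U (m U s) = m' U s) /\
      forall psi : modHom T H, (forall U s, psi U (m U s) = m' U s) ->
        forall U x, psi U x = phi U x.

Definition local_generator F (U : opens X) (u : F U) : Prop :=
  forall (V : opens X) (h : V `<=` U),
    bijective (fun f : A V => f *: mres F h u).

Definition invertible F : Prop :=
  forall x, exists (U : opens X) (u : F U), U x /\ local_generator u.

(* The sheaf Hom(F, A), presented by its evaluation pairing: a section over U
   is the same as a morphism from F|U to A|U. *)
Record dual F := Dual {
  dual_mod :> modSheaf A;
  dual_pair : forall U, F U -> dual_mod U -> A U;
  dual_linl : forall (U : opens X) a (s s' : F U) (w : dual_mod U),
    dual_pair (a *: s + s') w = a * dual_pair s w + dual_pair s' w;
  dual_linr : forall (U : opens X) a (s : F U) (w w' : dual_mod U),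
    dual_pair s (a *: w + w') = a * dual_pair s w + dual_pair s w';
  dual_res : forall (U V : opens X) (h : V `<=` U) (s : F U) (w : dual_mod U),
    rres A h (dual_pair s w) =
    dual_pair (mres F h s) (mres dual_mod h w);
  dual_hom : forall (U : opens X)
      (l : forall V : opens X, V `<=` U -> {linear F V -> (A V)^o}),
    (forall (V W : opens X) (hV : V `<=` U) (hW : W `<=` U) (h : W `<=` V) s,
       rres A h (l V hV s) = l W hW (mres F h s)) ->
    exists! w : dual_mod U, forall (V : opens X) (h : V `<=` U) s,
      l V h s = dual_pair s (mres dual_mod h w) }.

(* For a local generator u of an invertible F this is u^-1, the section of the
   dual taking the value 1 on u. *)
Definition dual_inv F (D : dual F) (U : opens X) (u : F U) : D U :=
  xget 0 [set w | dual_pair u w = 1].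

(* The projection A -> A/J onto the quotient by a sheaf of ideals J. *)
Record quotientMap (J : forall U : opens X, set (A U)) F := QuotientMap {
  qmap :> forall U, {linear (A U)^o -> F U};
  qmap_res : forall (U V : opens X) (h : V `<=` U) f,
    mres F h (qmap U f) = qmap V (rres A h f);
  qmap_ker : forall U f, qmap U f = 0 <-> J U f;
  qmap_surj : forall (U : opens X) (s : F U) x, U x ->
    exists (V : opens X) (h : V `<=` U) (f : A V), V x /\ qmap V f = mres F h s }.

(* The sheaf of ideals J^2: locally, finite sums of products of two sections of
   J. *)
Definition ideal_sq (J : forall U : opens X, set (A U)) (U : opens X) :
    set (A U) :=
  [set f | forall x, U x -> exists (V : opens X) (h : V `<=` U), V x /\
     exists k (a b : 'I_k -> A V),
       (forall i, J V (a i) /\ J V (b i)) /\ rres A h f = \sum_i a i * b i].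

Definition locally_in_image F G (phi : modHom F G) (U : opens X) (s : G U) :
    Prop :=
  forall x, U x -> exists (V : opens X) (h : V `<=` U) (t : F V),
    V x /\ phi V t = mres G h s.

(* Complexes T 0 -> T 1 -> ... -> T m.+1, extended by zero on both sides; the
   values of T and d in higher degrees are ignored. *)
Section Complexes.
Variables (m : nat) (T : nat -> modSheaf A).
Variable d : forall i, modHom (T i) (T i.+1).

Definition null_homotopic : Prop :=
  exists h : forall i, modHom (T i.+1) (T i),
  [/\ forall U (s : T 0%N U), h 0%N U (d 0%N U s) = s,
      forall i, (i < m)%N -> forall U (s : T i.+1 U),
        d i U (h i U s) + h i.+1 U (d i.+1 U s) = s
    & forall U (s : T m.+1 U), d m U (h m U s) = s].

Definition exact_complex : Prop :=
  [/\ forall U (s : T 0%N U), d 0%N U s = 0 -> s = 0,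
      forall i, (i < m)%N -> forall U (s : T i.+1 U),
        d i.+1 U s = 0 <-> locally_in_image (d i) s
    & forall U (s : T m.+1 U), locally_in_image (d m) s].
End Complexes.
End UniversalModules.

Definition restr_scal (A B : pzRingType) (phi : {rmorphism A -> B})
  (M : lmodType B) : Type := M.

Section RestrictScalars.
Variables (A B : pzRingType) (phi : {rmorphism A -> B}) (M : lmodType B).

HB.instance Definition _ := GRing.Zmodule.copy (restr_scal phi M) M.

Let scale (a : A) (x : restr_scal phi M) : restr_scal phi M :=
  phi a *: (x : M).

Let scaleA a b x : scale a (scale b x) = scale (a * b) x.
Proof. by rewrite /scale scalerA rmorphM. Qed.

Let scale1 : left_id 1 scale.
Proof. by move=> x; rewrite /scale rmorph1 scale1r. Qed.

Let scaleDr : right_distributive scale +%R.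
Proof. by move=> a x y; rewrite /scale scalerDr. Qed.

Let scaleDl x : {morph scale^~ x : a b / a + b}.
Proof. by move=> a b; rewrite /scale rmorphD scalerDl. Qed.

HB.instance Definition _ :=
  GRing.Zmodule_isLmodule.Build A (restr_scal phi M) scaleA scale1 scaleDr scaleDl.
End RestrictScalars.

Section Functoriality.

Definition restrict_scalars (X : topologicalType) (A B : ringPresheaf X)
  (phi : ringHom A B) (F : modSheaf B) : modSheaf A.
Proof.
refine (@ModSheaf X A (fun U => restr_scal (phi U) (F U) : lmodType (A U))
  (fun U V h s => mres F h s) _ _ _ _ _ _).
- by move=> U V h s t; exact: mresD.
- by move=> U V h a s; rewrite [LHS]mresZ rhom_res.
- by move=> U h s; exact: mres_id.
- by move=> U V W h1 h2 h3 s; exact: mres_comp.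
- by move=> U s t; exact: msec_separated.
- by move=> U I c h s; exact: msec_glue.
Defined.

Definition direct_image_ring (X Y : topologicalType) (p : Y -> X)
  (pc : continuous p) (B : ringPresheaf Y) : ringPresheaf X.
Proof.
refine (@RingPresheaf X (fun U => B (preim_opens pc U))
  (fun U V h => @rres _ B (preim_opens pc U) (preim_opens pc V) (preimage_subset h)) _ _).
- by move=> U h f; exact: rres_id.
- by move=> U V W h1 h2 h3 f; exact: rres_comp.
Defined.

Definition direct_image (X Y : topologicalType) (p : Y -> X)
  (pc : continuous p) (B : ringPresheaf Y) (F : modSheaf B) :
  modSheaf (direct_image_ring pc B).
Proof.
refine (@ModSheaf X (direct_image_ring pc B) (fun U => F (preim_opens pc U))
  (fun U V h => @mres _ _ F (preim_opens pc U) (preim_opens pc V) (preimage_subset h)) _ _ _ _ _ _).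
- by move=> U V h s t; exact: mresD.
- by move=> U V h a s; exact: mresZ.
- by move=> U h s; exact: mres_id.
- by move=> U V W h1 h2 h3 s; exact: mres_comp.
- move=> U s t st; apply: msec_separated => y /st[V [h [Vy e]]].
  by exists (preim_opens pc V), (preimage_subset h).
- move=> U I c h s cov comp.
  apply: (@msec_glue _ _ F (preim_opens pc U) I (fun i => preim_opens pc (c i))
    (fun i => preimage_subset (h i)) s) => [y /cov//|i j W hi hj].
  have Wij : W `<=` preim_opens pc (opensI (c i) (c j)).
    by move=> y Wy; split; [exact: hi|exact: hj].
  have hi' : opensI (c i) (c j) `<=` c i by move=> y [].
  have hj' : opensI (c i) (c j) `<=` c j by move=> y [].
  have := congr1 (@mres _ _ F (preim_opens pc (opensI (c i) (c j))) W Wij)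
    (comp i j _ hi' hj').
  by rewrite /= (@mres_comp _ _ F _ _ _ _ _ hi) (@mres_comp _ _ F _ _ _ _ _ hj).
Defined.

Record ringedMap (X Y : topologicalType) (A : ringPresheaf X)
    (B : ringPresheaf Y) := RingedMap {
  rmap :> Y -> X;
  rmap_continuous : continuous rmap;
  rmap_sharp : ringHom A (direct_image_ring rmap_continuous B) }.

Definition pushforward (X Y : topologicalType) (A : ringPresheaf X)
  (B : ringPresheaf Y) (p : ringedMap A B) (F : modSheaf B) : modSheaf A :=
  restrict_scalars (rmap_sharp p) (direct_image (@rmap_continuous _ _ _ _ p) F).

Definition pushforward_hom (X Y : topologicalType) (A : ringPresheaf X)
  (B : ringPresheaf Y) (p : ringedMap A B) (F G : modSheaf B) (phi : modHom F G)
  (U : opens X) (s : pushforward p F U) : pushforward p G U :=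
  phi (preim_opens (@rmap_continuous _ _ _ _ p) U) s.

(* (G, eta) is p^*F: eta is the unit of the adjunction between p^* and p_*. *)
Definition is_inverse_image (X Y : topologicalType) (A : ringPresheaf X)
    (B : ringPresheaf Y) (p : ringedMap A B) (F : modSheaf A) (G : modSheaf B)
    (eta : modHom F (pushforward p G)) : Prop :=
  forall (H : modSheaf B) (g : modHom F (pushforward p H)),
    exists phi : modHom G H,
      (forall U s, pushforward_hom phi (eta U s) = g U s) /\
      forall psi : modHom G H,
        (forall U s, pushforward_hom psi (eta U s) = g U s) ->
        forall W x, psi W x = phi W x.

Definition const_ring (X : topologicalType) (K : comPzRingType) : ringPresheaf X :=
  @RingPresheaf X (fun=> K) (fun _ _ _ => idfun : {rmorphism K -> K})
    (fun _ _ _ => erefl) (fun _ _ _ _ _ _ _ => erefl).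

Definition locally_constant (X : topologicalType) (U : opens X) (T : Type)
    (f : {x : X | U x} -> T) : Prop :=
  forall x (Ux : U x), \forall y \near x,
    forall Uy : U y, f (exist _ y Uy) = f (exist _ x Ux).

(* Locally isomorphic to a constant sheaf; over W the constant sheaf of value V
   consists of the locally constant functions W -> V. No finiteness condition
   is put on V. *)
Definition local_system (X : topologicalType) (K : comPzRingType)
    (S : modSheaf (const_ring X K)) : Prop :=
  forall x, exists (U : opens X) (V : lmodType K)
    (phi : forall W : opens X, W `<=` U -> S W -> {x : X | W x} -> V),
  [/\ U x,
      forall (W : opens X) (h : W `<=` U) (a : K) s t y,
        phi W h (a *: s + t) y = a *: phi W h s y + phi W h t y,
      forall (W W' : opens X) (h : W `<=` U) (h' : W' `<=` U) (k : W' `<=` W)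
        s y (W'y : W' y),
        phi W' h' (mres S k s) (exist _ y W'y) = phi W h s (exist _ y (k y W'y))
    & forall (W : opens X) (h : W `<=` U),
        injective (phi W h) /\
        forall f, locally_constant f <-> exists s, phi W h s = f].

End Functoriality.

Section Holomorphic.
Variable K : archiNumFieldType.

Record chart (n : nat) (X : topologicalType) := Chart {
  chart_dom : opens X;
  chart_coord : X -> 'rV[K]_n }.

Section StructureSheaf.
Variables (n : nat) (X : topologicalType) (E : set (chart n X)).

(* f is holomorphic on U when, in every chart of the atlas E, it is locally an
   analytic function of the coordinates. *)
Definition holomorphic (U : opens X) : set ({x : X | U x} -> K) :=
  [set f | forall c, E c -> forall x (Ux : U x), chart_dom c x ->
     exists g, analytic_at g (chart_coord c x) /\
       \forall y \near x, forall Uy : U y, f (exist _ y Uy) = g (chart_coord c y)].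

Definition hol_pred (U : opens X) : {pred ({x : X | U x} -> K)} :=
  mem (@holomorphic U).
Arguments hol_pred U : clear implicits.

Lemma hol_subring (U : opens X) : subring_closed (hol_pred U).
Proof.
split=> [|f g|f g].
- rewrite inE => c Ec x Ux cx; exists (fun=> 1); split; first exact: analytic_at_cst.
  by apply: nearW.
- rewrite !inE => hf hg c Ec x Ux cx.
  have [f1 [af ef]] := hf c Ec x Ux cx.
  have [g1 [ag eg]] := hg c Ec x Ux cx.
  exists (fun z => f1 z + -1 * g1 z); split.
    apply: analytic_atD => //; apply: analytic_atM => //; exact: analytic_at_cst.
  apply: filterS2 ef eg => y fy gy Uy.
  by rewrite -[LHS]/(f _ - g _) fy gy mulN1r.
- rewrite !inE => hf hg c Ec x Ux cx.
  have [f1 [af ef]] := hf c Ec x Ux cx.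
  have [g1 [ag eg]] := hg c Ec x Ux cx.
  exists (fun z => f1 z * g1 z); split; first exact: analytic_atM.
  apply: filterS2 ef eg => y fy gy Uy.
  by rewrite -[LHS]/(f _ * g _) fy gy.
Qed.

Record hol (U : opens X) := Hol {
  hol_val :> {x : X | U x} -> K;
  hol_mem : hol_val \in hol_pred U }.

HB.instance Definition _ U := [isSub for @hol_val U].
HB.instance Definition _ U := [Choice of hol U by <:].
HB.instance Definition _ U := GRing.SubChoice_isSubComPzRing.Build _ _ (hol U) (hol_subring U).
End StructureSheaf.
Arguments hol_pred {n X} E U.

Section Pullback.
Variables (n m : nat) (X Y : topologicalType).
Variables (E : set (chart n X)) (E' : set (chart m Y)).

Definition pull (p : Y -> X) (U : opens X) (W : opens Y)
    (h : forall y, W y -> U (p y)) (f : {x : X | U x} -> K) :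
    {y : Y | W y} -> K :=
  fun y => f (exist _ (p (sval y)) (h (sval y) (svalP y))).

Definition preserves_hol (p : Y -> X) : Prop :=
  forall (U : opens X) (W : opens Y) (h : forall y, W y -> U (p y)) f,
    holomorphic E f -> holomorphic E' (pull h f).

Variables (p : Y -> X) (hp : preserves_hol p).
Variables (U : opens X) (W : opens Y) (h : forall y, W y -> U (p y)).

Lemma hol_pull_subproof (f : hol E U) : pull h f \in hol_pred E' W.
Proof. by rewrite inE; apply: hp; have := hol_mem f; rewrite inE. Qed.

Definition hol_pull (f : hol E U) : hol E' W := Hol (hol_pull_subproof f).

Lemma hol_pull_zmod : zmod_morphism hol_pull.
Proof. by move=> f g; apply/val_inj. Qed.

Lemma hol_pull_monoid : monoid_morphism hol_pull.
Proof. by split=> [|f g]; apply/val_inj. Qed.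

HB.instance Definition _ := GRing.isZmodMorphism.Build _ _ hol_pull hol_pull_zmod.
HB.instance Definition _ :=
  GRing.isMonoidMorphism.Build _ _ hol_pull hol_pull_monoid.
End Pullback.

Section StructureSheaf.
Variables (n : nat) (X : topologicalType) (E : set (chart n X)).

Lemma preserves_hol_id : preserves_hol E E (fun x => x).
Proof.
move=> U W h f hf c Ec x Wx cx.
have [g [ag eg]] := hf c Ec x (h x Wx) cx.
exists g; split=> //; apply: filterS eg => y ey Wy; exact: ey.
Qed.

Lemma hol_eq (U : opens X) (f : hol E U) x (a b : U x) :
  f (exist _ x a) = f (exist _ x b).
Proof. by congr (f (exist _ _ _)); apply: Prop_irrelevance. Qed.

Definition hol_sheaf : ringPresheaf X.
Proof.
refine (@RingPresheaf X (fun U => hol E U)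
  (fun U V h => hol_pull preserves_hol_id h : {rmorphism hol E U -> hol E V}) _ _).
- by move=> U h f; apply/val_inj/funext => -[x Ux]; rewrite /= /pull /=; exact: hol_eq.
- by move=> U V W h1 h2 h3 f; apply/val_inj/funext => -[x Ux]; rewrite /= /pull /=; exact: hol_eq.
Defined.

Lemma hol_cst_subproof (U : opens X) (a : K) :
  (fun=> a) \in hol_pred E U.
Proof.
rewrite inE => c _ x _ _; exists (fun=> a); split; first exact: analytic_at_cst.
by apply: nearW.
Qed.

Definition hol_cst (U : opens X) (a : K) : hol E U := Hol (hol_cst_subproof U a).

Lemma hol_cst_zmod U : zmod_morphism (@hol_cst U).
Proof. by move=> a b; apply/val_inj. Qed.

Lemma hol_cst_monoid U : monoid_morphism (@hol_cst U).
Proof. by split=> [|a b]; apply/val_inj. Qed.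

HB.instance Definition _ U := GRing.isZmodMorphism.Build _ _ (@hol_cst U) (hol_cst_zmod U).
HB.instance Definition _ U :=
  GRing.isMonoidMorphism.Build _ _ (@hol_cst U) (hol_cst_monoid U).

Definition cst_hol : ringHom (const_ring X K) hol_sheaf.
Proof.
refine (@RingHom X (const_ring X K) hol_sheaf
  (fun U => @hol_cst U : {rmorphism K -> hol E U}) _).
by move=> U V h a; apply/val_inj.
Defined.
End StructureSheaf.

Section SelfProduct.
Variables (n : nat) (X : topologicalType) (E : set (chart n X)).

Lemma fst_continuous : continuous (@fst X X).
Proof. by move=> x; exact: cvg_fst. Qed.

Lemma snd_continuous : continuous (@snd X X).
Proof. by move=> x; exact: cvg_snd. Qed.

Definition prod_chart (c c' : chart n X) : chart (n + n) (X * X)%type :=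
  Chart (opensI (preim_opens fst_continuous (chart_dom c))
                (preim_opens snd_continuous (chart_dom c')))
        (fun x => row_mx (chart_coord c x.1) (chart_coord c' x.2)).

Definition prod_atlas : set (chart (n + n) (X * X)%type) :=
  [set prod_chart cc.1 cc.2 | cc in E `*` E].

Lemma preserves_hol_fst : preserves_hol E prod_atlas fst.
Proof.
move=> U W h f hf _ [[c c'] [/= Ec Ec'] <-] x Wx [/= cx cx'].
have [g [ag eg]] := hf c Ec _ (h _ Wx) cx.
exists (fun z => g (\row_k z 0 (lshift n k))); split.
  apply: analytic_at_coords; first exact: lshift_inj.
  rewrite (_ : \row_k _ = chart_coord c x.1)//.
  by apply/rowP => k; rewrite mxE row_mxEl.
have : \forall y \near x, forall Uy : U y.1, f (exist _ y.1 Uy) = g (chart_coord c y.1).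
  exact: (fst_continuous eg).
apply: filterS => y ey Wy; rewrite /pull ey; congr g.
by apply/rowP => k; rewrite mxE row_mxEl.
Qed.

Lemma preserves_hol_snd : preserves_hol E prod_atlas snd.
Proof.
move=> U W h f hf _ [[c c'] [/= Ec Ec'] <-] x Wx [/= cx cx'].
have [g [ag eg]] := hf c' Ec' _ (h _ Wx) cx'.
exists (fun z => g (\row_k z 0 (rshift n k))); split.
  apply: analytic_at_coords; first exact: rshift_inj.
  rewrite (_ : \row_k _ = chart_coord c' x.2)//.
  by apply/rowP => k; rewrite mxE row_mxEr.
have : \forall y \near x, forall Uy : U y.2, f (exist _ y.2 Uy) = g (chart_coord c' y.2).
  exact: (snd_continuous eg).
apply: filterS => y ey Wy; rewrite /pull ey; congr g.
by apply/rowP => k; rewrite mxE row_mxEr.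
Qed.

Definition sharp (p : X * X -> X) (pc : continuous p)
  (hp : preserves_hol E prod_atlas p) :
  ringHom (hol_sheaf E) (direct_image_ring pc (hol_sheaf prod_atlas)).
Proof.
refine (@RingHom X (hol_sheaf E) (direct_image_ring pc (hol_sheaf prod_atlas))
  (fun U => hol_pull hp (fun y (Uy : preim_opens pc U y) => Uy)
     : {rmorphism hol E U -> hol prod_atlas (preim_opens pc U)}) _).
by move=> U V h f; apply/val_inj/funext => -[x Ux]; rewrite /= /pull /=; exact: hol_eq.
Defined.

Definition pr1 : ringedMap (hol_sheaf E) (hol_sheaf prod_atlas) :=
  RingedMap (sharp fst_continuous preserves_hol_fst).

Definition pr2 : ringedMap (hol_sheaf E) (hol_sheaf prod_atlas) :=
  RingedMap (sharp snd_continuous preserves_hol_snd).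

(* The ideal of the diagonal in the structure sheaf of X x X. *)
Definition diag_ideal (W : opens (X * X)%type) : set (hol_sheaf prod_atlas W) :=
  [set f : hol prod_atlas W | forall x (h : W (x, x)), f (exist _ (x, x) h) = 0].

End SelfProduct.
End Holomorphic.

(* An analytic manifold of dimension n over K, given by an atlas with holomorphic
   transition functions. *)
Record manifold (K : archiNumFieldType) (n : nat) := Manifold {
  carrier :> topologicalType;
  atlas : set (chart K n carrier);
  manifold_hausdorff : hausdorff_space carrier;
  manifold_countable : @second_countable carrier;
  atlas_cover : forall x, exists2 c, atlas c & chart_dom c x;
  atlas_inj : forall c, atlas c -> {in chart_dom c : set carrier &, injective (chart_coord c)};
  atlas_continuous : forall c, atlas c ->
    forall x, chart_dom c x -> {for x, continuous (chart_coord c)};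
  atlas_open : forall c, atlas c -> forall U : opens carrier,
    U `<=` chart_dom c -> open (chart_coord c @` U);
  atlas_transition : forall c, atlas c -> forall k,
    holomorphic atlas (fun x : {x : carrier | chart_dom c x} =>
                         chart_coord c (sval x) 0 k) }.

Section PrincipalParts.
Variables (K : archiNumFieldType) (n : nat) (X : manifold K n).

Definition OX : ringPresheaf X := hol_sheaf (@atlas _ _ X).
Definition OXX : ringPresheaf (X * X)%type := hol_sheaf (prod_atlas (@atlas _ _ X)).
Definition p1 : ringedMap OX OXX := pr1 (@atlas _ _ X).
Definition p2 : ringedMap OX OXX := pr2 (@atlas _ _ X).

Definition p1_inv (U : opens X) : opens (X * X)%type :=
  preim_opens (@rmap_continuous _ _ _ _ p1) U.
Definition p2_inv (U : opens X) : opens (X * X)%type :=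
  preim_opens (@rmap_continuous _ _ _ _ p2) U.
Definition square (U : opens X) : opens (X * X)%type := opensI (p1_inv U) (p2_inv U).

Lemma square_p1 (U : opens X) : square U `<=` p1_inv U. Proof. by move=> x []. Qed.
Lemma square_p2 (U : opens X) : square U `<=` p2_inv U. Proof. by move=> x []. Qed.

Definition vect_sheaf (F : modSheaf OX) : modSheaf (const_ring X K) :=
  restrict_scalars (cst_hol (@atlas _ _ X)) F.

(* The ingredients of P(L): pp_pull is p2^*L, pp_jet is O_{XxX}/I^2 for I the
   ideal of the diagonal, and pp_mod is their tensor product over O_{XxX}. *)
Record principalParts (L : modSheaf OX) := PrincipalParts {
  pp_pull : modSheaf OXX;
  pp_unit : modHom L (pushforward p2 pp_pull);
  pp_pullP : is_inverse_image pp_unit;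
  pp_jet : modSheaf OXX;
  pp_quot : quotientMap (ideal_sq (@diag_ideal _ _ _ (@atlas _ _ X))) pp_jet;
  pp_mod : modSheaf OXX;
  pp_tens : bilinearMap pp_pull pp_jet pp_mod;
  pp_tensP : is_tensor pp_tens }.

Section Classes.
Variables (L : modSheaf OX) (P : principalParts L).

(* P(L) = p1_*(p2^*L (x) O_{XxX}/I^2), an O_X-module through p1. *)
Definition pp_sheaf : modSheaf OX := pushforward p1 (pp_mod P).

(* The section of P(L) over U given by p2^*u (x) [g], for g a function on U x U.
   A section of P(L) over U is a section of pp_mod over p1^-1(U) = U x X; since
   pp_mod vanishes off the diagonal it is determined, uniquely, by its
   restriction to U x U, which is where p2^*u and g are both defined. *)
Definition pp_class (U : opens X) (u : L U) (g : OXX (square U)) : pp_sheaf U :=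
  xget 0 [set s : pp_mod P (p1_inv U) |
    mres (pp_mod P) (@square_p1 U) s =
    pp_tens P (square U)
      (mres (pp_pull P) (@square_p2 U) (pp_unit P U u : pp_pull P (p2_inv U)))
      (pp_quot P (square U) g)].

(* The universal derivation d_L. *)
Definition pp_deriv (U : opens X) (u : L U) : pp_sheaf U := pp_class u 1.

(* The image of df (x) u under the inclusion of Omega^1 (x) L in P(L), where df is
   the class of p2^*f - p1^*f in I/I^2 = Omega^1. *)
Definition pp_differential (U : opens X) (f : OX U) (u : L U) : pp_sheaf U :=
  pp_class u (rres OXX (@square_p2 U) (rmap_sharp p2 U f) -
              rres OXX (@square_p1 U) (rmap_sharp p1 U f)).
End Classes.

(* P_0(L) = P(L) (x) L^-1. *)
Record normalizedParts (L : modSheaf OX) := NormalizedParts {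
  np_parts : principalParts L;
  np_dual : dual L;
  np_mod :> modSheaf OX;
  np_tens : bilinearMap (pp_sheaf np_parts) np_dual np_mod;
  np_tensP : is_tensor np_tens }.

Section Dlog.
Variables (L : modSheaf OX) (P0 : normalizedParts L).

Definition dlog (U : opens X) (u : L U) : P0 U :=
  np_tens P0 U (pp_deriv (np_parts P0) u) (dual_inv (np_dual P0) u).

(* df, in the image of Omega^1 in P_0(L), computed as (df (x) u) (x) u^-1 for a
   local generator u; it does not depend on u. *)
Definition np_differential (U : opens X) (f : OX U) (u : L U) : P0 U :=
  np_tens P0 U (pp_differential (np_parts P0) f u) (dual_inv (np_dual P0) u).
End Dlog.

Definition rcons_fun (T : Type) (i : nat) (s : 'I_i -> T) (x : T) (k : 'I_i.+1) : T :=
  if unlift ord_max k is Some k' then s k' else x.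

(* The complex P_j(L): ppc_term i is the tensor product of the i-th exterior power
   of P_0(L) with L^j. The differential is K-linear, not O-linear, and ppc_dE
   characterizes it because sections of the form on its left-hand side locally
   generate ppc_term i additively. Only degrees 0 to n+1 belong to the complex. *)
Record ppComplex (L : modSheaf OX) (j : nat) := PPComplex {
  ppc_parts : normalizedParts L;
  ppc_ext : nat -> modSheaf OX;
  ppc_wedge : forall i, multilinearMap i ppc_parts (ppc_ext i);
  ppc_wedgeP : forall i, is_exterior_power (ppc_wedge i);
  ppc_pow : modSheaf OX;
  ppc_power : multilinearMap j L ppc_pow;
  ppc_powerP : is_tensor_power ppc_power;
  ppc_term : nat -> modSheaf OX;
  ppc_tens : forall i, bilinearMap (ppc_ext i) ppc_pow (ppc_term i);
  ppc_tensP : forall i, is_tensor (ppc_tens i);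
  ppc_d : forall i, modHom (vect_sheaf (ppc_term i)) (vect_sheaf (ppc_term i.+1));
  ppc_dE : forall i, (i <= n)%N -> forall (U : opens X) (f : OX U)
      (u : 'I_i -> L U) (v : L U),
    (forall k, local_generator (u k)) -> local_generator v ->
    let w := fun k => dlog ppc_parts (u k) in
    let vj := ppc_power U (fun=> v) in
    ppc_d i U (f *: ppc_tens i U (ppc_wedge i U w) vj) =
    ppc_tens i.+1 U
      (ppc_wedge i.+1 U (rcons_fun w
         (np_differential ppc_parts f v + (j%:R * f) *: dlog ppc_parts v)))
      vj }.

(* The complex P_j(L) (x)_K S, with differential d (x) id_S. *)
Record twistedComplex (L : modSheaf OX) (j : nat) (C : ppComplex L j)
    (S : modSheaf (const_ring X K)) := TwistedComplex {
  tw_term : nat -> modSheaf (const_ring X K);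
  tw_tens : forall i, bilinearMap (vect_sheaf (ppc_term C i)) S (tw_term i);
  tw_tensP : forall i, is_tensor (tw_tens i);
  tw_d : forall i, modHom (tw_term i) (tw_term i.+1);
  tw_dE : forall i (U : opens X) (a : vect_sheaf (ppc_term C i) U) (s : S U),
    tw_d i U (tw_tens i U a s) = tw_tens i.+1 U (ppc_d C i U a) s }.
End PrincipalParts.

Section ComplexArchi.
Variable R : realType.
Lemma complex_archimedean : Num.archimedean_axiom R[i].
Proof.
move=> x; exists (Num.bound (complex.Re `|x|)).
have -> : `|x| = (complex.Re `|x|)%:C%C by rewrite RRe_real ?normr_real.
rewrite -[_%:R](rmorph_nat (real_complex R)) ltcR.
by apply: archi_boundP; rewrite -lecR RRe_real ?normr_real//; exact: normr_ge0.
Qed.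
HB.instance Definition _ := Num.NumDomain_bounded_isArchimedean.Build R[i] complex_archimedean.
End ComplexArchi.

Definition complexManifold (R : realType) (n : nat) := manifold R[i] n.

(* Main.v *)
(** The projection pi : P_0(L) -> O_X is the O_X-linear map with pi (dlog u) = 1
    and pi (df) = 0. Contraction by pi lowers the exterior degree by one, and on
    generators the resulting map h satisfies d h + h d = j; hence h / j is a
    contracting homotopy, and so is h / j (x) id_S after tensoring with S.

    In the top degree this requires wedge^(n+2) P_0(L) = 0, that is, n + 1 local
    sections dlog u spanning P_0(L). They come from Hadamard's lemma for power
    series: near the diagonal, every function of (x, y) is congruent modulo I^2 to
    a(x) + sum_k b_k(x) (y_k - x_k). The rest of the analysis shows that sections
    of O_{XxX} / I^2 vanish off the diagonal and have a value on it.

    If f is a unit then df = f dlog(fv) - f dlog(v) is again a combination of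
    dlog's, on which d d = 0 follows from the alternation of the wedge; an
    arbitrary f is locally a sum of two functions each of which is a unit or 0. *)
From HB Require Import structures.
Require Import Defs.
From mathcomp Require Import all_boot all_order perm all_algebra complex.
From mathcomp Require Import boolp classical_sets reals topology normedtype.
From mathcomp Require Import ring lra.
Set Implicit Arguments.
Unset Strict Implicit.
Unset Printing Implicit Defensive.
Import Order.TTheory GRing.Theory Num.Theory.
Import numFieldNormedType.Exports.
Local Open Scope classical_set_scope.
Local Open Scope ring_scope.

(** * Convergent power series *)

(** Tensor products, exterior powers and inverse images are given only by universal properties, so a
    statement about all their sections is proved for a subsheaf of modules that contains the
    generators: the universal map corestricts to it, and uniqueness shows that the subsheaf is
    everything. The differential is merely additive, so for the homotopy formula the coefficient [f]
    has to be part of the generator [f dlog(u_1) ... dlog(u_i) v^j].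

    Contraction carries the sign [(-1)^(i+k)] at slot [k] because the differential appends its new
    factor on the right. In [d h + h d] everything then cancels except the term that contracts the
    new factor, and [pi (df + j f dlog v) = j f].

    The homotopy shows that cocycles are boundaries. That boundaries are cocycles needs a separate
    argument, since [d d = 0] is not among the data of [ppComplex].

    In the analysis the scalars form an abstract archimedean field whose order is partial. Limits
    are therefore handled through error bounds [C / 2 ^ N], and completeness is a single hypothesis
    about sequences with such bounds. *)

Section Series.
Variable K : archiNumFieldType.

(** The order of [K] is only partial, so a proof by contradiction first needs [C] and [x - y] to be
    real. The instances [m = 0] and [m = 1] give this: their difference shows that [C / 2] is
    real. *)
Lemma le_geo (x y C : K) : (forall m, x <= y + C / 2 ^+ m) -> x <= y.
Proof.
move=> H; have H0 m : x - y <= C / 2 ^+ m by rewrite lerBlDl.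
rewrite -subr_le0; have := H0 0%N; rewrite expr0 divr1 => xyC.
have p2 m : 0 < (2 : K) ^+ m by rewrite exprn_gt0.
have Cr : C \is Num.real.
  have h01 : C - C / 2 ^+ 1 \is Num.real.
    have -> : C - C / 2 ^+ 1 = C / 2 ^+ 1 by rewrite expr1; field.
    have r1 := H0 1%N.
    have e0 : (C - (x - y)) \is Num.real by rewrite ger0_real// subr_ge0.
    have e1 : (C / 2 ^+ 1 - (x - y)) \is Num.real by rewrite ger0_real// subr_ge0.
    have -> : C / 2 ^+ 1 = (C - (x - y)) - (C / 2 ^+ 1 - (x - y)).
      by rewrite expr1; field.
    exact: rpredB.
  have -> : C = 2 * (C - C / 2 ^+ 1) by rewrite expr1; field.
  by rewrite rpredM// realn.
have dr : x - y \is Num.real.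
  have e0 : (C - (x - y)) \is Num.real by rewrite ger0_real// subr_ge0.
  have -> : x - y = C - (C - (x - y)) by ring.
  exact: rpredB.
rewrite real_leNgt ?real0//; apply/negP => d0.
have Cp : 0 < C by apply: lt_le_trans d0 xyC.
have := archi_boundP (ltW (divr_gt0 Cp d0)).
set m := Num.bound _ => hm.
have : C / (x - y) < 2 ^+ m.
  by apply: lt_trans hm _; rewrite -natrX ltr_nat ltn_expl.
rewrite ltr_pdivrMr// mulrC -ltr_pdivrMr// => lt.
by have := lt_le_trans lt (H0 m); rewrite ltxx.
Qed.

Lemma box_sum_widen n (a : ('I_n -> nat) -> K) (h : 'rV[K]_n) N N' : (N <= N')%N ->
  box_sum a h N = \sum_(v : {ffun 'I_n -> 'I_N'} | [forall k, v k < N]%N)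
    a (fun k => v k) * \prod_k h 0 k ^+ v k.
Proof.
case: N => [|N] NN'.
  (* In dimension 0 there is exactly one multi-index, even with values in ['I_0], so the sum over
     the box of size 0 is the constant term and not 0. *)
  case: n a h => [|n] a h.
    rewrite /box_sum; have E (M : nat) (P : pred {ffun 'I_0 -> 'I_M}) :
      P =1 xpredT ->
      \sum_(v : {ffun 'I_0 -> 'I_M} | P v) a (fun k => v k) * \prod_k h 0 k ^+ v k
      = a (fun=> 0%N).
      move=> PT; pose v0 : {ffun 'I_0 -> 'I_M} := [ffun k : 'I_0 => False_rect _
        (notF (ltn_ord k))].
      rewrite (big_pred1 v0) => [|v].
        by rewrite big_ord0 mulr1; congr a; apply/funext => -[].
      rewrite PT/= (_ : v == v0 = true)//; by apply/eqP/ffunP => -[].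
    by rewrite !E// => v; apply/forallP => -[].
  rewrite /box_sum !big1// => v.
    by move=> /forallP/(_ ord0).
  by case: (v ord0).
pose f (v : {ffun 'I_n -> 'I_N.+1}) : {ffun 'I_n -> 'I_N'} :=
  [ffun k => widen_ord NN' (v k)].
pose g (v : {ffun 'I_n -> 'I_N'}) : {ffun 'I_n -> 'I_N.+1} :=
  [ffun k => inord (v k)].
rewrite (reindex_onto f g)/=.
  rewrite /box_sum; apply: eq_big => v.
    symmetry; apply/andP; split; first by apply/forallP => k; rewrite ffunE/=.
    by apply/eqP/ffunP => k; rewrite !ffunE/= inord_val.
  move=> _; congr (a _ * _); first by apply/funext => k; rewrite ffunE.
  by apply: eq_bigr => k _; rewrite ffunE.
move=> v /forallP vN; apply/ffunP => k; rewrite !ffunE; apply/val_inj => /=.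
by rewrite inordK.
Qed.

Lemma notin_box_deg n N M (v : {ffun 'I_n -> 'I_M}) :
  ~~ [forall k, v k < N]%N -> (N <= \sum_k v k)%N.
Proof.
move=> /forallPn[k]; rewrite -leqNgt => /leq_trans; apply.
by rewrite (bigD1 k)//= leq_addr.
Qed.

(** A bound on the weighted l1 norm of the coefficients at radius [s]. Unlike the Cauchy bound in
    [analytic_at], this norm is submultiplicative, so products, powers and geometric series can be
    estimated without losing radius. *)
Definition l1_bound n (s B : K) (a : ('I_n -> nat) -> K) : Prop :=
  forall N, box_sum (fun v => `|a v|) (const_mx s) N <= B.

Lemma l1E n (s : K) (a : ('I_n -> nat) -> K) N :
  box_sum (fun v => `|a v|) (const_mx s) N =
  \sum_(v : {ffun 'I_n -> 'I_N}) `|a (fun k => v k)| * s ^+ (\sum_k v k)%N.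
Proof.
apply: eq_bigr => v _; congr (_ * _); rewrite expr_sum.
by apply: eq_bigr => k _; rewrite mxE.
Qed.

Lemma l1_sub n (s B : K) (a : ('I_n -> nat) -> K) N
    (P : pred {ffun 'I_n -> 'I_N}) : 0 <= s -> l1_bound s B a ->
  \sum_(v | P v) `|a (fun k => v k)| * s ^+ (\sum_k v k)%N <= B.
Proof.
move=> s0 /(_ N); rewrite l1E; apply: le_trans.
rewrite big_mkcond/=; apply: ler_sum => v _; case: ifP => // _.
by rewrite mulr_ge0 ?exprn_ge0.
Qed.

Lemma l1_term n (s B : K) (a : ('I_n -> nat) -> K) (v : 'I_n -> nat) :
  0 <= s -> l1_bound s B a -> `|a v| * s ^+ (\sum_k v k)%N <= B.
Proof.
move=> s0 aB; pose w : {ffun 'I_n -> 'I_(\sum_k v k).+1} := [ffun k => inord (v k)].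
have wE k : w k = v k :> nat.
  by rewrite ffunE inordK// ltnS (bigD1 k)//= leq_addr.
have := l1_sub (pred1 w) s0 aB; rewrite big_pred1_eq.
rewrite (_ : (fun k => _) = v); last by apply/funext.
by under eq_bigr do rewrite wE.
Qed.

Lemma l1_ge0 n (s B : K) (a : ('I_n -> nat) -> K) :
  0 <= s -> l1_bound s B a -> 0 <= B.
Proof.
move=> s0 /(_ 0%N); apply: le_trans; rewrite l1E; apply: sumr_ge0 => v _.
by rewrite mulr_ge0 ?exprn_ge0.
Qed.

Lemma mono_le n (s : K) (h : 'rV[K]_n) (v : 'I_n -> nat) : 0 < s ->
  (forall k, `|h 0 k| <= s / 2) ->
  `|\prod_k h 0 k ^+ v k| <= s ^+ (\sum_k v k)%N / 2 ^+ (\sum_k v k)%N.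
Proof.
move=> s0 hs; rewrite normr_prod -expr_div_n expr_sum; apply: ler_prod => k _.
rewrite normr_ge0/= normrX; apply: lerXn2r; rewrite ?nnegrE//.
by rewrite divr_ge0// ltW.
Qed.

(** At half the radius a monomial of degree at least [D] is smaller than its weight in the l1 norm
    by a factor [2 ^ D]. All geometric rates below come from here. *)
Lemma l1_tail n (s B : K) (a : ('I_n -> nat) -> K) (h : 'rV[K]_n) D N
    (P : pred {ffun 'I_n -> 'I_N}) : 0 < s -> l1_bound s B a ->
  (forall k, `|h 0 k| <= s / 2) -> (forall v, P v -> D <= \sum_k v k)%N ->
  `|\sum_(v | P v) a (fun k => v k) * \prod_k h 0 k ^+ v k| <= B / 2 ^+ D.
Proof.
move=> s0 aB hs PD; apply: le_trans (ler_norm_sum _ _ _) _.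
have p0 : 0 <= (2 ^+ D : K)^-1 by rewrite invr_ge0 exprn_ge0.
apply: le_trans (ler_wpM2r p0 (l1_sub P (ltW s0) aB)).
rewrite mulr_suml; apply: ler_sum => v Pv; rewrite normrM -mulrA.
apply: ler_wpM2l => //; apply: le_trans (mono_le _ s0 hs) _.
apply: ler_wpM2l; first by rewrite exprn_ge0 ?(ltW s0).
by rewrite lef_pV2 ?posrE ?exprn_gt0// ler_weXn2l ?ler1n// PD.
Qed.

Lemma box_sum_tail n (s B : K) (a : ('I_n -> nat) -> K) (h : 'rV[K]_n) N N' : 0 < s ->
  l1_bound s B a -> (forall k, `|h 0 k| <= s / 2) -> (N <= N')%N ->
  `|box_sum a h N' - box_sum a h N| <= B / 2 ^+ N.
Proof.
move=> s0 aB hs NN'; rewrite (box_sum_widen _ _ NN') {1}/box_sum.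
rewrite (bigID (fun v : {ffun 'I_n -> 'I_N'} => [forall k, v k < N]%N))/= addrC addrK.
exact: (@l1_tail _ _ _ _ h N _ (fun v : {ffun 'I_n -> 'I_N'} => ~~ [forall k, v k < N]%N) s0 aB hs (@notin_box_deg _ _ _)).
Qed.

Lemma box_sum_le n (s B : K) (a : ('I_n -> nat) -> K) (h : 'rV[K]_n) N : 0 < s ->
  l1_bound s B a -> (forall k, `|h 0 k| <= s / 2) -> `|box_sum a h N| <= B.
Proof.
move=> s0 aB hs; rewrite -[B]divr1 -(expr0 2).
exact: (@l1_tail _ _ _ _ h 0 _ xpredT s0 aB hs (fun _ _ => leq0n _)).
Qed.

(* An explicit rate replaces convergence: [f] is, on the polydisc of radius
   [s / 2], the sum of a series absolutely summable at radius [s]. *)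
Definition has_series n (s B : K) (a : ('I_n -> nat) -> K) (f : 'rV[K]_n -> K) :=
  l1_bound s B a /\ forall h : 'rV[K]_n, (forall k, `|h 0 k| <= s / 2) ->
    forall N, `|f h - box_sum a h N| <= B / 2 ^+ N.

(** The constant of the rate is free: between the boxes [N] and [N + m] the l1 bound controls the
    tail by [B / 2 ^ N], and any geometric rate makes the remaining error vanish as [m] grows. *)
Lemma has_seriesI n (s B : K) (a : ('I_n -> nat) -> K) (f : 'rV[K]_n -> K) :
  0 < s -> l1_bound s B a ->
  (forall h : 'rV[K]_n, (forall k, `|h 0 k| <= s / 2) ->
    exists C : K, forall N, `|f h - box_sum a h N| <= C / 2 ^+ N) ->
  has_series s B a f.
Proof.
move=> s0 aB fa; split=> // h hs N; have [C fC] := fa h hs.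
apply: (@le_geo _ _ C) => m.
have -> : f h - box_sum a h N = (box_sum a h (N + m)%N - box_sum a h N) +
   (f h - box_sum a h (N + m)%N) by ring.
apply: le_trans (ler_normD _ _) _; apply: lerD.
  by apply: (box_sum_tail s0 aB) => //; rewrite leq_addr.
have C0 : 0 <= C.
  by have := fC 0%N; rewrite expr0 divr1; apply: le_trans.
apply: le_trans (fC _) _; apply: ler_wpM2l => //.
by rewrite lef_pV2 ?posrE ?exprn_gt0// ler_weXn2l ?ler1n ?leq_addl.
Qed.

Lemma has_series_le n (s B : K) (a : ('I_n -> nat) -> K) f (h : 'rV[K]_n) : 0 < s ->
  has_series s B a f -> (forall k, `|h 0 k| <= s / 2) -> `|f h| <= B.
Proof.
move=> s0 [aB fa] hs; apply: (@le_geo _ _ B) => m.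
have -> : f h = box_sum a h m + (f h - box_sum a h m) by ring.
by apply: le_trans (ler_normD _ _) _; apply: lerD; [exact: (box_sum_le _ s0)|exact: fa].
Qed.

Definition ser n (s B : K) (f : 'rV[K]_n -> K) := exists a, has_series s B a f.

Lemma ser_ext n (s B : K) (f g : 'rV[K]_n -> K) :
  (forall h : 'rV[K]_n, (forall k, `|h 0 k| <= s / 2) -> f h = g h) ->
  ser s B f -> ser s B g.
Proof. by move=> fg [a [aB fa]]; exists a; split=> // h hs N; rewrite -fg ?fa. Qed.

Lemma ser_weaken n (s B B' : K) (f : 'rV[K]_n -> K) : B <= B' ->
  ser s B f -> ser s B' f.
Proof.
move=> BB' [a [aB fa]]; exists a; split=> [N|h hs N]; first exact: le_trans BB'.
apply: le_trans (fa h hs N) _; apply: ler_wpM2r => //.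
by rewrite invr_ge0 exprn_ge0.
Qed.

Lemma box_sumD n (a b : ('I_n -> nat) -> K) h N :
  box_sum (fun v => a v + b v) h N = box_sum a h N + box_sum b h N.
Proof. by rewrite /box_sum -big_split; apply: eq_bigr => v _; rewrite mulrDl. Qed.

Lemma box_sumZ n (c : K) (a : ('I_n -> nat) -> K) (h : 'rV[K]_n) N :
  box_sum (fun v => c * a v) h N = c * box_sum a h N.
Proof. by rewrite /box_sum mulr_sumr; apply: eq_bigr => v _; rewrite mulrA. Qed.

Lemma l1_mono n (s : K) (a b : ('I_n -> nat) -> K) N : 0 <= s ->
  (forall v, a v <= b v) ->
  box_sum a (const_mx s) N <= box_sum b (const_mx s) N.
Proof.
move=> s0 ab; apply: ler_sum => v _; apply: ler_wpM2r => //.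
by apply: prodr_ge0 => k _; rewrite mxE exprn_ge0.
Qed.

Lemma serD n (s B C : K) (f g : 'rV[K]_n -> K) : 0 < s ->
  ser s B f -> ser s C g -> ser s (B + C) (fun h => f h + g h).
Proof.
move=> s0 [a [aB fa]] [b [bC gb]]; exists (fun v => a v + b v); split=> [N|h hs N].
  apply: le_trans (lerD (aB N) (bC N)); rewrite -box_sumD; apply: l1_mono => [|v].
    exact: ltW.
  exact: ler_normD.
rewrite box_sumD opprD addrACA mulrDl.
by apply: le_trans (ler_normD _ _) _; apply: lerD; [exact: fa|exact: gb].
Qed.

Lemma serZ n (s B c : K) (f : 'rV[K]_n -> K) :
  ser s B f -> ser s (`|c| * B) (fun h => c * f h).
Proof.
move=> [a [aB fa]]; exists (fun v => c * a v); split=> [N|h hs N].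
  under [X in box_sum X]funext do rewrite normrM.
  by rewrite box_sumZ; apply: ler_wpM2l.
by rewrite box_sumZ -mulrBr normrM -mulrA; apply: ler_wpM2l => //; exact: fa.
Qed.

Lemma ser_cst n (s c : K) : ser s `|c| (fun=> c : K) (n := n).
Proof.
pose a (v : 'I_n -> nat) := if [forall k, v k == 0%N] then c else 0.
have E (b : K) (h : 'rV[K]_n) N :
    box_sum (fun v => if [forall k, v k == 0%N] then b else 0) h N =
    if (N == 0%N) && (n != 0%N) then 0 else b.
  case: N => [|N] /=.
    case: n a h => [|n] a h /=.
      rewrite (@box_sum_widen _ _ _ 0 1)// /box_sum (big_pred1 [ffun=> ord0]).
        rewrite big_ord0 mulr1 ifT//; apply/forallP => -[]//.
      move=> v; rewrite /= (_ : v == _ = true).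
        by apply/forallP => -[].
      by apply/eqP/ffunP => -[].
    by rewrite /box_sum big1// => v; case: (v ord0).
  rewrite /box_sum (bigD1 [ffun=> ord0])//= [X in _ + X]big1 => [|v vn0].
    rewrite ifT; last by apply/forallP => k; rewrite ffunE.
    by rewrite big1 ?mulr1 ?addr0// => k _; rewrite ffunE expr0.
  case: ifPn => [/forallP v0|]; last by rewrite mul0r.
  case/eqP: vn0; apply/ffunP => k; rewrite ffunE; apply/val_inj/eqP.
  exact: v0.
exists a; split=> [N|h hs N].
  rewrite (_ : (fun v => _) =
    (fun v => if [forall k, v k == 0%N] then `|c| else 0)).
    by rewrite E; case: ifP.
  by apply/funext => v; rewrite /a; case: ifP => //; rewrite normr0.
rewrite /a E; case: N => [|N]/=; last by rewrite subrr normr0 divr_ge0 ?exprn_ge0.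
by case: ifP => _; rewrite expr0 divr1 ?subr0// subrr normr0.
Qed.

Lemma ser_sum (I : Type) (r : seq I) (P : pred I) n (s : K) (B : I -> K)
    (f : I -> 'rV[K]_n -> K) : 0 < s ->
  (forall i, P i -> ser s (B i) (f i)) ->
  ser s (\sum_(i <- r | P i) B i) (fun h => \sum_(i <- r | P i) f i h).
Proof.
move=> s0 Bf; elim: r => [|i r IH].
  rewrite big_nil; apply: ser_ext (_ : ser s 0 (fun=> 0)).
    by move=> h _; rewrite big_nil.
  by have := @ser_cst n s 0; rewrite normr0.
rewrite big_cons; case: ifP => Pi.
  apply: ser_ext (serD s0 (Bf i Pi) IH) => h _; by rewrite big_cons Pi.
by apply: ser_ext IH => h _; rewrite big_cons Pi.
Qed.

(** The weighted l1 norm is submultiplicative for the Cauchy product. The product of two box sums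
    exceeds the box sum of [conv a b] by the pairs [(u, w)] with some [u k + w k >= N]; their total
    degree is at least [N], which gives the third error [B * C / 2 ^ N]. *)
Lemma serM n (s B C : K) (f g : 'rV[K]_n -> K) : 0 < s ->
  ser s B f -> ser s C g -> ser s (B * C) (fun h => f h * g h).
Proof.
move=> s0 [a fa] [b gb]; exists (conv a b).
have [aB _] := fa; have [bC _] := gb.
have B0 := l1_ge0 (ltW s0) aB; have C0 := l1_ge0 (ltW s0) bC.
apply: has_seriesI => // [N|h hs].
  apply: le_trans (ler_pM _ _ (aB N) (bC N)).
  - apply: le_trans (_ : box_sum (conv (fun v => `|a v|) (fun v => `|b v|)) (const_mx s) N <= _).
      apply: l1_mono => [|v]; first exact: ltW.
      apply: le_trans (ler_norm_sum _ _ _) _.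
      by apply: ler_sum => u _; rewrite normrM.
    rewrite box_sum_conv /box_sum mulr_suml; apply: ler_sum => u _.
    rewrite mulr_sumr big_mkcond/=; apply: ler_sum => w _.
    case: ifP => // _; rewrite !mulr_ge0 ?prodr_ge0// => k _; by rewrite mxE exprn_ge0 ?(ltW s0).
  - by rewrite l1E sumr_ge0// => v _; rewrite mulr_ge0 ?exprn_ge0 ?(ltW s0).
  - by rewrite l1E sumr_ge0// => v _; rewrite mulr_ge0 ?exprn_ge0 ?(ltW s0).
exists (B * C + B * C + B * C) => N.
have fB : `|f h| <= B := has_series_le s0 fa hs.
have gC : `|g h| <= C := has_series_le s0 gb hs.
have -> : f h * g h - box_sum (conv a b) h N =
   f h * (g h - box_sum b h N) + (f h - box_sum a h N) * box_sum b h N +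
   (box_sum a h N * box_sum b h N - box_sum (conv a b) h N) by ring.
rewrite [leRHS]mulrDl [X in _ <= X + _]mulrDl.
apply: le_trans (ler_normD _ _) _; apply: lerD.
  apply: le_trans (ler_normD _ _) _; apply: lerD.
    by rewrite normrM -mulrA; apply: ler_pM => //; apply: gb.2.
  rewrite normrM mulrAC; apply: ler_pM => //; first exact: fa.2.
  exact: (box_sum_le _ s0 bC).
rewrite box_sum_conv {1 2}/box_sum mulr_suml -sumrB.
apply: le_trans (ler_norm_sum _ _ _) _.
have Eu (u : {ffun 'I_n -> 'I_N}) :
  `|a (fun k => u k) * \prod_k h 0 k ^+ u k *
     (\sum_(w : {ffun 'I_n -> 'I_N}) b (fun k => w k) * \prod_k h 0 k ^+ w k) -
   \sum_(w : {ffun 'I_n -> 'I_N} | [forall k, u k + w k < N]%N)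
     (a (fun k => u k) * \prod_k h 0 k ^+ u k) *
     (b (fun k => w k) * \prod_k h 0 k ^+ w k)| <=
  `|a (fun k => u k)| * s ^+ (\sum_k u k)%N * (C / 2 ^+ N).
  rewrite mulr_sumr (bigID (fun w : {ffun 'I_n -> 'I_N} => [forall k, u k + w k < N]%N))/=.
  rewrite addrC addrK -mulr_sumr normrM.
  set P := (X in \sum_(w | X w) _); have PN (w : {ffun 'I_n -> 'I_N}) : P w ->
      (N - \sum_k u k <= \sum_k w k)%N.
    move=> /forallPn[k]; rewrite -leqNgt leq_subLR -big_split/= => /leq_trans.
    by apply; rewrite (bigD1 k)//= leq_addr.
  have bP := @l1_tail _ _ _ _ h _ _ P s0 bC hs PN.
  have au : `|a (fun k => u k) * \prod_k h 0 k ^+ u k| <=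
      `|a (fun k => u k)| * (s ^+ (\sum_k u k)%N / 2 ^+ (\sum_k u k)%N).
    by rewrite normrM; apply: ler_wpM2l => //; exact: mono_le s0 hs.
  apply: le_trans (ler_pM _ _ au bP) _ => //.
  rewrite -!mulrA; apply: ler_wpM2l => //; apply: ler_wpM2l.
    by rewrite exprn_ge0 ?(ltW s0).
  rewrite mulrCA; apply: ler_wpM2l => //.
  rewrite -invfM -exprD lef_pV2 ?posrE ?exprn_gt0// ler_weXn2l ?ler1n//.
  by rewrite -leq_subLR.
apply: le_trans (ler_sum _ (fun u _ => Eu u)) _.
rewrite -mulr_suml -mulrA; apply: ler_wpM2r; first by rewrite divr_ge0 ?exprn_ge0.
by rewrite -l1E.
Qed.

Lemma serX n (s B : K) (f : 'rV[K]_n -> K) e : 0 < s ->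
  ser s B f -> ser s (B ^+ e) (fun h => f h ^+ e).
Proof.
move=> s0 fB; elim: e => [|e IH].
  by have := @ser_cst n s 1; rewrite normr1.
by rewrite exprS; apply: ser_ext (serM s0 fB IH) => h _; rewrite exprS.
Qed.

Lemma ser_prod (I : Type) (r : seq I) n (s : K) (B : I -> K)
    (f : I -> 'rV[K]_n -> K) : 0 < s ->
  (forall i, ser s (B i) (f i)) ->
  ser s (\prod_(i <- r) B i) (fun h => \prod_(i <- r) f i h).
Proof.
move=> s0 Bf; elim: r => [|i r IH].
  have := @ser_cst n s 1; rewrite normr1 big_nil.
  by apply: ser_ext => h _; rewrite big_nil.
by rewrite big_cons; apply: ser_ext (serM s0 (Bf i) IH) => h _; rewrite big_cons.
Qed.

(** Every nonconstant term gains at least one factor [s / s0], so on a small polydisc the norm comes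
    close to the absolute value of the constant term. *)
Lemma l1_shrink n (s s0 B : K) (a : ('I_n -> nat) -> K) : 0 < s -> s <= s0 ->
  l1_bound s0 B a -> l1_bound s (`|a (fun=> 0%N)| + s / s0 * B) a.
Proof.
move=> sp ss0 aB N; have s0p : 0 < s0 := lt_le_trans sp ss0.
rewrite l1E (bigID (fun v : {ffun 'I_n -> 'I_N} => [forall k, v k == 0%N :> nat]))/=.
apply: lerD.
  case: (pickP (fun v : {ffun 'I_n -> 'I_N} => [forall k, v k == 0%N :> nat])) => [v v0|v0].
    rewrite (big_pred1 v).
      have vE k : v k = 0%N :> nat by apply/eqP; move/forallP: v0; apply.
      rewrite big1 ?expr0 ?mulr1 => [|k _]; last exact: vE.
      by rewrite le_eqVlt; apply/orP; left; apply/eqP; congr `|a _|; apply/funext.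
    move=> w /=; apply/idP/eqP => [w0|->//]; apply/ffunP => k; apply/val_inj => /=.
    by rewrite (eqP (forallP v0 k)) (eqP (forallP w0 k)).
  by rewrite big_pred0.
apply: le_trans (ler_wpM2l _ (l1_sub (fun v : {ffun 'I_n -> 'I_N} =>
  ~~ [forall k, v k == 0%N :> nat]) (ltW s0p) aB)); last first.
  by rewrite divr_ge0 ?(ltW sp) ?(ltW s0p).
rewrite mulr_sumr; apply: ler_sum => v /forallPn[k vk].
rewrite mulrCA; apply: ler_wpM2l => //.
have : (0 < \sum_k v k)%N.
  by rewrite (bigD1 k)//= addn_gt0 lt0n vk.
case: (\sum_k v k)%N => // d _.
rewrite !exprS mulrA divfK ?gt_eqF//; apply: ler_wpM2l; first exact: ltW.
exact: real_bound_le.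
Qed.

Lemma has_series0 n (s B : K) (a : ('I_n -> nat) -> K) f : 0 < s ->
  has_series s B a f -> a (fun=> 0%N) = f 0.
Proof.
move=> s0 [aB fa]; apply/eqP; rewrite eq_sym -subr_eq0 -normr_le0.
apply: (@le_geo _ _ B) => m; rewrite add0r.
have h0 k : `|(0 : 'rV[K]_n) 0 k| <= s / 2.
  by rewrite mxE normr0 divr_ge0// ltW.
(* The box of size 0 may be empty; from size 1 on, the box sum at the origin is the constant
   term. *)
have := fa 0 h0 m.+1; rewrite (_ : box_sum _ _ _ = a (fun=> 0%N)).
  move=> /le_trans; apply; apply: ler_wpM2l; first exact: l1_ge0 (ltW s0) aB.
  by rewrite lef_pV2 ?posrE ?exprn_gt0// ler_weXn2l ?ler1n.
rewrite /box_sum (bigD1 [ffun=> ord0])//= [X in _ + X]big1 => [|v vn0].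
  rewrite big1 ?mulr1 ?addr0 => [|k _]; last by rewrite ffunE expr0.
  by congr a; apply/funext => k; rewrite ffunE.
have [k vk] : exists k, v k != ord0.
  apply/existsP; apply: contraNT vn0; rewrite negb_exists => /forallP v0.
  by apply/eqP/ffunP => k; rewrite ffunE; apply/eqP/negPn/v0.
rewrite (bigD1 k)//= mxE expr0n (_ : (_ == 0%N :> nat) = false).
  by rewrite mul0r mulr0.
by apply: contra_neqF vk => /eqP v0; apply/val_inj.
Qed.

Lemma ser_shrink n (s s0 B : K) (f : 'rV[K]_n -> K) : 0 < s -> s <= s0 ->
  ser s0 B f -> ser s (`|f 0| + s / s0 * B) f.
Proof.
move=> sp ss0 [a fa]; have s0p : 0 < s0 := lt_le_trans sp ss0.
exists a; apply: has_seriesI => //.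
  by rewrite -(has_series0 s0p fa); apply: l1_shrink fa.1.
move=> h hs; exists B => N; apply: fa.2 => k.
by apply: le_trans (hs k) _; rewrite ler_pM2r ?invr_gt0.
Qed.

Lemma sum_pow_half (n N : nat) :
  \sum_(v : {ffun 'I_n -> 'I_N}) (2 ^+ (\sum_k v k)%N : K)^-1 <= 2 ^+ n.
Proof.
under eq_bigr do rewrite -exprVn expr_sum.
rewrite -(bigA_distr_bigA (fun _ (p : 'I_N) => (2^-1 : K) ^+ p))/=.
rewrite prodr_const card_ord; apply: lerXn2r; rewrite ?nnegrE//.
  by apply: sumr_ge0 => p _; rewrite exprn_ge0 ?invr_ge0.
exact: sum_half_le2.
Qed.

(** Of the two factors 1/2 in [r / 4], one yields the decay [2 ^ -D], and the other makes the sum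
    over all multi-indices at most [2 ^ n]. *)
Lemma cauchy_tail n (a : ('I_n -> nat) -> K) (r M : K) D N
    (P : pred {ffun 'I_n -> 'I_N}) : 0 < r ->
  (forall v, `|a v| * r ^+ (\sum_k v k)%N <= M) ->
  (forall v, P v -> D <= \sum_k v k)%N ->
  \sum_(v | P v) `|a (fun k => v k)| * (r / 4) ^+ (\sum_k v k)%N <=
  M * 2 ^+ n / 2 ^+ D.
Proof.
move=> r0 aM PD; have M0 := bound_ge0 r0 aM.
apply: le_trans (_ : \sum_(v | P v) M / 2 ^+ D / 2 ^+ (\sum_k v k)%N <= _).
  apply: ler_sum => v Pv.
  have -> : r / 4 = r * (2^-1 * 2^-1) by rewrite -invfM -natrM.
  rewrite !exprMn [leLHS]mulrA -[leRHS]mulrA; apply: ler_pM => //.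
  - by rewrite mulr_ge0 ?exprn_ge0 ?(ltW r0).
  - by rewrite mulr_ge0 ?exprn_ge0 ?invr_ge0.
  rewrite exprVn; apply: ler_wpM2r; first by rewrite invr_ge0 exprn_ge0.
  by rewrite lef_pV2 ?posrE ?exprn_gt0// ler_weXn2l ?ler1n// PD.
rewrite -mulr_sumr mulrAC; apply: ler_wpM2r; first by rewrite invr_ge0 exprn_ge0.
apply: ler_wpM2l => //; apply: le_trans (sum_pow_half n N).
rewrite [leLHS]big_mkcond/=; apply: ler_sum => v _; case: ifP => // _.
by rewrite invr_ge0 exprn_ge0.
Qed.

Lemma cauchy_l1 n (a : ('I_n -> nat) -> K) (r M : K) : 0 < r ->
  (forall v, `|a v| * r ^+ (\sum_k v k)%N <= M) ->
  l1_bound (r / 2) (M * 2 ^+ n) a.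
Proof.
move=> r0 aM N; have M0 := bound_ge0 r0 aM; rewrite l1E.
apply: le_trans (ler_wpM2l M0 (sum_pow_half n N)); rewrite mulr_sumr.
apply: ler_sum => v _; rewrite expr_div_n mulrA; apply: ler_wpM2r => //.
by rewrite invr_ge0 exprn_ge0.
Qed.

(** * Analytic functions and absolutely summable series *)

Lemma analytic_has_series n (g : 'rV[K]_n -> K) c a (r M : K) : 0 < r ->
  (forall v, `|a v| * r ^+ (\sum_k v k)%N <= M) ->
  (forall h : 'rV[K]_n, (forall k, `|h 0 k| < r) -> box_sum a h @ \oo --> g (c + h)) ->
  has_series (r / 2) (M * 2 ^+ n) a (fun h => g (c + h)).
Proof.
move=> r0 aM ga; have r20 : 0 < r / 2 by rewrite divr_gt0.
have aB := cauchy_l1 r0 aM.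
apply: has_seriesI => // h hr; exists (M * 2 ^+ n) => N.
have {}ga : box_sum a h @ \oo --> g (c + h).
  apply: ga => k; apply: le_lt_trans (hr k) _.
  rewrite -mulrA gtr_pMr//; apply: le_lt_trans (_ : 2^-1 < 1).
    by rewrite ler_pdivrMr// ler_peMr ?invr_ge0// ler1n.
  by rewrite invf_lt1// ltr1n.
apply: (@le_geo _ _ 1) => m.
have /cvgrPdist_le/(_ (1 / 2 ^+ m)) := ga.
move=> /(_ _)[|N' _ N'P]; first by rewrite divr_gt0 ?exprn_gt0.
pose M' := maxn N N'.
have -> : g (c + h) - box_sum a h N =
   (box_sum a h M' - box_sum a h N) + (g (c + h) - box_sum a h M') by ring.
apply: le_trans (ler_normD _ _) _; apply: lerD; last first.
  by apply: N'P; rewrite /= leq_maxr.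
by apply: (box_sum_tail r20 aB) => //; rewrite leq_maxl.
Qed.

Lemma ser_analytic n (g : 'rV[K]_n -> K) c (s B : K) : 0 < s ->
  ser s B (fun h => g (c + h)) -> analytic_at g c.
Proof.
move=> s0 [a [aB ga]]; have B0 := l1_ge0 (ltW s0) aB.
exists a, (s / 2), B; split=> [|v|h hs].
- by rewrite divr_gt0.
- apply: le_trans (l1_term v (ltW s0) aB); apply: ler_wpM2l => //.
  apply: real_bound_le; first by rewrite divr_gt0.
  by rewrite ler_pdivrMr// ler_peMr ?(ltW s0)// ler1n.
apply/cvgrPdist_le => e e0.
have /cvgrPdist_le/(_ _ e0) : (fun N => B * 2^-1 ^+ N : K) @ \oo --> (0 : K).
  rewrite -[X in _ --> X](mulr0 B).
  by apply: cvgM; [exact: cvg_cst|exact: cvg_half].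
apply: filterS => N; rewrite sub0r normrN => He.
apply: le_trans (ga _ _ _) _ => [k|]; first exact: ltW.
rewrite -exprVn; apply: le_trans He; apply: real_ler_norm.
by rewrite ger0_real// mulr_ge0// exprn_ge0// invr_ge0.
Qed.

Lemma analytic_ser n (g : 'rV[K]_n -> K) c : analytic_at g c ->
  exists s B : K, 0 < s /\ ser s B (fun h => g (c + h)).
Proof.
move=> [a [r [M [r0 aM ga]]]]; exists (r / 2), (M * 2 ^+ n); split.
  by rewrite divr_gt0.
by exists a; exact: analytic_has_series.
Qed.

Lemma analytic_small n (g : 'rV[K]_n -> K) c (e : K) : 0 < e -> analytic_at g c ->
  exists s0 : K, 0 < s0 /\ forall s, 0 < s -> s <= s0 ->
    ser s (`|g c| + e) (fun h => g (c + h)).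
Proof.
move=> e0 /analytic_ser[s1 [B [s1p gB]]].
have B0 : 0 <= B by have [a [aB _]] := gB; exact: l1_ge0 (ltW s1p) aB.
have B1 : 0 < B + 1 by rewrite ltr_wpDl.
(* The radius solves [s / s1 * (B + 1) <= e]; with [B + 1] in place of [B] the denominator is
   positive even when [B = 0]. *)
have [s0 s0p [s01 s0e]] := common_radius s1p (divr_gt0 (mulr_gt0 e0 s1p) B1).
exists s0; split=> // s sp ss0; have ss1 : s <= s1 := le_trans ss0 s01.
apply: ser_weaken (ser_shrink sp ss1 gB); rewrite addr0 lerD2l.
apply: le_trans (_ : s / s1 * (B + 1) <= _).
  by rewrite ler_wpM2l ?divr_ge0 ?(ltW sp) ?(ltW s1p)// lerDl.
rewrite mulrAC ler_pdivrMr// -ler_pdivlMr//; exact: le_trans s0e.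
Qed.

Lemma fin_small (m : nat) (P : 'I_m -> K -> Prop) :
  (forall k, exists s0 : K, 0 < s0 /\ forall s, 0 < s -> s <= s0 -> P k s) ->
  exists s : K, 0 < s /\ forall k, P k s.
Proof.
move=> HP; suff [s [s0 sP]] : exists s0 : K, 0 < s0 /\
    forall s k, k \in enum 'I_m -> 0 < s -> s <= s0 -> P k s.
  by exists s; split=> // k; apply: sP => //; rewrite mem_enum.
elim: (enum _) => [|k ks [s [s0 IH]]]; first by exists 1; split.
have [s1 [s10 s1P]] := HP k.
have [s2 s20 [s21 s2s]] := common_radius s10 s0.
exists s2; split=> // s3 k'; rewrite in_cons => /orP[/eqP ->|kk] s30 s32.
  by apply: s1P => //; apply: le_trans s21.
by apply: IH => //; apply: le_trans s2s.
Qed.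

(* The only form in which the completeness of [K] is needed. *)
Definition geo_complete : Prop := forall (u : nat -> K) (C : K),
  (forall N, `|u N.+1 - u N| <= C / 2 ^+ N) ->
  exists l, forall N, `|l - u N| <= C * 2 / 2 ^+ N.

Hypothesis HK : geo_complete.

Lemma l1_has_series n (s B : K) (a : ('I_n -> nat) -> K) : 0 < s ->
  l1_bound s B a -> exists f, has_series s B a f.
Proof.
move=> s0 aB.
have H (h : 'rV[K]_n) : exists l : K, (forall k, `|h 0 k| <= s / 2) ->
    forall N, `|l - box_sum a h N| <= B * 2 / 2 ^+ N.
  have [hs|hs] := pselect (forall k, `|h 0 k| <= s / 2); last by exists 0.
  have [|l lP] := HK (u := box_sum a h) (C := B).
    by move=> N; apply: (box_sum_tail s0 aB).
  by exists l.
have [f fP] := choice H; exists f; apply: has_seriesI => // h hs.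
by exists (B * 2); exact: fP.
Qed.

(** Completeness of the weighted l1 space. The coefficients converge one by one with a geometric
    rate; in a fixed box there are finitely many of them, so the errors add up to a multiple of
    [2 ^ -N], which [le_geo] removes before the box grows. *)
Lemma ser_limit n (s C : K) (G : nat -> 'rV[K]_n -> K) (f : 'rV[K]_n -> K) :
  0 < s -> (forall i, ser s (C / 2 ^+ i) (G i)) ->
  (forall h : 'rV[K]_n, (forall k, `|h 0 k| <= s / 2) ->
    exists C' : K, forall N, `|f h - \sum_(i < N) G i h| <= C' / 2 ^+ N) ->
  ser s (C * 2) f.
Proof.
move=> s0 /choice[d dG] fG.
pose S N (v : 'I_n -> nat) := \sum_(i < N) d i v.
have C0 : 0 <= C.
  by have := l1_ge0 (ltW s0) (dG 0%N).1; rewrite expr0 divr1.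
have dv i v : `|d i v| * s ^+ (\sum_k v k)%N <= C / 2 ^+ i.
  exact: l1_term (ltW s0) (dG i).1.
have H v : exists l : K, forall N, `|l - S N v| * s ^+ (\sum_k v k)%N <= C * 2 / 2 ^+ N.
  have sp : 0 < s ^+ (\sum_k v k)%N by rewrite exprn_gt0.
  have [|l lP] := HK (u := S^~ v) (C := C / s ^+ (\sum_k v k)%N).
    move=> N; rewrite /S big_ord_recr/= addrAC subrr add0r.
    by rewrite mulrAC ler_pdivlMr.
  exists l => N; rewrite -ler_pdivlMr//; apply: le_trans (lP N) _.
  by rewrite le_eqVlt; apply/orP; left; apply/eqP; ring.
have [a aP] := choice H; clear H.
have Sbox h M N : box_sum (S N) h M = \sum_(i < N) box_sum (d i) h M.
  rewrite /box_sum exchange_big/=; apply: eq_bigr => v _.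
  by rewrite mulr_suml.
have geoC N : \sum_(i < N) C / 2 ^+ i <= C * 2.
  rewrite -mulr_sumr; apply: ler_wpM2l => //.
  under eq_bigr do rewrite -exprVn.
  exact: sum_half_le2.
exists a; apply: has_seriesI => // [M|h hs].
  apply: (@le_geo _ _ (\sum_(v : {ffun 'I_n -> 'I_M}) C * 2)) => N.
  rewrite l1E.
  apply: le_trans (_ : \sum_(v : {ffun 'I_n -> 'I_M})
    (`|S N (fun k => v k)| * s ^+ (\sum_k v k)%N + C * 2 / 2 ^+ N) <= _).
    apply: ler_sum => v _; apply: le_trans (lerD (lexx _) (aP (fun k => v k) N)).
    rewrite -mulrDl; apply: ler_wpM2r; first by rewrite exprn_ge0 ?(ltW s0).
    have {1}-> : a (fun k => v k) = S N (fun k => v k) + (a (fun k => v k) - S N (fun k => v k)).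
      by ring.
    exact: ler_normD.
  rewrite big_split/= -mulr_suml; apply: lerD => //.
  apply: le_trans (geoC N).
  apply: le_trans (_ : \sum_(v : {ffun 'I_n -> 'I_M})
      \sum_(i < N) `|d i (fun k => v k)| * s ^+ (\sum_k v k)%N <= _).
    apply: ler_sum => v _; rewrite -mulr_suml; apply: ler_wpM2r.
      by rewrite exprn_ge0 ?(ltW s0).
    exact: ler_norm_sum.
  rewrite exchange_big/=; apply: ler_sum => i _.
  by rewrite -l1E; exact: (dG i).1.
exists (C * 2) => M; have [C' fC'] := fG h hs.
apply: (@le_geo _ _ (C' + \sum_(v : {ffun 'I_n -> 'I_M}) C * 2)) => N.
have -> : f h - box_sum a h M =
    \sum_(i < N) (G i h - box_sum (d i) h M) +
    ((f h - \sum_(i < N) G i h) + (box_sum (S N) h M - box_sum a h M)).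
  by rewrite sumrB -Sbox; ring.
apply: le_trans (ler_normD _ _) _; apply: lerD.
  apply: le_trans (ler_norm_sum _ _ _) _.
  apply: le_trans (_ : \sum_(i < N) C / 2 ^+ i / 2 ^+ M <= _).
    by apply: ler_sum => i _; exact: (dG i).2.
  by rewrite -mulr_suml; apply: ler_wpM2r => //; rewrite invr_ge0 exprn_ge0.
rewrite mulrDl; apply: le_trans (ler_normD _ _) _; apply: lerD => //.
rewrite /box_sum -sumrB mulr_suml; apply: le_trans (ler_norm_sum _ _ _) _.
apply: ler_sum => v _; rewrite -mulrBl normrM distrC.
apply: le_trans (aP (fun k => v k) N); apply: ler_wpM2l => //.
apply: le_trans (mono_le _ s0 hs) _.
rewrite ler_pdivrMr ?exprn_gt0// ler_peMr ?exprn_ge0 ?(ltW s0)//.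
by rewrite exprn_ege1 ?ler1n.
Qed.

(* The condition on [phi k p] allows values off the centre [c]: with [phi] the
   coordinate functions it yields the analyticity of [g] at points near [c]. *)
Lemma series_comp n m (g : 'rV[K]_n -> K) c a (r M : K)
    (phi : 'I_n -> 'rV[K]_m -> K) (p : 'rV[K]_m) : 0 < r ->
  (forall v, `|a v| * r ^+ (\sum_k v k)%N <= M) ->
  (forall h : 'rV[K]_n, (forall k, `|h 0 k| < r) -> box_sum a h @ \oo --> g (c + h)) ->
  (forall k, analytic_at (phi k) p) ->
  (forall k, `|phi k p - c 0 k| <= r / 8) ->
  analytic_at (fun z => g (\row_k phi k z)) p.
Proof.
move=> r0 aM ga aphi phic; have M0 := bound_ge0 r0 aM.
have r80 : 0 < r / 8 by rewrite divr_gt0.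
have r4E : r / 8 + r / 8 = r / 4 by field.
(* The norm of [phi k - c k] near [p] is at most its value at [p], bounded by [r / 8], plus an
   arbitrarily small variation, also taken to be [r / 8]. The sum [r / 4] is the radius at which
   [cauchy_tail] applies. *)
have [s [s0 sphi]] : exists s : K, 0 < s /\
    forall k, ser s (r / 4) (fun h => phi k (p + h) - c 0 k).
  apply: fin_small => k.
  have aphik : analytic_at (fun z => phi k z - c 0 k) p.
    by apply: analytic_atD => //; exact: analytic_at_cst.
  have [s0 [s0p sP]] := analytic_small r80 aphik.
  exists s0; split=> // s sp ss0; apply: ser_weaken (sP s sp ss0).
  by rewrite -r4E lerD2r.
pose T (v : 'I_n -> nat) h := a v * \prod_k (phi k (p + h) - c 0 k) ^+ v k.
(* [Q i] selects the shell between the boxes of size [i] and [i.+1], and the whole box of size 1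
   when [i = 0]. The sums over the shells thus add up to box sums, while their norms decay like
   [2 ^ -i]. *)
pose Q i (v : {ffun 'I_n -> 'I_i.+1}) := (i == 0%N) || ~~ [forall k, v k < i]%N.
pose G i h := \sum_(v : {ffun 'I_n -> 'I_i.+1} | Q i v) T (fun k => v k) h.
have GP N (h : 'rV[K]_m) : (0 < N)%N ->
    \sum_(i < N) G i h = box_sum a (\row_k (phi k (p + h) - c 0 k)) N.
  case: N => // N _; elim: N => [|N IH].
    rewrite big_ord1 /G /box_sum; apply: eq_big => v //= _.
    by congr (_ * _); apply: eq_bigr => k _; rewrite mxE.
  rewrite big_ord_recr/= IH (box_sum_widen _ _ (leqnSn _)) /box_sum.
  rewrite [RHS](bigID (fun v : {ffun 'I_n -> 'I_N.+2} => [forall k, v k < N.+1]%N))/=.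
  congr (_ + _); apply: eq_bigr => v _; congr (_ * _).
  by apply: eq_bigr => k _; rewrite mxE.
have sG i : ser s (M * 2 ^+ n / 2 ^+ i) (G i).
  apply: ser_weaken (_ : \sum_(v : {ffun 'I_n -> 'I_i.+1} | Q i v)
     `|a (fun k => v k)| * (r / 4) ^+ (\sum_k v k)%N <= _) _.
    apply: cauchy_tail => // v; rewrite /Q; case: i v => //= i v.
    exact: notin_box_deg.
  apply: ser_sum => // v _; apply: serZ; rewrite expr_sum.
  by apply: ser_prod => // k; exact: serX.
apply: (@ser_analytic _ _ _ s (M * 2 ^+ n * 2)) => //.
apply: ser_limit sG _ => // h hs.
have psi k : `|phi k (p + h) - c 0 k| <= r / 4.
  by have [b bP] := sphi k; exact: (has_series_le s0 bP hs).
have gs := analytic_has_series r0 aM ga.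
have r20 : 0 < r / 2 by rewrite divr_gt0.
have gE : g (\row_k phi k (p + h)) = g (c + \row_k (phi k (p + h) - c 0 k)).
  by congr g; apply/rowP => k; rewrite !mxE addrC subrK.
have hr k : `|(\row_k (phi k (p + h) - c 0 k) : 'rV[K]_n) 0 k| <= r / 2 / 2.
  rewrite mxE; have -> : r / 2 / 2 = r / 4 by field.
  exact: psi.
(* The second summand of the constant serves only [N = 0], where no term has been subtracted yet. *)
exists (M * 2 ^+ n + `|g (\row_k phi k (p + h))|) => -[|N].
  by rewrite big_ord0 subr0 expr0 divr1 lerDr mulr_ge0 ?exprn_ge0.
rewrite GP// gE; apply: le_trans (gs.2 _ hr _) _.
by apply: ler_wpM2r; [rewrite invr_ge0 exprn_ge0|rewrite lerDl].
Qed.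

Lemma analytic_comp n m (g : 'rV[K]_n -> K) (phi : 'I_n -> 'rV[K]_m -> K) p :
  (forall k, analytic_at (phi k) p) -> analytic_at g (\row_k phi k p) ->
  analytic_at (fun z => g (\row_k phi k z)) p.
Proof.
move=> aphi [a [r [M [r0 aM ga]]]]; apply: (series_comp r0 aM ga) => // k.
by rewrite mxE subrr normr0 divr_ge0// ltW.
Qed.

(** The series is written out only for the identity in one variable; [analytic_at_coords] pulls it
    back along the projection to coordinate [k]. *)
Lemma analytic_at_coord n (k : 'I_n) (p : 'rV[K]_n) :
  analytic_at (fun z => z 0 k) p.
Proof.
pose a1 (v : 'I_1 -> nat) : K :=
  if v ord0 is 0%N then p 0 k else if v ord0 is 1%N then 1 else 0.
have id1 : analytic_at (fun z : 'rV[K]_1 => z 0 ord0) (\row_i p 0 ((fun=> k) i)).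
  exists a1, 1, (`|p 0 k| + 1); split=> // [v|h _].
    rewrite expr1n mulr1 /a1; case: (v ord0) => [|[|i]].
    - by rewrite lerDl.
    - by rewrite normr1 lerDr.
    - by rewrite normr0 addr_ge0.
  apply: cvg_near_cst; exists 2%N => //= N N2.
  case: N N2 => [//|[//|N]] _.
  pose v0 : {ffun 'I_1 -> 'I_N.+2} := [ffun=> ord0].
  pose v1 : {ffun 'I_1 -> 'I_N.+2} := [ffun=> inord 1].
  have v10 : v1 != v0.
    apply/eqP => /ffunP/(_ ord0); rewrite !ffunE => /(congr1 val).
    by rewrite /= inordK.
  rewrite /box_sum (bigD1 v0)//= (bigD1 v1)//= [X in _ + (_ + X)]big1 => [|v /andP[vv0 vv1]].
    rewrite /a1 !big_ord1 !ffunE inordK//= expr0 expr1 mulr1 mul1r addr0.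
    by rewrite !mxE.
  rewrite /a1; case E : (nat_of_ord (v ord0)) => [|[|i]]; last by rewrite mul0r.
    by case/eqP: vv0; apply/ffunP => i; rewrite ord1 ffunE; apply/val_inj.
  case/eqP: vv1; apply/ffunP => i; rewrite ord1 ffunE; apply/val_inj.
  by rewrite /= inordK// E.
have := @analytic_at_coords _ _ _ (fun=> k) _ p _ id1.
under [X in analytic_at X]funext do rewrite mxE.
by apply=> i j _; rewrite !ord1.
Qed.

Lemma analytic_comp_coord n m (g : 'rV[K]_n -> K) (f : 'rV[K]_m -> 'rV[K]_n) p :
  (forall k, analytic_at (fun z => f z 0 k) p) -> analytic_at g (f p) ->
  analytic_at (fun z => g (f z)) p.
Proof.
move=> af ag; have fE z : f z = \row_k f z 0 k.
  by apply/rowP => k; rewrite mxE.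
under [X in analytic_at X]funext do rewrite fE.
by apply: analytic_comp => //; rewrite -fE.
Qed.

Lemma analytic_near n (g : 'rV[K]_n -> K) c : analytic_at g c ->
  exists e : K, 0 < e /\
    forall p : 'rV[K]_n, (forall k, `|p 0 k - c 0 k| <= e) -> analytic_at g p.
Proof.
move=> [a [r [M [r0 aM ga]]]]; exists (r / 8); split=> [|p pc].
  by rewrite divr_gt0.
have -> : g = (fun z => g (\row_k z 0 k)).
  by apply/funext => z; congr g; apply/rowP => k; rewrite mxE.
apply: (series_comp r0 aM ga) => // k; exact: analytic_at_coord.
Qed.

Lemma analytic_nonzero n (g : 'rV[K]_n -> K) c : analytic_at g c -> g c != 0 ->
  exists e : K, 0 < e /\
    forall p : 'rV[K]_n, (forall k, `|p 0 k - c 0 k| <= e) -> g p != 0.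
Proof.
move=> ag g0; have e0 : 0 < `|g c| / 2 by rewrite divr_gt0 ?normr_gt0.
have ag0 : analytic_at (fun z => g z - g c) c.
  by apply: analytic_atD => //; exact: analytic_at_cst.
have [s [s0 /(_ s s0 (lexx _))[a aP]]] := analytic_small e0 ag0.
exists (s / 2); split=> [|p pc]; first by rewrite divr_gt0.
have pc' k : `|(p - c) 0 k| <= s / 2 by rewrite !mxE.
have := has_series_le s0 aP pc'.
rewrite (_ : c + (p - c) = p) ?subrr ?normr0 ?add0r; last by rewrite addrC subrK.
apply: contraTneq => ->; rewrite sub0r normrN.
have n0 : 0 < `|g c| by rewrite normr_gt0.
by rewrite ler_pdivlMr// ger_pMr// -[1]/(1%:R) ler_nat.
Qed.

(** Geometric series: [1 / g] is [1 / g c] times the sum of the powers of [u = 1 - g / g c]. As [u]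
    vanishes at [c], its norm is at most 1/2 on a small polydisc. *)
Lemma analytic_inv n (g : 'rV[K]_n -> K) c : analytic_at g c -> g c != 0 ->
  analytic_at (fun z => (g z)^-1) c.
Proof.
move=> ag g0; pose u z : K := 1 - (g c)^-1 * g z.
have e0 : 0 < 2^-1 :> K by rewrite invr_gt0.
have au : analytic_at u c.
  rewrite /u; under [X in analytic_at X]funext do rewrite -mulNr.
  apply: analytic_atD; first exact: analytic_at_cst.
  by apply: analytic_atM => //; exact: analytic_at_cst.
have [s [s0 /(_ s s0 (lexx _)) su]] := analytic_small e0 au.
rewrite {1}/u mulVf// subrr normr0 add0r in su.
apply: (@ser_analytic _ _ _ s (`|(g c)^-1| * 2)) => //.
apply: (@ser_limit _ _ _ (fun i h => (g c)^-1 * u (c + h) ^+ i)) => // [i|h hs].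
  by apply: serZ; rewrite -exprVn; exact: serX.
have [a aP] := su; have u2 : `|u (c + h)| <= 2^-1 := has_series_le s0 aP hs.
have gh0 : g (c + h) != 0.
  apply: contraTneq u2 => g00; rewrite /u g00 mulr0 subr0 normr1.
  by rewrite -[_^-1]mul1r ler_pdivlMr// mul1r -[1]/(1%:R) ler_nat.
exists `|(g (c + h))^-1| => N.
have -> : (g (c + h))^-1 - \sum_(i < N) (g c)^-1 * u (c + h) ^+ i =
    (g (c + h))^-1 * u (c + h) ^+ N.
  have -> : (g c)^-1 = (g (c + h))^-1 * (1 - u (c + h)).
    by rewrite /u opprB (addrC 1) subrK mulrCA mulVf// mulr1.
  rewrite -mulr_sumr -mulrA -[1 - _]opprB mulNr -subrX1.
  by rewrite opprB mulrBr mulr1 opprB addrC subrK.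
rewrite normrM normrX; apply: ler_wpM2l => //; rewrite -exprVn.
by apply: lerXn2r; rewrite ?nnegrE ?invr_ge0.
Qed.

(** * Division by coordinates and Hadamard's lemma *)

Definition zero_coords n (ks : seq 'I_n) (h : 'rV[K]_n) : 'rV[K]_n :=
  \row_k (if k \in ks then 0 else h 0 k).

Lemma shift_sum n (k : 'I_n) (F : ('I_n -> nat) -> K) N :
  \sum_(u : {ffun 'I_n -> 'I_N.+1} | (0 < u k)%N) F (fun i => u i) =
  \sum_(v : {ffun 'I_n -> 'I_N.+1} | (v k < N)%N) F (fun i => v i + (i == k))%N.
Proof.
pose U (v : {ffun 'I_n -> 'I_N.+1}) : {ffun 'I_n -> 'I_N.+1} :=
  [ffun i => inord (v i + (i == k))].
pose V (u : {ffun 'I_n -> 'I_N.+1}) : {ffun 'I_n -> 'I_N.+1} :=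
  [ffun i => inord (u i - (i == k))].
have VE u i : V u i = (u i - (i == k))%N :> nat.
  by rewrite ffunE inordK// (leq_ltn_trans (leq_subr _ _)).
rewrite (reindex_onto U V)/=; last first.
  move=> u uk; apply/ffunP => i; apply/val_inj; rewrite ffunE /= VE subnK ?inordK//.
  by case: eqP => // ->.
have UE (v : {ffun 'I_n -> 'I_N.+1}) i : (v k < N)%N -> U v i = (v i + (i == k))%N :> nat.
  move=> vk; rewrite ffunE inordK//; case: eqP => [->|_]; last by rewrite addn0.
  by rewrite addn1.
apply: eq_big => v.
  apply/andP/idP => [[uk /eqP VU]|vk].
    have := VE (U v) k; rewrite VU eqxx => ->.
    by rewrite ltn_subLR // add1n ltn_ord.
  rewrite UE// eqxx addn1; split=> //; apply/eqP/ffunP => i; apply/val_inj.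
  by rewrite /= VE UE// addnK.
move=> /andP[uk /eqP VU]; have vk : (v k < N)%N.
  have := VE (U v) k; rewrite VU eqxx => ->.
  by rewrite ltn_subLR // add1n ltn_ord.
by congr F; apply/funext => i; rewrite UE.
Qed.

(** The monomials without the variable [k] sum to [f] on the hyperplane where coordinate [k]
    vanishes. In all others one factor [h 0 k] is split off, which shifts the multi-index by one and
    divides the norm by [s]. *)
Lemma ser_divide n (k : 'I_n) (s B : K) (f : 'rV[K]_n -> K) : 0 < s ->
  ser s B f -> exists q : 'rV[K]_n -> K, ser s (B / s) q /\
    forall h : 'rV[K]_n, (forall i, `|h 0 i| <= s / 2) ->
      f h = f (zero_coords [:: k] h) + h 0 k * q h.
Proof.
move=> s0 [a [aB fa]]; have B0 := l1_ge0 (ltW s0) aB.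
have s00 := ltW s0.
pose up (v : 'I_n -> nat) i := (v i + (i == k))%N.
pose b v := a (up v).
have upX (x : 'I_n -> K) (v : 'I_n -> nat) : \prod_i x i ^+ up v i = x k * \prod_i x i ^+ v i.
  under eq_bigr do rewrite exprD.
  rewrite big_split/= mulrC; congr (_ * _).
  by rewrite (bigD1 k)//= eqxx expr1 big1 ?mulr1// => i /negPf ->.
have bB : l1_bound s (B / s) b.
  move=> N; rewrite (box_sum_widen _ _ (leqnSn N)) ler_pdivlMr//.
  apply: le_trans (l1_sub (fun u : {ffun 'I_n -> 'I_N.+1} => 0 < u k)%N s00 aB).
  under [leRHS]eq_bigr do rewrite expr_sum.
  rewrite (shift_sum k (fun u => `|a u| * \prod_i s ^+ u i)) mulr_suml.
  rewrite big_mkcond [leRHS]big_mkcond; apply: ler_sum => v _ /=.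
  have T0 : 0 <= `|a (up (fun i => v i))| * \prod_i s ^+ up (fun i => v i) i.
    by rewrite mulr_ge0// prodr_ge0// => i _; rewrite exprn_ge0.
  case: ifP => [/forallP vN|_]; last by case: ifP.
  rewrite vN -[X in X <= _]mulrA (upX (fun=> s)) [_ * s]mulrC.
  by under eq_bigr do rewrite mxE.
have [q qP] := l1_has_series s0 bB; exists q; split; first by exists b.
move=> h hs; apply/eqP; rewrite -subr_eq0 -normr_le0.
pose z := zero_coords [:: k] h.
have zs (i : 'I_n) : `|z 0 i| <= s / 2.
  by rewrite mxE; case: ifP => // _; rewrite normr0 divr_ge0.
apply: (@le_geo _ _ (B + B + (s * (B / s) + s * (B / s)))) => N; rewrite add0r.
have S1 : \sum_(u : {ffun 'I_n -> 'I_N.+1} | ~~ (0 < u k)%N)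
    a (fun i => u i) * \prod_i h 0 i ^+ u i = box_sum a z N.+1.
  rewrite /box_sum [RHS](bigID (fun u : {ffun 'I_n -> 'I_N.+1} => 0 < u k)%N)/=.
  rewrite [X in _ = X + _]big1 ?add0r => [|u uk].
    apply: eq_bigr => u; rewrite -eqn0Ngt => /eqP uk; congr (_ * _).
    apply: eq_bigr => i _; rewrite mxE inE; case: eqP => // ->.
    by rewrite uk !expr0.
  by rewrite (bigD1 k)//= mxE mem_seq1 eqxx expr0n eqn0Ngt uk mul0r mulr0.
have S2 : box_sum a h N.+1 = box_sum a z N.+1 + h 0 k *
    \sum_(v : {ffun 'I_n -> 'I_N.+1} | (v k < N)%N)
      b (fun i => v i) * \prod_i h 0 i ^+ v i.
  rewrite -S1 {1}/box_sum (bigID (fun u : {ffun 'I_n -> 'I_N.+1} => 0 < u k)%N)/= addrC.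
  congr (_ + _); rewrite (shift_sum k (fun u => a u * \prod_i h 0 i ^+ u i)) mulr_sumr.
  by apply: eq_bigr => v _; rewrite (upX (h 0)) mulrCA.
set S := (X in _ * X) in S2.
(* The shift pushes the slice [v k = N] out of the box; its terms have degree at least [N]. *)
have S3 : `|box_sum b h N.+1 - S| <= B / s / 2 ^+ N.
  rewrite /box_sum (bigID (fun v : {ffun 'I_n -> 'I_N.+1} => v k < N)%N)/= addrC addrK.
  apply: (@l1_tail _ _ _ _ h _ _ (fun v : {ffun 'I_n -> 'I_N.+1} => ~~ (v k < N)%N) s0 bB hs) => v.
  by rewrite -leqNgt => /leq_trans; apply; rewrite (bigD1 k)//= leq_addr.
have -> : f h - (f z + h 0 k * q h) =
    (f h - box_sum a h N.+1) + - (f z - box_sum a z N.+1) +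
    - (h 0 k * (q h - box_sum b h N.+1) + h 0 k * (box_sum b h N.+1 - S)).
  by rewrite S2; ring.
have le2 (x : K) : 0 <= x -> x / 2 ^+ N.+1 <= x / 2 ^+ N.
  by move=> x0; rewrite ler_wpM2l// lef_pV2 ?posrE ?exprn_gt0// ler_weXn2l ?ler1n.
have hk : `|h 0 k| <= s.
  by apply: le_trans (hs k) _; rewrite ler_pdivrMr// ler_peMr// ler1n.
rewrite mulrDl; apply: le_trans (ler_normD _ _) _; apply: lerD.
  rewrite mulrDl; apply: le_trans (ler_normD _ _) _; rewrite normrN; apply: lerD.
    by apply: le_trans (le2 _ B0); exact: fa.
  by apply: le_trans (le2 _ B0); exact: fa.
rewrite normrN mulrDl; apply: le_trans (ler_normD _ _) _; apply: lerD.
  rewrite normrM -mulrA; apply: ler_pM => //.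
  by apply: le_trans (qP.2 _ hs _) _; apply: le2; rewrite divr_ge0.
by rewrite normrM -mulrA; apply: ler_pM.
Qed.

Lemma analytic_divide n (k : 'I_n) (f : 'rV[K]_n -> K) c : analytic_at f c ->
  exists q : 'rV[K]_n -> K, analytic_at q c /\ exists e : K, 0 < e /\
    forall h : 'rV[K]_n, (forall i, `|h 0 i| <= e) ->
      f (c + h) = f (c + zero_coords [:: k] h) + h 0 k * q (c + h).
Proof.
move=> /analytic_ser[s [B [s0 /(ser_divide k s0)[q [sq fq]]]]].
exists (fun z => q (z - c)); split.
  apply: (@ser_analytic _ _ _ s (B / s)) => //; apply: ser_ext sq => h _.
  by rewrite addrAC subrr add0r.
exists (s / 2); split=> [|h hs]; first by rewrite divr_gt0.
by rewrite fq// (addrAC c) subrr add0r.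
Qed.

Lemma analytic_zero_coords n (ks : seq 'I_n) (f : 'rV[K]_n -> K) c :
  analytic_at f c -> analytic_at (fun z => f (c + zero_coords ks (z - c))) c.
Proof.
move=> af; apply: analytic_comp_coord => [k|]; last first.
  rewrite subrr (_ : zero_coords ks 0 = 0) ?addr0//.
  by apply/rowP => k; rewrite !mxE if_same.
have E z : (c + zero_coords ks (z - c)) 0 k =
    if k \in ks then c 0 k else z 0 k.
  by rewrite !mxE; case: ifP => _; rewrite ?addr0// addrC subrK.
under [X in analytic_at X]funext do rewrite E.
by case: (k \in ks); [exact: analytic_at_cst|exact: analytic_at_coord].
Qed.

Lemma analytic_divide_seq n (ks : seq 'I_n) (f : 'rV[K]_n -> K) c :
  uniq ks -> analytic_at f c ->
  exists q : 'I_n -> 'rV[K]_n -> K, (forall k, analytic_at (q k) c) /\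
    exists e : K, 0 < e /\
    forall h : 'rV[K]_n, (forall i, `|h 0 i| <= e) ->
      f (c + h) = f (c + zero_coords ks h) +
        \sum_(k <- ks) h 0 k * q k (c + h).
Proof.
elim: ks f => [|k ks IH] f.
  move=> _ af; exists (fun _ _ => 0); split=> [_|]; first exact: analytic_at_cst.
  exists 1; split=> // h _; rewrite big_nil addr0; congr (f (_ + _)).
  by apply/rowP => k; rewrite mxE.
move=> /=/andP[kks uks] af; have [q0 [aq0 [e0 [e00 fq0]]]] := analytic_divide k af.
have [q [aq [e1 [e10 fq]]]] := IH _ uks (analytic_zero_coords [:: k] af).
exists (fun i => if i == k then q0 else q i); split=> [i|].
  by case: (i == k).
have [e ep [ee0 ee1]] := common_radius e00 e10.
exists e; split=> // h he.
rewrite fq0; last by move=> i; apply: le_trans ee0.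
have := fq h (fun i => le_trans (he i) ee1).
have cK x : c + x - c = x by rewrite addrAC subrr add0r.
rewrite /= !cK => ->.
rewrite big_cons eqxx -addrA [X in _ + X]addrC; congr (f (_ + _) + _).
  by apply/rowP => i; rewrite !mxE !inE; case: eqP => [->|].
congr (_ + _); apply: eq_big_seq => i ik; rewrite (_ : (i == k) = false)//.
by apply/negP => /eqP ik'; rewrite ik' (negPf kks) in ik.
Qed.

(** The maps [m : (z, t) |-> (z, z + t)] and [d : (z, w) |-> (z, w - z)] are mutually inverse. In
    the coordinates [(z, t)] the diagonal is [t = 0], so dividing by the last [n] coordinates
    suffices. The radius is halved because [w - z] is bounded by the sum of two distances to [c]. *)
Lemma analytic_hadamard n (f : 'rV[K]_(n + n) -> K) (c : 'rV[K]_n) :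
  analytic_at f (row_mx c c) ->
  exists q : 'I_n -> 'rV[K]_(n + n) -> K,
    (forall k, analytic_at (q k) (row_mx c c)) /\ exists e : K, 0 < e /\
    forall z w : 'rV[K]_n, (forall k, `|z 0 k - c 0 k| <= e) ->
      (forall k, `|w 0 k - c 0 k| <= e) ->
      f (row_mx z w) = f (row_mx z z) +
        \sum_k (w 0 k - z 0 k) * q k (row_mx z w).
Proof.
move=> af; pose m (x : 'rV[K]_(n + n)) : 'rV[K]_(n + n) :=
  row_mx (lsubmx x) (lsubmx x + rsubmx x).
pose d (x : 'rV[K]_(n + n)) : 'rV[K]_(n + n) :=
  row_mx (lsubmx x) (rsubmx x - lsubmx x).
have am p i : analytic_at (fun x => m x 0 i) p.
  rewrite -(splitK i); case: (fintype.split i) => k /=.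
    under [X in analytic_at X]funext do rewrite row_mxEl mxE.
    exact: analytic_at_coord.
  under [X in analytic_at X]funext do rewrite row_mxEr !mxE.
  by apply: analytic_atD; exact: analytic_at_coord.
have ad p i : analytic_at (fun x => d x 0 i) p.
  rewrite -(splitK i); case: (fintype.split i) => k /=.
    under [X in analytic_at X]funext do rewrite row_mxEl mxE.
    exact: analytic_at_coord.
  under [X in analytic_at X]funext do rewrite row_mxEr !mxE -mulN1r.
  apply: analytic_atD; first exact: analytic_at_coord.
  by apply: analytic_atM; [exact: analytic_at_cst|exact: analytic_at_coord].
pose c0 : 'rV[K]_(n + n) := row_mx c 0.
have mc0 : m c0 = row_mx c c by rewrite /m row_mxKl row_mxKr addr0.
have dcc : d (row_mx c c) = c0 by rewrite /d row_mxKl row_mxKr subrr.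
have afm : analytic_at (fun x => f (m x)) c0.
  by apply: analytic_comp_coord => //; rewrite mc0.
have uks : uniq [seq rshift n k | k <- enum 'I_n].
  by rewrite map_inj_uniq ?enum_uniq//; exact: rshift_inj.
have [q [aq [e [e0 fq]]]] := analytic_divide_seq uks afm.
exists (fun k x => q (rshift n k) (d x)); split=> [k|].
  by apply: analytic_comp_coord => //; rewrite dcc.
exists (e / 2); split=> [|z w zc wc]; first by rewrite divr_gt0.
have e2 : e / 2 <= e by rewrite ler_pdivrMr// ler_peMr ?(ltW e0)// ler1n.
pose h : 'rV[K]_(n + n) := row_mx (z - c) (w - z).
have hs i : `|h 0 i| <= e.
  rewrite -(splitK i); case: (fintype.split i) => k /=.
    by rewrite row_mxEl !mxE; apply: le_trans (zc k) e2.
  rewrite row_mxEr !mxE.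
  have -> : w 0 k - z 0 k = (w 0 k - c 0 k) - (z 0 k - c 0 k) by ring.
  apply: le_trans (ler_normB _ _) _.
  have -> : e = e / 2 + e / 2 by field.
  exact: lerD.
have := fq h hs; have -> : c0 + h = d (row_mx z w).
  by rewrite /d /h add_row_mx row_mxKl row_mxKr add0r addrC subrK.
have md x : m (d x) = x.
  by rewrite /m /d row_mxKl row_mxKr addrC subrK hsubmxK.
have -> : c0 + zero_coords [seq rshift n k | k <- enum 'I_n] h = row_mx z 0.
  rewrite (_ : zero_coords _ h = row_mx (z - c) 0).
    by rewrite add_row_mx addr0 addrC subrK.
  apply/rowP => i; rewrite mxE -(splitK i); case: (fintype.split i) => k /=.
    rewrite row_mxEl row_mxEl (_ : (_ \in _) = false)//.
    by apply/negP => /mapP[k' _ /eqP]; rewrite eq_lrshift.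
  by rewrite !row_mxEr map_f ?mem_enum// mxE.
rewrite md => ->; congr (f _ + _).
  by rewrite /m row_mxKl row_mxKr addr0.
rewrite big_map big_enum/=; apply: eq_bigr => k _.
by rewrite row_mxEr !mxE.
Qed.

End Series.

Lemma nbhs_opens (Y : topologicalType) (y : Y) (A : set Y) :
  nbhs y A -> exists V : opens Y, V y /\ V `<=` A.
Proof.
move=> yA; exists (Opens (interior A) (@open_interior _ A)); split; first exact: yA.
exact: interior_subset.
Qed.

Lemma opens_nbhs (Y : topologicalType) (U : opens Y) y : U y -> nbhs y U.
Proof. by move=> Uy; apply: open_nbhs_nbhs; split=> //; exact: oset_open. Qed.

Lemma nbhs_forall (Y : topologicalType) (y : Y) m (P : 'I_m -> set Y) :
  (forall k, nbhs y (P k)) -> nbhs y [set z | forall k, P k z].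
Proof. by move=> Py; apply: filter_forall. Qed.

(** * Germs of holomorphic functions *)

Section Germs.
Variables (K : archiNumFieldType) (HK : geo_complete K).

Section Atlas.
Variables (n : nat) (Y : topologicalType) (E : set (chart K n Y)).

(** This and [chart_holomorphic] are the properties of an atlas on which the section relies. They
    are isolated so that its results apply both to the atlas of a manifold and to the product atlas,
    which is not packaged as a [manifold]. *)
Definition chart_continuous : Prop := forall c, E c -> forall x, chart_dom c x ->
  forall k (e : K), 0 < e ->
  \forall y \near x, `|chart_coord c y 0 k - chart_coord c x 0 k| <= e.

Definition chart_holomorphic : Prop := forall c, E c -> forall k,
  holomorphic E (fun x : {x : Y | chart_dom c x} => chart_coord c (sval x) 0 k).

Hypotheses (Ec : chart_continuous) (Eh : chart_holomorphic).

Definition mkhol (U : opens Y) (f : {x : Y | U x} -> K) (hf : holomorphic E f) :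
  hol E U := Hol (mem_set hf).

Lemma holP (U : opens Y) (f : hol E U) : holomorphic E f.
Proof. exact: set_mem (hol_mem f). Qed.

Lemma hol_ext (U : opens Y) (f g : hol E U) :
  (forall x (Ux : U x), f (exist _ x Ux) = g (exist _ x Ux)) -> f = g.
Proof. by move=> fg; apply/val_inj/funext => -[x Ux]; exact: fg. Qed.

Lemma holD (U : opens Y) (f g : hol_sheaf E U) y :
  (f + g : hol E U) y = (f : hol E U) y + (g : hol E U) y.
Proof. by []. Qed.

Lemma holN (U : opens Y) (f : hol_sheaf E U) y :
  (- f : hol E U) y = - (f : hol E U) y.
Proof. by []. Qed.

Lemma holM (U : opens Y) (f g : hol_sheaf E U) y :
  (f * g : hol E U) y = (f : hol E U) y * (g : hol E U) y.
Proof. by []. Qed.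

Lemma hol_res (U V : opens Y) (h : V `<=` U) (f : hol_sheaf E U) y Vy :
  (rres (hol_sheaf E) h f : hol E V) (exist _ y Vy) = (f : hol E U) (exist _ y (h y Vy)).
Proof. by rewrite /= /pull /=; congr ((f : hol E U) (exist _ _ _)); exact: Prop_irrelevance. Qed.

Lemma chart_near c x (e : K) : E c -> chart_dom c x -> 0 < e ->
  \forall y \near x, forall k, `|chart_coord c y 0 k - chart_coord c x 0 k| <= e.
Proof.
move=> cE cx e0.
exact: nbhs_forall (fun k => Ec cE cx k e0).
Qed.

(** Holomorphy on [V] has to be checked at every point of [V] and in every chart. [analytic_near]
    moves the expansion of [g] to nearby points, and [analytic_comp] changes charts through the
    holomorphic transition functions. *)
Lemma hol_germ c x (g : 'rV[K]_n -> K) : E c -> chart_dom c x ->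
  analytic_at g (chart_coord c x) ->
  exists V : opens Y, [/\ V x, V `<=` chart_dom c &
    holomorphic E (fun y : {y | V y} => g (chart_coord c (sval y)))].
Proof.
move=> cE cx ag; have [e [e0 eg]] := analytic_near HK ag.
have [V [Vx VA]] := nbhs_opens (filterI (chart_near cE cx e0) (opens_nbhs cx)).
exists V; split=> // [y /VA[]//|d dE y Vy dy].
have [yg cy] := VA y Vy.
have [phi phiP] := choice (fun k => Eh cE k dE cy dy).
exists (fun z => g (\row_k phi k z)); split.
  apply: (analytic_comp HK) => [k|]; first exact: (phiP k).1.
  have -> : \row_k phi k (chart_coord d y) = chart_coord c y.
    apply/rowP => k; rewrite mxE.
    by have /nbhs_singleton/(_ cy)/= <- := (phiP k).2.
  exact: eg.
have := nbhs_forall (fun k => (phiP k).2).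
apply: filterS2 (opens_nbhs cy) => y' cy' y'k Vy' /=.
by congr g; apply/rowP => k; rewrite mxE; exact: (y'k k cy').
Qed.

Lemma hol_unit (U : opens Y) (f : hol E U) x (Ux : U x) c :
  E c -> chart_dom c x -> f (exist _ x Ux) != 0 ->
  exists (V : opens Y) (h : V `<=` U) (g : hol E V),
    V x /\ rres (hol_sheaf E) h f * (g : hol_sheaf E V) = 1.
Proof.
move=> cE cx f0; have [g [ag fg]] := holP f cE Ux cx.
have fx := nbhs_singleton fg Ux; rewrite fx in f0.
have [V [Vx Vc hV]] := hol_germ cE cx (analytic_inv HK ag f0).
have [e [e0 eg]] := analytic_nonzero ag f0.
have [V' [V'x V'A]] := nbhs_opens (filterI (filterI (chart_near cE cx e0) fg)
  (filterI (opens_nbhs Vx) (opens_nbhs Ux))).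
have V'V : V' `<=` V by move=> y /V'A[_ []].
have V'U : V' `<=` U by move=> y /V'A[_ []].
exists V', V'U, (rres (hol_sheaf E) V'V (mkhol hV)); split=> //.
apply: hol_ext => y V'y; have [[ye yf] _] := V'A _ V'y.
by rewrite holM !hol_res/= yf divff// eg.
Qed.
End Atlas.

(** * The atlases of X and X x X, and the diagonal embedding *)

Variables (n : nat) (X : manifold K n).
Let E := @atlas _ _ X.

Lemma atlas_chart_continuous : chart_continuous E.
Proof.
move=> c cE x cx k e e0; have cc := atlas_continuous cE cx.
have /cvgrPdist_le/(_ e e0) : (fun y => chart_coord c y 0 k) @ x --> chart_coord c x 0 k.
  have := @coord_continuous K 1 n 0 k (chart_coord c x).
  exact: (@continuous_comp X _ _ (chart_coord c) (fun M : 'rV[K]_n => M 0 k) x cc).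
by apply: filterS => y; rewrite distrC.
Qed.

Lemma atlas_chart_holomorphic : chart_holomorphic E.
Proof. by move=> c cE k; exact: atlas_transition. Qed.

Lemma prod_chart_continuous : chart_continuous (prod_atlas E).
Proof.
move=> _ [[c c'] [/= cE cE'] <-] [x y] [/= cx cy] k e e0.
rewrite -(splitK k); case: (fintype.split k) => i /=.
  have : \forall z \near (x, y), `|chart_coord c z.1 0 i - chart_coord c x 0 i| <= e.
    exact: (@fst_continuous X (x, y) _ (atlas_chart_continuous cE cx i e0)).
  by apply: filterS => -[z w] /=; rewrite !row_mxEl.
have : \forall z \near (x, y), `|chart_coord c' z.2 0 i - chart_coord c' y 0 i| <= e.
    exact: (@snd_continuous X (x, y) _ (atlas_chart_continuous cE' cy i e0)).
by apply: filterS => -[z w] /=; rewrite !row_mxEr.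
Qed.

Lemma prod_chart_holomorphic : chart_holomorphic (prod_atlas E).
Proof.
move=> _ [[c c'] [/= cE cE'] <-] k.
rewrite -(splitK k); case: (fintype.split k) => i /=.
  have h (y : X * X) : chart_dom (prod_chart c c') y -> chart_dom c y.1 by case.
  have := preserves_hol_fst h (atlas_transition cE i).
  by congr holomorphic; apply/funext => -[y hy]; rewrite /= row_mxEl.
have h (y : X * X) : chart_dom (prod_chart c c') y -> chart_dom c' y.2 by case.
have := preserves_hol_snd h (atlas_transition cE' i).
by congr holomorphic; apply/funext => -[y hy]; rewrite /= row_mxEr.
Qed.

Definition diag_map (x : X) : X * X := (x, x).

Lemma diag_continuous : continuous diag_map.
Proof. by move=> x; apply: cvg_pair; exact: cvg_id. Qed.

Lemma preserves_hol_diag : preserves_hol (prod_atlas E) E diag_map.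
Proof.
move=> W U h f hf c cE x Ux cx.
have [||g [ag fg]] := hf (prod_chart c c) _ (x, x) (h x Ux).
- by exists (c, c).
- by [].
exists (fun z => g (row_mx z z)); split.
  apply: (analytic_comp_coord HK) => // k; rewrite -(splitK k).
  case: (fintype.split k) => i /=.
    under [X in analytic_at X]funext do rewrite row_mxEl.
    exact: analytic_at_coord.
  under [X in analytic_at X]funext do rewrite row_mxEr.
  exact: analytic_at_coord.
have : \forall y \near x, forall Wy : W (y, y),
    f (exist _ (y, y) Wy) = g (chart_coord (prod_chart c c) (y, y)).
  exact: (diag_continuous fg).
by apply: filterS => y /= gy Uy; rewrite /pull gy.
Qed.

Lemma diag_hadamard (W : opens (X * X)%type) (f : OXX X W) x c :
  diag_ideal f -> W (x, x) -> E c -> chart_dom c x ->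
  exists (V : opens X) (h : square V `<=` W) (q : 'I_n -> OXX X (square V)),
    [/\ V x, V `<=` chart_dom c & forall z w (zw : square V (z, w)),
      (f : hol _ _) (exist _ (z, w) (h _ zw)) =
      \sum_k (chart_coord c w 0 k - chart_coord c z 0 k) *
        (q k : hol _ _) (exist _ (z, w) zw)].
Proof.
move=> fI Wx cE cx; pose cc := prod_chart c c.
have ccE : prod_atlas E cc by exists (c, c).
have ccx : chart_dom cc (x, x) by [].
have [g [ag fg]] := holP f ccE Wx ccx.
have [q [aq [e [e0 gq]]]] := analytic_hadamard HK ag.
have [Q QP] := choice (fun k => hol_germ prod_chart_continuous
  prod_chart_holomorphic ccE ccx (aq k)).
have Qx k : nbhs (x, x) (Q k) by have [/opens_nbhs] := QP k.
have : nbhs (x, x) [set y | [/\ W y, (forall k, Q k y) &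
    forall Wy : W y, (f : hol _ _) (exist _ y Wy) = g (chart_coord cc y)]].
  by apply: filterS2 (nbhs_forall Qx) (filterI (opens_nbhs Wx) fg) => y yQ [].
move=> [[A B] [/= xA xB] AB].
(* [V] lies in both sides of the box [A x B], so that for [z] and [w] in [V] the expansion is valid
   at [(z, w)] and also at [(z, z)], where [f] vanishes. *)
have [V [Vx VA]] := nbhs_opens (filterI (filterI xA xB)
  (filterI (opens_nbhs cx) (chart_near atlas_chart_continuous cE cx e0))).
have VW : square V `<=` W.
  move=> [z w] [/VA[[Az _] _] /VA[[_ Bw] _]].
  by have [] := AB (z, w) (conj Az Bw).
have VQ k : square V `<=` Q k.
  move=> [z w] [/VA[[Az _] _] /VA[[_ Bw] _]].
  by have [_ + _] := AB (z, w) (conj Az Bw); apply.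
have hQ k : holomorphic (prod_atlas E)
    (fun y : {y | Q k y} => q k (chart_coord cc (sval y))).
  by have [] := QP k.
exists V, VW, (fun k => rres (OXX X) (VQ k) (mkhol (hQ k))); split=> // [y /VA[_ []]//|z w zw].
have [/= /VA[[Az Bz] [_ ze]] /VA[[_ Bw] [_ we]]] := zw.
have [_ _ ->] := AB (z, w) (conj Az Bw).
rewrite /cc/= gq//; have [Wz _ gz] := AB (z, z) (conj Az Bz).
by have := fI z Wz; rewrite gz /cc/= => ->; rewrite add0r.
Qed.
End Germs.

(** * Completeness of the complex numbers *)

Lemma geo_tail (K : numFieldType) (u : nat -> K) (C : K) :
  (forall N, `|u N.+1 - u N| <= C / 2 ^+ N) ->
  forall N m, `|u (N + m)%N - u N| <= C * 2 / 2 ^+ N - C * 2 / 2 ^+ (N + m).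
Proof.
move=> uC N; elim=> [|m IH]; first by rewrite addn0 !subrr normr0.
have -> : u (N + m.+1)%N - u N = (u (N + m).+1 - u (N + m)%N) + (u (N + m)%N - u N).
  by rewrite addnS; ring.
apply: le_trans (ler_normD _ _) _; apply: le_trans (lerD (uC _) IH) _.
rewrite le_eqVlt; apply/orP; left; apply/eqP.
by rewrite addnS exprS; field; rewrite expf_neq0 ?expf_neq0// pnatr_eq0.
Qed.

Section ComplexComplete.
Variable R : realType.

(** By [geo_tail] each lower bound [u M - 2 c / 2 ^ M] is below each upper bound
    [u N + 2 c / 2 ^ N]; the supremum of the lower bounds therefore lies in all these intervals. *)
Lemma real_geo_complete (u : nat -> R) (c : R) :
  (forall N, `|u N.+1 - u N| <= c / 2 ^+ N) ->
  exists l, forall N, `|l - u N| <= c * 2 / 2 ^+ N.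
Proof.
move=> uc; have c0 : 0 <= c.
  by have := uc 0%N; rewrite expr0 divr1; apply: le_trans.
have p0 N : 0 <= c * 2 / 2 ^+ N by rewrite divr_ge0 ?mulr_ge0 ?exprn_ge0.
pose A := [set u N - c * 2 / 2 ^+ N | N in setT].
have AB M N : u M - c * 2 / 2 ^+ M <= u N + c * 2 / 2 ^+ N.
  have [MN|NM] := leqP M N.
    have := geo_tail uc M (N - M); rewrite subnKC// distrC => /(le_trans (ler_norm _)) H.
    have := p0 N; lra.
  have := geo_tail uc N (M - N); rewrite subnKC ?(ltnW NM)// => /(le_trans (ler_norm _)) H.
  have := p0 M; lra.
have Aub : has_ubound A by exists (u 0%N + c * 2 / 2 ^+ 0) => _ [N _ <-].
have A0 : A !=set0 by exists (u 0%N - c * 2 / 2 ^+ 0); exists 0%N.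
exists (sup A) => N; rewrite ler_norml; apply/andP; split.
  have : u N - c * 2 / 2 ^+ N <= sup A by apply: ub_le_sup => //; exists N.
  lra.
have : sup A <= u N + c * 2 / 2 ^+ N by apply: ge_sup => // _ [M _ <-].
lra.
Qed.

(** Adding the errors of the real and imaginary parts gives the rate [4 C], twice what is required.
    Comparing with a later term [u (N + m)] and letting [m] grow restores [2 C]. *)
Lemma complex_geo_complete : geo_complete R[i].
Proof.
move=> u C uC.
have C0 : 0 <= C by have := uC 0%N; rewrite expr0 divr1; apply: le_trans.
have [c Cc] : exists c : R, C = c%:C%C.
  by exists (complex.Re C); rewrite RRe_real ?ger0_real.
have geoE (x : R) N : (x%:C / 2 ^+ N)%C = ((x / 2 ^+ N)%:C)%C :> R[i].
  by rewrite rmorphM fmorphV rmorphXn rmorph_nat.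
have ReP (z : R[i]) : (`|complex.Re z|%:C)%C <= `|z|.
  by rewrite normc_ge_Re.
have ImP (z : R[i]) : (`|complex.Im z|%:C)%C <= `|z|.
  rewrite normc_def lecR -sqrtr_sqr; apply: ler_wsqrtr.
  by rewrite lerDr sqr_ge0.
have aux (p : {additive R[i] -> R}) : (forall z, (`|p z|%:C)%C <= `|z|) ->
    exists l, forall N, `|l - p (u N)| <= c * 2 / 2 ^+ N.
  move=> pP; apply: real_geo_complete => N; rewrite -lecR -geoE -Cc -raddfB.
  exact: le_trans (pP _) (uC N).
have [a aP] := aux (@complex.Re R) ReP.
have [b bP] := aux (@complex.Im R) ImP.
exists (a +i* b)%C => N.
have lN M : `|(a +i* b)%C - u M| <= C * 4 / 2 ^+ M.
  have -> : (a +i* b)%C - u M = ((a - complex.Re (u M))%:C)%C +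
      (0 +i* (b - complex.Im (u M)))%C.
    by case: (u M) => x y; simpc.
  apply: le_trans (ler_normD _ _) _.
  have -> : C * 4 / 2 ^+ M = ((c * 2 / 2 ^+ M)%:C)%C + ((c * 2 / 2 ^+ M)%:C)%C.
    have c2 : (c * 2)%:C%C = C * 2.
      by rewrite Cc -[2 in RHS](rmorph_nat (real_complex R)) -rmorphM.
    rewrite -!geoE c2.
    by field; rewrite expf_neq0// pnatr_eq0.
  apply: lerD; first by rewrite normc_def/= expr0n/= addr0 sqrtr_sqr lecR; exact: aP.
  by rewrite normc_def/= expr0n/= add0r sqrtr_sqr lecR; exact: bP.
apply: (@le_geo _ _ _ (C * 4)) => m.
have -> : (a +i* b)%C - u N = (u (N + m)%N - u N) + ((a +i* b)%C - u (N + m)%N) by ring.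
apply: le_trans (ler_normD _ _) _; apply: lerD.
  by apply: le_trans (geo_tail uC N m) _; rewrite lerBlDr lerDl divr_ge0 ?mulr_ge0 ?exprn_ge0.
apply: le_trans (lN _) _; rewrite ler_wpM2l ?mulr_ge0//.
by rewrite lef_pV2 ?posrE ?exprn_gt0// ler_weXn2l ?ler1n ?leq_addl.
Qed.
End ComplexComplete.

(** * Sheaves of modules *)

Section ModuleSheaves.
Variables (X : topologicalType) (A : ringPresheaf X).
Implicit Types F G H T : modSheaf A.

Section MresTheory.
Variables (F : modSheaf A) (U V : opens X) (h : V `<=` U).

Lemma mres0 : mres F h 0 = 0.
Proof. by rewrite -[0](scale0r 0) mresZ rmorph0 scale0r. Qed.

Lemma mres_sum I (r : seq I) (P : pred I) (s : I -> F U) :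
  mres F h (\sum_(i <- r | P i) s i) = \sum_(i <- r | P i) mres F h (s i).
Proof. by apply: (big_morph _ _ mres0) => x y; rewrite mresD. Qed.
End MresTheory.

Lemma mres_irr F (U V : opens X) (h h' : V `<=` U) (s : F U) :
  mres F h s = mres F h' s.
Proof. by congr (mres F _ s); exact: Prop_irrelevance. Qed.

(** The proof of linearity is an argument, so that the [{linear _ -> _}] structure can be inferred
    for a function that is merely known to be linear. *)
Definition lin_fun (R : pzRingType) (M N : lmodType R) (f : M -> N)
  (fl : linear f) : M -> N := f.

HB.instance Definition _ (R : pzRingType) (M N : lmodType R) (f : M -> N)
  (fl : linear f) := GRing.isLinear.Build _ _ _ _ (lin_fun fl) fl.

Definition mkHom F G (f : forall U, F U -> G U) (fl : forall U, linear (f U))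
  (fr : forall (U V : opens X) (h : V `<=` U) s, mres G h (f U s) = f V (mres F h s)) :
  modHom F G := @ModHom X A F G (fun U => lin_fun (fl U)) fr.

Definition idHom F : modHom F F.
Proof. by refine (@mkHom F F (fun _ s => s) _ _). Defined.

Definition compHom F G H (g : modHom G H) (f : modHom F G) : modHom F H.
Proof.
refine (@mkHom F H (fun U s => g U (f U s)) _ _) => [U a s t|U V h s].
  by rewrite !linearP.
by rewrite !mhom_res.
Defined.

Section Bilinear.
Variables (F G H : modSheaf A) (b : bilinearMap F G H) (U : opens X).

Lemma bmap0l t : b U 0 t = 0.
Proof. by have := bmap_linl b (-1) 0 0 t; rewrite scaler0 addr0 scaleN1r addNr. Qed.

Lemma bmap0r s : b U s 0 = 0.
Proof. by have := bmap_linr b (-1) s 0 0; rewrite scaler0 addr0 scaleN1r addNr. Qed.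

Lemma bmapZl a s t : b U (a *: s) t = a *: b U s t.
Proof. by rewrite -[a *: s]addr0 bmap_linl bmap0l addr0. Qed.

Lemma bmapZr a s t : b U s (a *: t) = a *: b U s t.
Proof. by rewrite -[a *: t]addr0 bmap_linr bmap0r addr0. Qed.

Lemma bmapDl s s' t : b U (s + s') t = b U s t + b U s' t.
Proof. by have := bmap_linl b 1 s s' t; rewrite !scale1r. Qed.

Lemma bmapDr s t t' : b U s (t + t') = b U s t + b U s t'.
Proof. by have := bmap_linr b 1 s t t'; rewrite !scale1r. Qed.

Lemma bmapNl s t : b U (- s) t = - b U s t.
Proof. by rewrite -scaleN1r bmapZl scaleN1r. Qed.

Lemma bmap_suml I (r : seq I) (P : pred I) (s : I -> F U) t :
  b U (\sum_(i <- r | P i) s i) t = \sum_(i <- r | P i) b U (s i) t.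
Proof. by apply: (big_morph (b U ^~ t)) => [x y|]; [exact: bmapDl|exact: bmap0l]. Qed.
End Bilinear.

Section Multilinear.
Variables (k : nat) (F G : modSheaf A) (m : multilinearMap k F G) (U : opens X).

Lemma mmap0 (s : 'I_k -> F U) i : m U [eta s with i |-> 0] = 0.
Proof. by have := mmap_lin m s i (-1) 0 0; rewrite scaler0 addr0 scaleN1r addNr. Qed.

Lemma mmapZ (s : 'I_k -> F U) i a x :
  m U [eta s with i |-> a *: x] = a *: m U [eta s with i |-> x].
Proof. by have := mmap_lin m s i a x 0; rewrite addr0 mmap0 addr0. Qed.

Lemma eta_with_id (s : 'I_k -> F U) i :
  ([eta s with i |-> s i] : 'I_k -> F U) = s.
Proof. by apply/funext => j /=; case: eqP => [->|]. Qed.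
End Multilinear.

Inductive span F (U : opens X) (gens : F U -> Prop) : F U -> Prop :=
| span0 : span gens 0
| span_lin a g y : gens g -> span gens y -> span gens (a *: g + y).

Lemma mmap_span k F G (m : multilinearMap k F G) U (gens : F U -> Prop)
    (S : G U -> Prop) : S 0 ->
  (forall a x y, S x -> S y -> S (a *: x + y)) ->
  (forall s, (forall i, gens (s i)) -> S (m U s)) ->
  forall s, (forall i, span gens (s i)) -> S (m U s).
Proof.
move=> S0 Slin Sg.
(* Induction on [t]: the first [t] arguments range over the span, the others are still
   generators. *)
suff H t s : (forall i : 'I_k, (i < t)%N -> span gens (s i)) ->
    (forall i : 'I_k, (t <= i)%N -> gens (s i)) -> S (m U s).
  move=> s ss; apply: (H k) => [i _//|i]; by rewrite leqNgt ltn_ord.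
elim: t s => [|t IH] s ss sg; first by apply: Sg => i; exact: sg.
have [kt|tk] := leqP k t.
  apply: IH => i => [it|ti]; first by apply: ss; rewrite ltnS ltnW.
  by have := leq_trans kt ti; rewrite leqNgt ltn_ord.
pose i0 := Ordinal tk; rewrite -[s](eta_with_id s i0).
have : span gens (s i0) by apply: ss.
elim=> [|a g y gg _ Sy]; first by rewrite mmap0.
rewrite mmap_lin; apply: Slin => //; apply: IH => i /=; case: eqP => [->|ii0] it.
- by rewrite ltnn in it.
- by apply: ss; exact: ltnW.
- by [].
- apply: sg; rewrite ltn_neqAle it andbT; apply/eqP => ti; apply: ii0.
  exact/val_inj.
Qed.

(** * Subsheaves and induction over universal modules *)

Record subsheaf F := Subsheaf {
  sub_mem :> forall U : opens X, F U -> Prop;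
  sub_mem0 : forall U : opens X, sub_mem (0 : F U);
  sub_memP : forall (U : opens X) a (s t : F U),
    sub_mem s -> sub_mem t -> sub_mem (a *: s + t);
  sub_mem_res : forall (U V : opens X) (h : V `<=` U) (s : F U),
    sub_mem s -> sub_mem (mres F h s);
  sub_mem_loc : forall (U : opens X) (s : F U),
    (forall x, U x -> exists (V : opens X) (h : V `<=` U),
       V x /\ sub_mem (mres F h s)) -> sub_mem s }.
Arguments sub_mem {F} _ U _.

Section SubsheafModule.
Variables (F : modSheaf A) (S : subsheaf F).

Definition sub_pred U : pred (F U) := fun s => `[< S U s >].
Definition sub_sec U := {s : F U | sub_pred s}.
HB.instance Definition _ U := Choice.on (sub_sec U).
HB.instance Definition _ U := SubChoice.on (sub_sec U).

Lemma sub_closed U : submod_closed (@sub_pred U).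
Proof.
split=> [|a s t /asboolP Ss /asboolP St]; apply/asboolP; first exact: sub_mem0.
exact: sub_memP.
Qed.

HB.instance Definition _ U :=
  GRing.SubChoice_isSubLmodule.Build _ _ _ (sub_sec U) (sub_closed U).

Lemma sub_secP U (s : sub_sec U) : S U (val s).
Proof. by apply/asboolP; exact: (valP s). Qed.

Definition mksub U (s : F U) (Ss : S U s) : sub_sec U := exist _ s (asboolT Ss).

Definition sub_res (U V : opens X) (h : V `<=` U) (s : sub_sec U) : sub_sec V :=
  mksub (sub_mem_res h (sub_secP s)).

Definition sub_module : modSheaf A.
Proof.
refine (@ModSheaf X A sub_sec sub_res _ _ _ _ _ _).
- by move=> U V h s t; apply/val_inj; exact: mresD.
- by move=> U V h a s; apply/val_inj; exact: mresZ.
- by move=> U h s; apply/val_inj; exact: mres_id.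
- by move=> U V W h1 h2 h3 s; apply/val_inj; exact: mres_comp.
- move=> U s t st; apply/val_inj; apply: msec_separated => x /st[V [h [Vx e]]].
  by exists V, h; split=> //; exact: (congr1 val e).
- move=> U I c h s cov comp.
  have [|t tP] := @msec_glue X A F U I c h (fun i => val (s i)) cov.
    by move=> i j W hi hj; exact: (congr1 val (comp i j W hi hj)).
  have St : S U t.
    apply: sub_mem_loc => x /cov[i cx]; exists (c i), (h i); split=> //.
    by rewrite tP; exact: sub_secP.
  by exists (mksub St) => i; apply/val_inj; exact: tP.
Defined.

Definition sub_inc : modHom sub_module F.
Proof. by refine (@mkHom sub_module F (fun U s => val (s : sub_sec U)) _ _). Defined.
End SubsheafModule.

(** Corestricting [b] to the subsheaf gives a morphism from [T] into it. Followed by the inclusion,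
    this is an endomorphism of [T] that fixes all [b U s t], hence the identity by uniqueness. The
    variants for tensor powers, exterior powers and inverse images follow the same pattern. *)
Lemma tensor_ind F G T (b : bilinearMap F G T) (S : subsheaf T) :
  is_tensor b -> (forall U s t, S U (b U s t)) -> forall U x, S U x.
Proof.
move=> tb Sb U x.
have b'P : exists b' : bilinearMap F G (sub_module S),
    forall U s t, val (b' U s t : sub_sec S U) = b U s t.
  unshelve eexists (@BilinearMap X A F G (sub_module S)
    (fun U s t => mksub (Sb U s t)) _ _ _) => //.
  - by move=> V a s s' t; apply/val_inj; exact: bmap_linl.
  - by move=> V a s t t'; apply/val_inj; exact: bmap_linr.
  - by move=> V W h s t; apply/val_inj; exact: bmap_res.
have [b' b'E] := b'P; have [phi [phiE _]] := tb _ b'.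
have [phi0 [_ phi0U]] := tb _ b.
have e1 := phi0U (idHom T) (fun _ _ _ => erefl).
have e2 := phi0U (compHom (sub_inc S) phi).
have -> : x = sub_inc S U (phi U x).
  rewrite -[LHS]/(idHom T U x) e1 -e2// => V s t.
  by rewrite -[LHS]/(val (phi V (b V s t) : sub_sec S V)) phiE b'E.
exact: sub_secP.
Qed.

Lemma tensor_power_ind k F T (m : multilinearMap k F T) (S : subsheaf T) :
  is_tensor_power m -> (forall U s, S U (m U s)) -> forall U x, S U x.
Proof.
move=> tm Sm U x.
have m'P : exists m' : multilinearMap k F (sub_module S),
    forall U s, val (m' U s : sub_sec S U) = m U s.
  unshelve eexists (@MultilinearMap k X A F (sub_module S)
    (fun U s => mksub (Sm U s)) _ _) => //.
  - by move=> V s i a y z; apply/val_inj; exact: mmap_lin.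
  - by move=> V W h s; apply/val_inj; exact: mmap_res.
have [m' m'E] := m'P; have [phi [phiE _]] := tm _ m'.
have [phi0 [_ phi0U]] := tm _ m.
have e1 := phi0U (idHom T) (fun _ _ => erefl).
have e2 := phi0U (compHom (sub_inc S) phi).
have -> : x = sub_inc S U (phi U x).
  rewrite -[LHS]/(idHom T U x) e1 -e2// => V s.
  by rewrite -[LHS]/(val (phi V (m V s) : sub_sec S V)) phiE m'E.
exact: sub_secP.
Qed.

Lemma exterior_power_ind k F T (m : multilinearMap k F T) (S : subsheaf T) :
  is_exterior_power m -> (forall U s, S U (m U s)) -> forall U x, S U x.
Proof.
move=> [am tm] Sm U x.
have m'P : exists m' : multilinearMap k F (sub_module S),
    forall U s, val (m' U s : sub_sec S U) = m U s.
  unshelve eexists (@MultilinearMap k X A F (sub_module S)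
    (fun U s => mksub (Sm U s)) _ _) => //.
  - by move=> V s i a y z; apply/val_inj; exact: mmap_lin.
  - by move=> V W h s; apply/val_inj; exact: mmap_res.
have [m' m'E] := m'P; have am' : alternating m'.
  by move=> V s i j ij sij; apply/val_inj; rewrite m'E (am V s i j).
have [phi [phiE _]] := tm _ m' am'.
have [phi0 [_ phi0U]] := tm _ m am.
have e1 := phi0U (idHom T) (fun _ _ => erefl).
have e2 := phi0U (compHom (sub_inc S) phi).
have -> : x = sub_inc S U (phi U x).
  rewrite -[LHS]/(idHom T U x) e1 -e2// => V s.
  by rewrite -[LHS]/(val (phi V (m V s) : sub_sec S V)) phiE m'E.
exact: sub_secP.
Qed.
(** A [ringPresheaf] need not be a sheaf; separation and gluing are supplied as arguments to make it
    a module over itself. *)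
Definition ring_module
  (sep : forall (U : opens X) (f g : A U), (forall x, U x ->
     exists (V : opens X) (h : V `<=` U), V x /\ rres A h f = rres A h g) -> f = g)
  (glue : forall (U : opens X) (I : Type) (c : I -> opens X)
     (h : forall i, c i `<=` U) (s : forall i, A (c i)),
     (forall x, U x -> exists i, c i x) ->
     (forall i j (W : opens X) (hi : W `<=` c i) (hj : W `<=` c j),
       rres A hi (s i) = rres A hj (s j)) ->
     exists t : A U, forall i, rres A (h i) t = s i) : modSheaf A.
Proof.
refine (@ModSheaf X A (fun U => (A U)^o : lmodType (A U))
  (fun U V h f => rres A h f) _ _ _ _ _ _).
- by move=> U V h f g; exact: rmorphD.
- by move=> U V h a f; exact: rmorphM.
- by move=> U h f; exact: rres_id.
- by move=> U V W h1 h2 h3 f; exact: rres_comp.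
- exact: sep.
- exact: glue.
Defined.

Lemma generator_res F (U V : opens X) (h : V `<=` U) (u : F U) :
  local_generator u -> local_generator (mres F h u).
Proof.
move=> ugen W k; have kh : W `<=` U by move=> x /k/h.
have [f fK fK'] := ugen W kh; exists f => a; first by rewrite (mres_comp _ _ kh) fK.
by rewrite (mres_comp _ _ kh) fK'.
Qed.

Lemma generator_unit F (U : opens X) (u : F U) a b : a * b = 1 ->
  local_generator u -> local_generator (a *: u).
Proof.
move=> ab ugen W k; have [f fK fK'] := ugen W k.
have rab : rres A k a * rres A k b = 1 by rewrite -rmorphM ab rmorph1.
exists (fun s => rres A k b * f s) => c.
  by rewrite mresZ scalerA fK mulrCA [rres A k b * _]mulrC rab mulr1.
by rewrite mresZ scalerA mulrAC [rres A k b * _]mulrC rab mul1r fK'.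
Qed.

(** * The inverse of a local generator *)

Section DualInverse.
Variables (F : modSheaf A) (D : dual F) (U : opens X) (u : F U).
Hypothesis ugen : local_generator u.

Lemma generator_inj (V : opens X) (h : V `<=` U) (a b : A V) :
  a *: mres F h u = b *: mres F h u -> a = b.
Proof. exact: (@bij_inj _ _ _ (ugen h) a b). Qed.

(** Every section of [F] over a smaller open set is a multiple of [u], so [w] and [w'] represent the
    same functional, and [dual_hom] says that the representing section is unique. *)
Lemma dual_ext (w w' : D U) : dual_pair u w = dual_pair u w' -> w = w'.
Proof.
move=> ww'.
have fl (V : opens X) (h : V `<=` U) : linear (fun s : F V => dual_pair s (mres D h w) : (A V)^o).
  by move=> a s s'; exact: dual_linl.
have [|w0 [_ w0U]] := @dual_hom _ _ _ D U (fun V h => lin_fun (fl V h)).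
  by move=> V W hV hW h s /=; rewrite /lin_fun dual_res (mres_comp _ _ hW).
rewrite -(w0U w) => [|V h s]; last by [].
apply: w0U => V h s; rewrite /= /lin_fun.
have [f fK fK'] := ugen h; rewrite -(fK' s).
have pZ (x : D V) a (t : F V) : dual_pair (a *: t) x = a * dual_pair t x.
  have := dual_linl (-1) 0 0 x; rewrite scaler0 addr0 mulN1r addNr => p0.
  by rewrite -[a *: t]addr0 dual_linl p0 addr0.
by rewrite !pZ -!dual_res ww'.
Qed.

(** The functional that sends a section to its coefficient with respect to [u] is linear and
    compatible with restriction. The section of the dual that represents it takes the value 1 on
    [u], so the set from which [dual_inv] chooses is not empty. *)
Lemma dual_inv_pair : dual_pair u (dual_inv D u) = 1.
Proof.
have [c cP] : exists c : forall V : opens X, V `<=` U -> F V -> A V,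
    forall (V : opens X) (h : V `<=` U) s, c V h s *: mres F h u = s.
  have H (V : opens X) (h : V `<=` U) (s : F V) : exists a, a *: mres F h u = s.
    by have [f _ fK'] := ugen h; exists (f s).
  by exists (fun V h s => projT1 (cid (H V h s))) => V h s; exact: (projT2 (cid (H V h s))).
have cl (V : opens X) (h : V `<=` U) : linear (c V h : F V -> (A V)^o).
  move=> a s t; apply: (@generator_inj V h).
  by rewrite cP scalerDl -scalerA !cP.
have [|w [wP _]] := @dual_hom _ _ _ D U (fun V h => lin_fun (cl V h)).
  move=> V W hV hW h s /=; rewrite /lin_fun; apply: (@generator_inj W hW).
  by rewrite cP -[X in mres F h X](cP V hV s) mresZ (mres_comp _ _ hW).
apply: (@xgetPex _ 0 [set w | dual_pair u w = 1]); exists w => /=.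
have idU : U `<=` U by [].
have := wP U idU u; rewrite /= /lin_fun mres_id => <-; apply: (@generator_inj U idU).
by rewrite cP scale1r mres_id.
Qed.

Lemma dual_inv_uniq (w : D U) : dual_pair u w = 1 -> w = dual_inv D u.
Proof. by move=> w1; apply: dual_ext; rewrite w1 dual_inv_pair. Qed.

Lemma dual_pairZr a (s : F U) (w : D U) : dual_pair s (a *: w) = a * dual_pair s w.
Proof.
have := dual_linr (-1) s (0 : D U) 0; rewrite scaler0 addr0 mulN1r addNr => p0.
by rewrite -[a *: w]addr0 dual_linr p0 addr0.
Qed.

Lemma dual_pairZl a (s : F U) (w : D U) : dual_pair (a *: s) w = a * dual_pair s w.
Proof.
have := dual_linl (-1) (0 : F U) 0 w; rewrite scaler0 addr0 mulN1r addNr => p0.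
by rewrite -[a *: s]addr0 dual_linl p0 addr0.
Qed.

Lemma dual_invE (w : D U) : w = dual_pair u w *: dual_inv D u.
Proof. by apply: dual_ext; rewrite dual_pairZr dual_inv_pair mulr1. Qed.
End DualInverse.

Lemma dual_inv_res F (D : dual F) (U V : opens X) (h : V `<=` U) (u : F U) :
  local_generator u -> mres D h (dual_inv D u) = dual_inv D (mres F h u).
Proof.
move=> ugen; apply: dual_inv_uniq; first exact: generator_res.
by rewrite -dual_res dual_inv_pair ?rmorph1.
Qed.

Lemma dual_inv_unit F (D : dual F) (U : opens X) (u : F U) a b : a * b = 1 ->
  local_generator u -> dual_inv D u = a *: dual_inv D (a *: u).
Proof.
move=> ab ugen; apply/esym/dual_inv_uniq => //.
by rewrite dual_pairZr -dual_pairZl dual_inv_pair//; apply: (generator_unit ab).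
Qed.

Lemma span_res F (U V : opens X) (h : V `<=` U) (gens : F U -> Prop)
    (gens' : F V -> Prop) : (forall g, gens g -> gens' (mres F h g)) ->
  forall s, span gens s -> span gens' (mres F h s).
Proof.
move=> gg s; elim=> [|a g y gs _ Sy]; first by rewrite mres0; exact: span0.
by rewrite mresD mresZ; apply: span_lin => //; exact: gg.
Qed.

Lemma spanP F (U : opens X) (gens : F U -> Prop) a s t :
  span gens s -> span gens t -> span gens (a *: s + t).
Proof.
move=> Ss St; elim: Ss => [|b g y gg _ IH]; first by rewrite scaler0 add0r.
by rewrite scalerDr scalerA -addrA; exact: span_lin.
Qed.

Lemma span_gen F (U : opens X) (gens : F U -> Prop) g : gens g -> span gens g.
Proof.
by move=> gg; rewrite -[g]addr0 -[g]scale1r; apply: span_lin => //; exact: span0.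
Qed.
End ModuleSheaves.

Lemma inverse_image_ind (X Y : topologicalType) (A : ringPresheaf X)
    (B : ringPresheaf Y) (p : ringedMap A B) (F : modSheaf A) (G : modSheaf B)
    (eta : modHom F (pushforward p G)) (S : subsheaf G) :
  is_inverse_image eta ->
  (forall U s, S (preim_opens (@rmap_continuous _ _ _ _ p) U) (eta U s)) ->
  forall W x, S W x.
Proof.
move=> ie Se W x.
pose f U (s : F U) : pushforward p (sub_module S) U := mksub (Se U s).
have fl U : linear (f U).
  by move=> a s t; apply/val_inj; rewrite /= linearP.
have fr (U V : opens X) (h : V `<=` U) s :
    mres (pushforward p (sub_module S)) h (f U s) = f V (mres F h s).
  by apply/val_inj; exact: (mhom_res eta h s).
have [phi [phiE _]] := ie _ (mkHom fl fr).
have [phi0 [_ phi0U]] := ie _ eta.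
have e1 := phi0U (idHom G) (fun _ _ => erefl).
have e2 := phi0U (compHom (sub_inc S) phi).
have -> : x = sub_inc S W (phi W x).
  rewrite -[LHS]/(idHom G W x) e1 -e2// => U s.
  by have /(congr1 val) := phiE U s.
exact: sub_secP.
Qed.

(** * Contraction of exterior powers *)

Section Alternating.
Variables (X : topologicalType) (A : ringPresheaf X) (F G : modSheaf A).
Variables (k : nat) (m : multilinearMap k F G) (am : alternating m).
Variable U : opens X.

Lemma alternating_tperm (s : 'I_k -> F U) a b : a != b ->
  m U (fun i => s (tperm a b i)) = - m U s.
Proof.
move=> ab; pose f x y := m U [eta [eta s with a |-> x] with b |-> y].
have fab x y : f x y = m U [eta [eta s with b |-> y] with a |-> x].
  congr (m U _); apply/funext => i /=; case: eqP => [->|//].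
  by rewrite eq_sym (negPf ab).
have fx x : f x x = 0.
  by rewrite /f (@am U _ a b)//= !eqxx (negPf ab).
have fDl x x' y : f (x + x') y = f x y + f x' y.
  by rewrite !fab; have := mmap_lin m [eta s with b |-> y] a 1 x x'; rewrite !scale1r.
have fDr x y y' : f x (y + y') = f x y + f x y'.
  by have := mmap_lin m [eta s with a |-> x] b 1 y y'; rewrite !scale1r.
have -> : (fun i => s (tperm a b i)) =
    [eta [eta s with a |-> s b] with b |-> s a].
  apply/funext => i /=; case: tpermP => [->|->|/eqP/negPf -> /eqP/negPf ->//].
    by rewrite (negPf ab) eqxx.
  by rewrite eqxx.
have -> : m U s = f (s a) (s b).
  congr (m U _); apply/funext => i /=.
  by case: eqP => [->//|_]; case: eqP => [->|].
apply/eqP; rewrite -addr_eq0 -/(f _ _); apply/eqP.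
by have := fx (s a + s b); rewrite fDl !fDr !fx add0r addr0 addrC.
Qed.

Lemma alternating_perm (s : 'I_k -> F U) (t : 'S_k) :
  m U (fun i => s (t i)) = (-1) ^+ (t : bool) *: m U s.
Proof.
have [ts -> dts] := prod_tpermP t; elim: ts s dts => [|[a b] ts IH] s /=.
  move=> _; rewrite big_nil odd_perm1 expr0 scale1r; congr (m U _).
  by apply/funext => i; rewrite perm1.
move=> /andP[ab dts]; rewrite big_cons odd_permM odd_tperm ab.
have := alternating_tperm (fun i => s ((\prod_(t <- ts) tperm t.1 t.2)%g i)) ab.
rewrite IH// signr_addb expr1 mulN1r scaleNr => <-.
by congr (m U _); apply/funext => i; rewrite permM.
Qed.
End Alternating.

Section Contraction.
Variables (X : topologicalType) (A : ringPresheaf X) (P : modSheaf A).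
Variables (ext : nat -> modSheaf A) (w : forall i, multilinearMap i P (ext i)).
Hypothesis wP : forall i, is_exterior_power (w i).
Variable pi : forall U, {linear P U -> (A U)^o}.
Hypothesis pi_res : forall (U V : opens X) (h : V `<=` U) s,
  rres A h (pi U s : A U) = pi V (mres P h s).

(** The interior product with [pi], normalized from the right: the last slot [k = i] has sign [+],
    which suits a differential that appends its factor at the end. *)
Definition contract_fun i U (s : 'I_i.+1 -> P U) : ext i U :=
  \sum_(k < i.+1) ((-1) ^+ (i + k) * (pi U (s k) : A U)) *:
    w i U (fun l => s (lift k l)).

Lemma eta_lift i U (s : 'I_i.+1 -> P U) k l z :
  (fun j => [eta s with lift k l |-> z] (lift k j)) =
  [eta (fun j => s (lift k j)) with l |-> z].
Proof. by apply/funext => j /=; rewrite (inj_eq lift_inj). Qed.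

Lemma contract_lin i U (s : 'I_i.+1 -> P U) l a x y :
  contract_fun [eta s with l |-> a *: x + y] =
  a *: contract_fun [eta s with l |-> x] + contract_fun [eta s with l |-> y].
Proof.
rewrite scaler_sumr -big_split/=; apply: eq_bigr => k _.
case: (unliftP k l) => [l' ->|->].
  rewrite !eta_lift mmap_lin /= (negPf (neq_lift _ _)).
  by rewrite scalerDr !scalerA mulrC.
have Ek z : [eta s with k |-> z] k = z by rewrite /= eqxx.
have E z : (fun j => [eta s with k |-> z] (lift k j)) = (fun j => s (lift k j)).
  by apply/funext => j /=; rewrite eq_sym (negPf (neq_lift _ _)).
rewrite !Ek !E linearP scalerA -scalerDl mulrDr; congr ((_ + _) *: _).
  by rewrite /= eqxx -mulrCA.
by rewrite /= eqxx.
Qed.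

Lemma contract_res i (U V : opens X) (h : V `<=` U) (s : 'I_i.+1 -> P U) :
  mres (ext i) h (contract_fun s) = contract_fun (fun k => mres P h (s k)).
Proof.
rewrite mres_sum; apply: eq_bigr => k _.
by rewrite mresZ rmorphM rmorphXn rmorphN1 pi_res mmap_res.
Qed.

Definition contract_map i : multilinearMap i.+1 P (ext i) :=
  MultilinearMap (@contract_lin i) (@contract_res i).

(** Compares the tuples obtained by deleting slot [a] and slot [b]. The permutation [t], extended by
    [b |-> a], is the transposition of [a] and [b]; its parity is then read off from that of
    [lift_perm]. *)
Lemma lift_tperm i (a b : 'I_i.+1) : a != b -> exists2 t : 'S_i,
  (t : bool) = ~~ (odd a (+) odd b) & forall k, tperm a b (lift b k) = lift a (t k).
Proof.
move=> ab; pose f k := odflt k (unlift a (tperm a b (lift b k))).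
have fE k : lift a (f k) = tperm a b (lift b k).
  rewrite /f; case: unliftP => [j ->//|/eqP].
  rewrite -[X in _ == X](tpermR a b) (inj_eq perm_inj) => /eqP e.
  by have := neq_lift b k; rewrite e eqxx.
have fI : injective f.
  by move=> k l kl; apply/(@lift_inj _ b)/(@perm_inj _ (tperm a b)); rewrite -!fE kl.
exists (perm fI) => [|k]; last by rewrite -fE permE.
have : lift_perm b a (perm fI) = tperm a b.
  apply/permP => x; case: (unliftP b x) => [k ->|->].
    by rewrite lift_perm_lift -fE permE.
  by rewrite lift_perm_id tpermR.
move=> /(congr1 (fun t : 'S_i.+1 => t : bool)); rewrite odd_lift_perm odd_tperm ab.
by case: (odd a); case: (odd b); case: (odd_perm _).
Qed.

(** If slots [a] and [b] agree, every term deleting a third slot still has two equal entries. The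
    two other terms differ by the permutation of [lift_tperm], whose sign makes them cancel. *)
Lemma contract_alternating i : alternating (contract_map i).
Proof.
move=> U s a b ab sab; rewrite /= /contract_fun.
rewrite (bigD1 a)//= (bigD1 b) 1?eq_sym//= big1 ?addr0; last first.
  move=> k /andP[ka kb]; have [a' aE _] := unlift_some ka.
  have [b' bE _] := unlift_some kb; rewrite (_ : w i U _ = 0) ?scaler0//.
  apply: ((wP i).1 U _ a' b'); last by rewrite -aE -bE.
  by apply: contra_neq ab => ab'; rewrite aE bE ab'.
have [t tE tP] := lift_tperm ab.
have -> : (fun l => s (lift b l)) = (fun l => (fun l => s (lift a l)) (t l)).
  apply/funext => l /=; rewrite -tP.
  by case: tpermP => [->|->|].
rewrite (alternating_perm (wP i).1 (fun l => s (lift a l)) t) scalerA -scalerDl -sab.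
rewrite [X in _ + X]mulrAC -mulrDl (_ : _ + _ = 0) ?mul0r ?scale0r//.
rewrite tE -signr_odd -[X in _ + X * _]signr_odd !oddD.
by case: (odd i); case: (odd a); case: (odd b); rewrite /= ?expr0 ?expr1; ring.
Qed.

Lemma contraction_exists : exists iota : forall i, modHom (ext i.+1) (ext i),
  forall i U s, iota i U (w i.+1 U s) = contract_fun s.
Proof.
have H i : exists phi : modHom (ext i.+1) (ext i),
    forall U s, phi U (w i.+1 U s) = contract_fun s.
  have [phi [phiE _]] := (wP i.+1).2 _ _ (@contract_alternating i).
  by exists phi => U s; rewrite phiE.
by exists (fun i => projT1 (cid (H i))) => i; exact: (projT2 (cid (H i))).
Qed.

Lemma contract_rcons i U (s : 'I_i -> P U) x :
  contract_fun (rcons_fun s x) =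
  \sum_(k < i) ((-1) ^+ (i + k) * (pi U (s k) : A U)) *:
     w i U (fun l => rcons_fun s x (lift (lift ord_max k) l)) +
  (pi U x : A U) *: w i U s.
Proof.
rewrite /contract_fun big_ord_recr/=; congr (_ + _).
  apply: eq_bigr => k _.
  have -> : widen_ord (leqnSn i) k = lift ord_max k.
    by apply/val_inj; rewrite /= /bump leqNgt ltn_ord.
  by rewrite {1}/rcons_fun liftK.
rewrite {1}/rcons_fun unlift_none addnn -signr_odd odd_double expr0 mul1r.
by congr (_ *: w i U _); apply/funext => l; rewrite /rcons_fun liftK.
Qed.

Lemma rcons_lift T i (s : 'I_i.+1 -> T) x k :
  (fun l => rcons_fun s x (lift (lift ord_max k) l)) =
  rcons_fun (fun l => s (lift k l)) x.
Proof.
apply/funext => l; case: (unliftP ord_max l) => [l' ->|->].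
  have -> : lift (lift ord_max k) (lift ord_max l') = lift ord_max (lift k l').
    apply/val_inj => /=; rewrite /bump.
    have li := ltn_ord l'; have ki := ltn_ord k.
    have -> : (i < k)%N = false by apply/negbTE; rewrite -leqNgt -ltnS.
    have -> : (i <= l')%N = false by apply/negbTE; rewrite -ltnNge.
    have -> : (i < (k <= l') + l')%N = false.
      by apply/negbTE; rewrite -leqNgt; case: (k <= l')%N; rewrite ?add1n ?add0n// ltnW.
    by rewrite !add0n.
  by rewrite /rcons_fun !liftK.
have -> : lift (lift ord_max k) ord_max = ord_max :> 'I_i.+2.
  apply/val_inj => /=; rewrite /bump; have ki := ltn_ord k.
  have -> : (i < k)%N = false by apply/negbTE; rewrite -leqNgt -ltnS.
  by rewrite add0n -ltnS ki.
by rewrite /rcons_fun !unlift_none.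
Qed.
End Contraction.

Lemma mres_pushforward (X Y : topologicalType) (A : ringPresheaf X)
    (B : ringPresheaf Y) (p : ringedMap A B) (F : modSheaf B) (U V : opens X)
    (h : V `<=` U) (h' : preim_opens (@rmap_continuous _ _ _ _ p) V `<=`
      preim_opens (@rmap_continuous _ _ _ _ p) U) (s : pushforward p F U) :
  mres (pushforward p F) h s = mres F h' s.
Proof. exact: (@mres_irr _ _ F). Qed.

(** * Principal parts *)

(* [p1] and [p2] stand for the projections of X x X, [dm] for the diagonal
   embedding, [J] for O_{XxX} / I^2 and [Q] for its tensor product with
   [G] = p2^*L. *)
Section AbstractParts.
Variables (X Y : topologicalType) (A : ringPresheaf X) (B : ringPresheaf Y).
Variables (p1 p2 : ringedMap A B) (dm : ringedMap B A).
Local Notation i1 U := (preim_opens (@rmap_continuous _ _ _ _ p1) U).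
Local Notation i2 U := (preim_opens (@rmap_continuous _ _ _ _ p2) U).
Local Notation di W := (preim_opens (@rmap_continuous _ _ _ _ dm) W).
Local Notation sq U := (opensI (i1 U) (i2 U)).
Local Notation s1 U a := (rmap_sharp p1 U a : B (i1 U)).
Local Notation s2 U a := (rmap_sharp p2 U a : B (i2 U)).
Local Notation sd W g := (rmap_sharp dm W g : A (di W)).

Lemma sq1 (U : opens X) : sq U `<=` i1 U. Proof. by move=> y []. Qed.
Lemma sq2 (U : opens X) : sq U `<=` i2 U. Proof. by move=> y []. Qed.

Hypotheses (p1d : forall x, p1 (dm x) = x) (p2d : forall x, p2 (dm x) = x).

Lemma di1 (U : opens X) : U `<=` di (i1 U).
Proof. by move=> x Ux; rewrite /preim_opens /= /preimage /= p1d. Qed.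
Lemma di2 (U : opens X) : di (i2 U) `<=` U.
Proof. by move=> x; rewrite /preim_opens /= /preimage /= p2d. Qed.
Lemma disq (U : opens X) : U `<=` di (sq U).
Proof. by move=> x Ux; split; rewrite /preim_opens /= /preimage /= ?p1d ?p2d. Qed.

Hypothesis sd1 : forall (U : opens X) (h : U `<=` di (i1 U)) a, rres A h (sd (i1 U) (s1 U a)) = a.
Hypothesis sd2 : forall (U : opens X) (h : di (i2 U) `<=` U) a, rres A h a = sd (i2 U) (s2 U a).

Variables (L : modSheaf A) (G : modSheaf B) (eta : modHom L (pushforward p2 G)).
Hypothesis etaP : is_inverse_image eta.
Local Notation et U u := (eta U u : G (i2 U)).

Lemma unitZ U a (u : L U) : et U (a *: u) = s2 U a *: et U u.
Proof. exact: (linearZ_LR (eta U) a u). Qed.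

(** Restriction of [p2^*L] to the diagonal is [L] because [p2] composed with [dm] is the identity;
    the adjunction turns this into a morphism from [G] to [dm_*L]. *)
Lemma pull_diag : exists phi : modHom G (pushforward dm L),
  forall U (u : L U), phi (i2 U) (et U u) = mres L (@di2 U) u.
Proof.
pose f U (u : L U) : pushforward p2 (pushforward dm L) U := mres L (@di2 U) u.
have fl U : linear (f U) by move=> a u v; rewrite /f mresD mresZ sd2.
have fr (U V : opens X) (k : V `<=` U) s :
    mres (pushforward p2 (pushforward dm L)) k (f U s) = f V (mres L k s).
  have kk : di (i2 V) `<=` U by move=> x /di2/k.
  by rewrite /f (mres_comp _ _ kk); exact: (mres_comp (@di2 U) _ kk).
have [phi [phiE _]] := etaP (mkHom fl fr).
by exists phi => U u; rewrite -[LHS]/(pushforward_hom phi (eta U u)) phiE.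
Qed.

Variables (J : modSheaf B) (I : forall W : opens Y, set (B W)) (q : quotientMap I J).
Variable rho : forall W, J W -> A (di W).
Hypothesis rho_lin : forall W a t t', rho (a *: t + t') = sd W a * rho t + rho t'.
Hypothesis rho_res : forall (V W : opens Y) (h : W `<=` V) (h' : di W `<=` di V) t,
  rres A h' (rho t) = rho (mres J h t).
Hypothesis rhoq : forall W g, rho (q W g) = sd W g.

Variables (Q : modSheaf B) (tens : bilinearMap G J Q).
Hypothesis tensP : is_tensor tens.

(** Evaluation along the diagonal of a section of p2^*L tensored with a jet. Its direct image under
    [p1] is the projection from [P(L)] to [L], see [ev_exists]. *)
Lemma mod_diag : exists psi : modHom Q (pushforward dm L),
  forall (U : opens X) (u : L U) (V : opens Y) (h : V `<=` i2 U) (k : di V `<=` U) (g : B V),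
    psi V (tens V (mres G h (et U u)) (q V g)) = sd V g *: mres L k u.
Proof.
have [phi phiE] := pull_diag.
pose f V (l : G V) (t : J V) : pushforward dm L V := rho t *: (phi V l : L (di V)).
have fl (V : opens Y) a (l l' : G V) (t : J V) :
    f V (a *: l + l') t = a *: f V l t + f V l' t.
  rewrite /f linearP.
  rewrite -[X in _ *: X]/(sd V a *: (phi V l : L (di V)) + (phi V l' : L (di V))).
  by rewrite scalerDr scalerA mulrC -scalerA.
have fr (V : opens Y) a (l : G V) (t t' : J V) :
    f V l (a *: t + t') = a *: f V l t + f V l t'.
  by rewrite /f rho_lin scalerDl -scalerA.
have fres (V W : opens Y) (h : W `<=` V) (l : G V) (t : J V) :
    mres (pushforward dm L) h (f V l t) = f W (mres G h l) (mres J h t).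
  have hd : di W `<=` di V by move=> x /h.
  have e : phi W (mres G h l) = mres L hd (phi V l : L (di V)).
    by rewrite -mhom_res; exact: mres_pushforward.
  by rewrite /f e -(rho_res h hd) -mresZ; exact: mres_pushforward.
have [psi [psiE _]] := tensP (BilinearMap fl fr fres).
exists psi => U u V h k g; rewrite psiE /= /f rhoq -mhom_res phiE.
by congr (_ *: _); exact: (mres_comp (@di2 U) _ k).
Qed.

(** * Sections of P(L) as classes of functions near the diagonal *)

Hypothesis off0 : forall W : opens Y, (forall x, ~ W (dm x)) -> forall t : J W, t = 0.
Hypothesis offN : forall y, (forall x, dm x <> y) ->
  exists N : opens Y, N y /\ forall x, ~ N (dm x).

(** The support of the tensor product lies in that of the factor [J]. The predicate quantifies over
    the open subsets missing the diagonal in order to be a subsheaf on all of [Y]. *)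
Lemma mod_off (W : opens Y) : (forall x, ~ W (dm x)) -> forall t : Q W, t = 0.
Proof.
pose S (U : opens Y) (s : Q U) := forall (V : opens Y) (h : V `<=` U),
  (forall x, ~ V (dm x)) -> mres Q h s = 0.
have S0 (U : opens Y) : S U 0 by move=> V h _; rewrite mres0.
have Slin (U : opens Y) a (s t : Q U) : S U s -> S U t -> S U (a *: s + t).
  by move=> Ss St V h Vo; rewrite mresD mresZ Ss// St// scaler0 addr0.
have Sres (U V : opens Y) (h : V `<=` U) (s : Q U) : S U s -> S V (mres Q h s).
  move=> Ss W' h' Wo; have hh : W' `<=` U by move=> y /h'/h.
  by rewrite (mres_comp _ _ hh) Ss.
have Sloc (U : opens Y) (s : Q U) : (forall x, U x -> exists (V : opens Y) (h : V `<=` U),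
    V x /\ S V (mres Q h s)) -> S U s.
  move=> loc V h Vo; apply: msec_separated => y Vy.
  have [V' [h' [V'y Ss]]] := loc y (h y Vy).
  have k1 : opensI V V' `<=` V by move=> z [].
  have k2 : opensI V V' `<=` V' by move=> z [].
  have k3 : opensI V V' `<=` U by move=> z /k1/h.
  exists (opensI V V'), k1; split=> //.
  rewrite (mres_comp _ _ k3) mres0 -(mres_comp h' k2 k3); apply: Ss => x [] Vx _.
  exact: Vo Vx.
move=> Wo t; rewrite -[t](@mres_id _ _ Q W (fun _ => id)).
apply: (@tensor_ind _ _ _ _ _ _ (Subsheaf S0 Slin Sres Sloc) tensP _ W t W _ Wo) => U l s V h Vo.
by rewrite bmap_res [X in tens V _ X]off0// bmap0r.
Qed.

Lemma class_inj U (s t : Q (i1 U)) : mres Q (@sq1 U) s = mres Q (@sq1 U) t -> s = t.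
Proof.
move=> st; apply: msec_separated => y Uy.
have [[x xy]|yo] := pselect (exists x, dm x = y).
  exists (sq U), (@sq1 U); split=> //; split=> //.
  by move: Uy; rewrite -xy /= /preimage /= p1d p2d.
have [N [Ny No]] := offN (y := y) (fun x xy => yo (ex_intro _ x xy)).
have k1 : opensI (i1 U) N `<=` i1 U by move=> z [].
exists (opensI (i1 U) N), k1; split=> //.
have Vo x : ~ opensI (i1 U) N (dm x) by move=> [_ /No].
by rewrite (mod_off Vo (mres Q k1 s)) (mod_off Vo (mres Q k1 t)).
Qed.

(** Extension by zero: [i1 U] is covered by [sq U] and by open sets that miss the diagonal. On
    overlaps with the latter all sections of [Q] vanish, so [t] glues with 0. *)
Lemma class_ex U (t : Q (sq U)) : exists s : Q (i1 U), mres Q (@sq1 U) s = t.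
Proof.
have [N NP] := choice (fun y : {y | forall x, dm x <> y} => offN (proj2_sig y)).
pose c (i : option {y | forall x, dm x <> y}) : opens Y :=
  if i is Some y then opensI (i1 U) (N y) else sq U.
have h i : c i `<=` i1 U by case: i => [y|] z [].
pose s i : Q (c i) := if i is Some y then 0 else t.
have [y Uy|i j W hi hj|r rP] := @msec_glue _ _ Q (i1 U) _ c h s.
- have [[x xy]|yo] := pselect (exists x, dm x = y).
    by exists None; split=> //; move: Uy; rewrite -xy /= /preimage /= p1d p2d.
  have yo' x : dm x <> y by move=> xy; apply: yo; exists x.
  by exists (Some (exist _ y yo')); split=> //; have [] := NP (exist _ y yo').
- case: i hi => [y|] hi; [|case: j hj => [y|] hj]; last exact: mres_irr.
    have Wo x : ~ W (dm x) by move=> /hi[_]; have [_ /(_ x)] := NP y.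
    by rewrite [LHS](mod_off Wo) [RHS](mod_off Wo).
  have Wo x : ~ W (dm x) by move=> /hj[_]; have [_ /(_ x)] := NP y.
  by rewrite [LHS](mod_off Wo) [RHS](mod_off Wo).
- by exists r; rewrite -[RHS](rP None); exact: mres_irr.
Qed.

Definition is_class U (u : L U) (g : B (sq U)) (s : Q (i1 U)) : Prop :=
  mres Q (@sq1 U) s = tens (sq U) (mres G (@sq2 U) (et U u)) (q (sq U) g).

Lemma is_class_ex U (u : L U) (g : B (sq U)) : exists s, is_class u g s.
Proof. exact: class_ex. Qed.

Lemma is_class_xget U (u : L U) (g : B (sq U)) (h1 : sq U `<=` i1 U) (h2 : sq U `<=` i2 U) :
  is_class u g (xget 0 [set s : Q (i1 U) | mres Q h1 s =
    tens (sq U) (mres G h2 (et U u)) (q (sq U) g)]).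
Proof.
have [s us] := is_class_ex u g; rewrite /is_class (mres_irr _ h1) (mres_irr _ h2).
apply: (@xgetPex _ 0 [set s : Q (i1 U) | mres Q h1 s =
  tens (sq U) (mres G h2 (et U u)) (q (sq U) g)]); exists s => /=.
by rewrite (mres_irr _ (@sq1 U)) (mres_irr _ (@sq2 U)).
Qed.

Lemma is_class_uniq U (u : L U) (g : B (sq U)) s t :
  is_class u g s -> is_class u g t -> s = t.
Proof. by move=> us ut; apply: class_inj; rewrite us ut. Qed.

Lemma is_class_lin U (u : L U) (g g' : B (sq U)) s s' a :
  is_class u g s -> is_class u g' s' ->
  is_class u (rres B (@sq1 U) (s1 U a) * g + g') (s1 U a *: s + s').
Proof.
move=> us us'; rewrite /is_class mresD mresZ us us' -bmapZr -bmapDr.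
by congr (tens _ _ _); rewrite -[LHS]linearP.
Qed.

(** Functions act on [P(L)] through [p1], but on the section [u] inside p2^*L through [p2]. The
    difference of the two actions is the source of the derivation rule. *)
Lemma is_class_scale U (u : L U) (g : B (sq U)) s a :
  is_class (a *: u) g s <-> is_class u (rres B (@sq2 U) (s2 U a) * g) s.
Proof.
rewrite /is_class; set x := tens _ _ _; set y := tens _ _ _.
suff -> : x = y by [].
rewrite {}/x {}/y unitZ mresZ bmapZl -bmapZr.
by congr (tens _ _ _); rewrite -[LHS]linearZ.
Qed.

Lemma is_class_res (U V : opens X) (h : V `<=` U) (h1 : i1 V `<=` i1 U)
    (hs : sq V `<=` sq U) (u : L U) (g : B (sq U)) s :
  is_class u g s -> is_class (mres L h u) (rres B hs g) (mres Q h1 s).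
Proof.
move=> us; have k : sq V `<=` i1 U by move=> y /sq1/h1.
have k2 : sq V `<=` i2 U by move=> y /hs/sq2.
rewrite /is_class (mres_comp _ _ k) -(mres_comp (@sq1 U) hs) us bmap_res.
rewrite -qmap_res (mres_comp _ _ k2) -mhom_res.
have h2 : i2 V `<=` i2 U by move=> y /h.
by rewrite (mres_pushforward h h2) (mres_comp _ _ k2).
Qed.

Lemma is_class_ker U (u : L U) (g g' : B (sq U)) s :
  I (g - g') -> is_class u g s -> is_class u g' s.
Proof.
move=> /(qmap_ker q); rewrite linearB => /eqP; rewrite subr_eq0 => /eqP e.
by rewrite /is_class e.
Qed.

Lemma ev_exists : exists ev : modHom (pushforward p1 Q) L,
  forall U (u : L U) g s, is_class u g s ->
    ev U s = rres A (@disq U) (sd (sq U) g) *: u.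
Proof.
have [psi psiE] := mod_diag.
pose f U (s : pushforward p1 Q U) : L U := mres L (@di1 U) (psi (i1 U) s : L (di (i1 U))).
have fl U : linear (f U).
  move=> a s t; have psil W b (x y : Q W) : (psi W (b *: x + y) : L (di W)) =
      sd W b *: (psi W x : L (di W)) + (psi W y : L (di W)) by exact: linearP.
  have := congr1 (mres L (@di1 U)) (psil (i1 U) (s1 U a) s t).
  by rewrite mresD mresZ sd1.
have fr (U V : opens X) (k : V `<=` U) s : mres L k (f U s) = f V (mres (pushforward p1 Q) k s).
  have kk : V `<=` di (i1 U) by move=> x /k/di1.
  rewrite /f (mres_comp _ _ kk) -(mhom_res psi).
  have kd : di (i1 V) `<=` di (i1 U) by move=> x /k.
  by rewrite (mres_pushforward _ kd) (mres_comp _ _ kk).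
exists (mkHom fl fr) => U u g s us; rewrite -[LHS]/(f U s) /f.
have k : di (sq U) `<=` di (i1 U) by move=> x [].
rewrite -(mres_comp k (@disq U)).
have -> : mres L k (psi (i1 U) s : L (di (i1 U))) = psi (sq U) (mres Q (@sq1 U) s).
  by rewrite -mhom_res; exact: mres_irr.
have k' : di (sq U) `<=` U by move=> x [_ /di2].
rewrite us (psiE U u _ _ k') mresZ (mres_comp _ _ (fun _ => id)) mres_id//.
Qed.

Hypothesis sq_nbhs : forall (W : opens Y) x, W (dm x) ->
  exists V : opens X, V x /\ sq V `<=` W.

Lemma opensI_sq (V V' : opens X) : sq (opensI V V') `<=` opensI (sq V) (sq V').
Proof. by move=> y [[a b] [c d]]; split; split. Qed.

(** The predicate [S] only concerns the germ at the point [dm x] and is vacuous on open sets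
    avoiding it. Near that point a section pulled back from [L] is a multiple of the pulled back
    generator. *)
Lemma pull_local (V0 : opens X) (u : L V0) x : local_generator u -> V0 x ->
  forall (W : opens Y) (l : G W), W (dm x) ->
  exists (V : opens X) (hW : sq V `<=` W) (h0 : V `<=` V0) (f : B (sq V)),
    V x /\ mres G hW l = f *: mres G (@sq2 V) (et V (mres L h0 u)).
Proof.
move=> ugen V0x.
pose S (W : opens Y) (l : G W) := W (dm x) ->
  exists (V : opens X) (hW : sq V `<=` W) (h0 : V `<=` V0) (f : B (sq V)),
    V x /\ mres G hW l = f *: mres G (@sq2 V) (et V (mres L h0 u)).
have small (V V' : opens X) (k : V' `<=` V) (ks : sq V' `<=` sq V) (h0 : V `<=` V0) (h0' : V' `<=` V0) :
    mres G ks (mres G (@sq2 V) (et V (mres L h0 u))) =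
    mres G (@sq2 V') (et V' (mres L h0' u)).
  have k2 : sq V' `<=` i2 V by move=> y /ks/sq2.
  have h2 : i2 V' `<=` i2 V by move=> y /k.
  rewrite (mres_comp _ _ k2) -(mres_comp h0 k h0') -(mhom_res eta k).
  by rewrite (mres_pushforward k h2) (mres_comp _ _ k2).
have S0 (W : opens Y) : S W 0.
  move=> Wx; have [V [Vx VW]] := sq_nbhs Wx.
  have h1 : opensI V V0 `<=` V0 by move=> y [].
  have h2 : sq (opensI V V0) `<=` W by move=> y /opensI_sq[/VW].
  by exists (opensI V V0), h2, h1, 0; split=> //; rewrite mres0 scale0r.
have Slin (W : opens Y) a (s t : G W) : S W s -> S W t -> S W (a *: s + t).
  move=> Ss St Wx; have [V [hV [V0V [f [Vx sE]]]]] := Ss Wx.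
  have [V' [hV' [V0V' [f' [V'x tE]]]]] := St Wx.
  pose VV := opensI V V'.
  have k : VV `<=` V by move=> y [].
  have k' : VV `<=` V' by move=> y [].
  have kk : sq VV `<=` sq V by move=> y /opensI_sq[].
  have kk' : sq VV `<=` sq V' by move=> y /opensI_sq[].
  have kW : sq VV `<=` W by move=> y /kk/hV.
  have k0 : VV `<=` V0 by move=> y /k/V0V.
  exists VV, kW, k0, (rres B kW a * rres B kk f + rres B kk' f'); split=> //.
  rewrite mresD mresZ -(mres_comp hV kk kW) -(mres_comp hV' kk' kW) sE tE.
  by rewrite !mresZ !(small _ _ _ _ _ k0)// scalerA -scalerDl.
have Sres (U V : opens Y) (h : V `<=` U) (s : G U) : S U s -> S V (mres G h s).
  move=> Ss Vx; have [V1 [hV [V0V [f [V1x sE]]]]] := Ss (h _ Vx).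
  have [V2 [V2x V2V]] := sq_nbhs Vx; pose VV := opensI V1 V2.
  have k : VV `<=` V1 by move=> y [].
  have kk : sq VV `<=` sq V1 by move=> y /opensI_sq[].
  have kW : sq VV `<=` U by move=> y /kk/hV.
  have kV : sq VV `<=` V by move=> y /opensI_sq[_ /V2V].
  have k0 : VV `<=` V0 by move=> y /k/V0V.
  exists VV, kV, k0, (rres B kk f); split=> //.
  by rewrite (mres_comp _ _ kW) -(mres_comp hV kk kW) sE mresZ (small _ _ _ _ _ k0).
have Sloc (U : opens Y) (s : G U) : (forall x, U x -> exists (V : opens Y) (h : V `<=` U),
    V x /\ S V (mres G h s)) -> S U s.
  move=> loc Ux; have [V [h [Vx Ss]]] := loc _ Ux.
  have [V1 [hV [V0V [f [V1x sE]]]]] := Ss Vx.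
  have kU : sq V1 `<=` U by move=> y /hV/h.
  by exists V1, kU, V0V, f; split=> //; rewrite -sE (mres_comp _ _ kU).
apply: (@inverse_image_ind _ _ _ _ _ _ _ _ (Subsheaf S0 Slin Sres Sloc) etaP) => U v /=.
rewrite /S /preim_opens /= /opens_mem /= /preimage /= p2d => Ux.
pose VV := opensI U V0.
have kU : VV `<=` U by move=> y [].
have k0 : VV `<=` V0 by move=> y [].
have k2U : i2 VV `<=` i2 U by move=> y /kU.
have ksU : sq VV `<=` i2 U by move=> y /sq2/k2U.
have [a' _ aK] := ugen VV k0.
exists VV, ksU, k0, (rres B (@sq2 VV) (s2 VV (a' (mres L kU v)))); split=> //.
rewrite -mresZ -unitZ aK -(mhom_res eta kU) (mres_pushforward kU k2U).
by rewrite (mres_comp _ _ ksU).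
Qed.

(** Near the diagonal both factors of a simple tensor are explicit: the first is a multiple of
    p2^*u, the second is the image of a function. Moving the coefficient to the second factor leaves
    a single function [g]. *)
Lemma class_local (V0 : opens X) (u : L V0) x : local_generator u -> V0 x ->
  forall (U : opens X) (s : Q (i1 U)), U x ->
  exists (V : opens X) (h : V `<=` U) (h0 : V `<=` V0) (h1 : i1 V `<=` i1 U) (g : B (sq V)),
    V x /\ is_class (mres L h0 u) g (mres Q h1 s).
Proof.
move=> ugen V0x.
pose uV (V : opens X) (h0 : V `<=` V0) := mres G (@sq2 V) (et V (mres L h0 u)).
pose S (W : opens Y) (s : Q W) := W (dm x) ->
  exists (V : opens X) (hW : sq V `<=` W) (h0 : V `<=` V0) (g : B (sq V)),
    V x /\ mres Q hW s = tens (sq V) (uV V h0) (q (sq V) g).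
have small (V V' : opens X) (k : V' `<=` V) (ks : sq V' `<=` sq V) (h0 : V `<=` V0)
    (h0' : V' `<=` V0) g : mres Q ks (tens (sq V) (uV V h0) (q (sq V) g)) =
    tens (sq V') (uV V' h0') (q (sq V') (rres B ks g)).
  have k2 : sq V' `<=` i2 V by move=> y /ks/sq2.
  have h2 : i2 V' `<=` i2 V by move=> y /k.
  rewrite bmap_res qmap_res /uV (mres_comp _ _ k2) -(mres_comp h0 k h0').
  by rewrite -(mhom_res eta k) (mres_pushforward k h2) (mres_comp _ _ k2).
have S0 (W : opens Y) : S W 0.
  move=> Wx; have [V [Vx VW]] := sq_nbhs Wx.
  have h1 : opensI V V0 `<=` V0 by move=> y [].
  have h2 : sq (opensI V V0) `<=` W by move=> y /opensI_sq[/VW].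
  by exists (opensI V V0), h2, h1, 0; split=> //; rewrite mres0 linear0 bmap0r.
have Slin (W : opens Y) a (s t : Q W) : S W s -> S W t -> S W (a *: s + t).
  move=> Ss St Wx; have [V [hV [V0V [f [Vx sE]]]]] := Ss Wx.
  have [V' [hV' [V0V' [f' [V'x tE]]]]] := St Wx.
  pose VV := opensI V V'.
  have k : VV `<=` V by move=> y [].
  have k' : VV `<=` V' by move=> y [].
  have kk : sq VV `<=` sq V by move=> y /opensI_sq[].
  have kk' : sq VV `<=` sq V' by move=> y /opensI_sq[].
  have kW : sq VV `<=` W by move=> y /kk/hV.
  have k0 : VV `<=` V0 by move=> y /k/V0V.
  exists VV, kW, k0, (rres B kW a * rres B kk f + rres B kk' f'); split=> //.
  rewrite mresD mresZ -(mres_comp hV kk kW) -(mres_comp hV' kk' kW) sE tE.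
  rewrite (small _ _ k _ _ k0) (small _ _ k' _ _ k0) -bmapZr -bmapDr.
  by congr (tens _ _ _); rewrite -[LHS]linearP.
have Sres (U V : opens Y) (h : V `<=` U) (s : Q U) : S U s -> S V (mres Q h s).
  move=> Ss Vx; have [V1 [hV [V0V [f [V1x sE]]]]] := Ss (h _ Vx).
  have [V2 [V2x V2V]] := sq_nbhs Vx; pose VV := opensI V1 V2.
  have k : VV `<=` V1 by move=> y [].
  have kk : sq VV `<=` sq V1 by move=> y /opensI_sq[].
  have kW : sq VV `<=` U by move=> y /kk/hV.
  have kV : sq VV `<=` V by move=> y /opensI_sq[_ /V2V].
  have k0 : VV `<=` V0 by move=> y /k/V0V.
  exists VV, kV, k0, (rres B kk f); split=> //.
  by rewrite (mres_comp _ _ kW) -(mres_comp hV kk kW) sE (small _ _ k _ _ k0).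
have Sloc (U : opens Y) (s : Q U) : (forall x, U x -> exists (V : opens Y) (h : V `<=` U),
    V x /\ S V (mres Q h s)) -> S U s.
  move=> loc Ux; have [V [h [Vx Ss]]] := loc _ Ux.
  have [V1 [hV [V0V [f [V1x sE]]]]] := Ss Vx.
  have kU : sq V1 `<=` U by move=> y /hV/h.
  by exists V1, kU, V0V, f; split=> //; rewrite -sE (mres_comp _ _ kU).
have SP : forall W s, S W s.
  apply: (@tensor_ind _ _ _ _ _ _ (Subsheaf S0 Slin Sres Sloc) tensP) => W l t Wx.
  have [V1 [hV [V0V [f [V1x lE]]]]] := pull_local ugen V0x l Wx.
  have [V2 [h2 [g [V2x gE]]]] := qmap_surj q t Wx.
  have [V3 [V3x V3V2]] := sq_nbhs V2x.
  pose VV := opensI V1 V3.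
  have k : VV `<=` V1 by move=> y [].
  have kk : sq VV `<=` sq V1 by move=> y /opensI_sq[].
  have kW : sq VV `<=` W by move=> y /kk/hV.
  have kV : sq VV `<=` V2 by move=> y /opensI_sq[_ /V3V2].
  have k0 : VV `<=` V0 by move=> y /k/V0V.
  exists VV, kW, k0, (rres B kk f * rres B kV g); split=> //.
  rewrite bmap_res -(mres_comp hV kk kW) lE mresZ bmapZl -bmapZr.
  have -> : mres J kW t = q (sq VV) (rres B kV g).
    by rewrite -qmap_res gE (mres_comp _ _ kW).
  have h2' : i2 VV `<=` i2 V1 by move=> y /k.
  have k2 : sq VV `<=` i2 V1 by move=> y /kk/sq2.
  congr (tens _ _ _); last by rewrite -[LHS]linearZ.
  rewrite (mres_comp _ _ k2) /uV -(mres_comp V0V k k0) -(mhom_res eta k).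
  by rewrite (mres_pushforward k h2') (mres_comp _ _ k2).
move=> U s Ux; have xU : (i1 U) (dm x) by rewrite /= /opens_mem /= /preimage /= p1d.
have [V [hW [h0 [g [Vx sE]]]]] := SP _ s xU.
pose VV := opensI V U.
have kU : VV `<=` U by move=> y [].
have k0 : VV `<=` V0 by move=> y [/h0].
have k1 : i1 VV `<=` i1 U by move=> y /kU.
have kV : VV `<=` V by move=> y [].
have kk : sq VV `<=` sq V by move=> y /opensI_sq[].
have kW : sq VV `<=` i1 U by move=> y /kk/hW.
exists VV, kU, k0, k1, (rres B kk g); split=> //.
by rewrite /is_class (mres_comp _ _ kW) -(mres_comp hW kk kW) sE (small _ _ kV _ _ k0).
Qed.

Hypothesis sepA : forall (U : opens X) (f g : A U), (forall x, U x ->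
  exists (V : opens X) (h : V `<=` U), V x /\ rres A h f = rres A h g) -> f = g.
Hypothesis glueA : forall (U : opens X) (T : Type) (c : T -> opens X)
  (h : forall i, c i `<=` U) (s : forall i, A (c i)),
  (forall x, U x -> exists i, c i x) ->
  (forall i j (W : opens X) (hi : W `<=` c i) (hj : W `<=` c j),
    rres A hi (s i) = rres A hj (s j)) ->
  exists t : A U, forall i, rres A (h i) t = s i.

(** * Normalized parts: logarithmic derivatives, their values under pi and their span *)

Variables (D : dual L) (P0 : modSheaf A) (nt : bilinearMap (pushforward p1 Q) D P0).
Hypothesis ntP : is_tensor nt.
Variable cls : forall U : opens X, L U -> B (sq U) -> pushforward p1 Q U.
Hypothesis clsP : forall U (u : L U) g, is_class u g (cls u g).

Local Notation r1 U a := (rres B (@sq1 U) (s1 U a)).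
Local Notation r2 U a := (rres B (@sq2 U) (s2 U a)).

Definition dlg U (u : L U) : P0 U := nt U (cls u 1) (dual_inv D u).
Definition ndf U (f : A U) (u : L U) : P0 U :=
  nt U (cls u (r2 U f - r1 U f)) (dual_inv D u).

Lemma cls_lin U (u : L U) (g g' : B (sq U)) a :
  cls u (r1 U a * g + g') = a *: cls u g + cls u g'.
Proof. by apply: is_class_uniq (clsP _ _) _; apply: is_class_lin. Qed.

Lemma cls0 U (u : L U) : cls u 0 = 0.
Proof.
apply: is_class_uniq (clsP _ _) _.
by rewrite /is_class mres0 linear0 bmap0r.
Qed.

Lemma clsZ U (u : L U) (g : B (sq U)) a : cls u (r1 U a * g) = a *: cls u g.
Proof. by rewrite -[_ * g]addr0 cls_lin cls0 addr0. Qed.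

Lemma clsB U (u : L U) (g g' : B (sq U)) : cls u (g - g') = cls u g - cls u g'.
Proof.
have := cls_lin u g' g (-1); rewrite !rmorphN1 mulN1r addrC => ->.
by rewrite scaleN1r addrC.
Qed.

Lemma cls_scale U (u : L U) (g : B (sq U)) a : cls (a *: u) g = cls u (r2 U a * g).
Proof.
apply: is_class_uniq (clsP _ _) _; apply/is_class_scale; exact: clsP.
Qed.

Lemma cls_res (U V : opens X) (h : V `<=` U) (hs : sq V `<=` sq U) (u : L U) g :
  mres (pushforward p1 Q) h (cls u g) = cls (mres L h u) (rres B hs g).
Proof.
apply: is_class_uniq (clsP _ _); have h1 : i1 V `<=` i1 U by move=> y /h.
by rewrite (mres_pushforward h h1); apply: is_class_res.
Qed.

Lemma dlg_res (U V : opens X) (h : V `<=` U) (u : L U) : local_generator u ->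
  mres P0 h (dlg u) = dlg (mres L h u).
Proof.
move=> ugen; have hs : sq V `<=` sq U by move=> y [/h ? /h].
by rewrite /dlg bmap_res (cls_res h hs) dual_inv_res// rmorph1.
Qed.

(** The Leibniz rule, divided by [u]: the part p2^*f of the function defining [df] can be absorbed
    into the section, which turns it into the derivative of [f *: u], while p1^*f is the scalar
    [f]. *)
Lemma ndfE U (f : A U) (u : L U) :
  ndf f u = nt U (cls (f *: u) 1) (dual_inv D u) - f *: dlg u.
Proof.
rewrite /ndf clsB bmapDl bmapNl cls_scale mulr1; congr (_ - _).
by rewrite -[r1 U f]mulr1 clsZ bmapZl.
Qed.

Lemma ndf_unit U (f f' : A U) (u : L U) : f * f' = 1 -> local_generator u ->
  ndf f u = f *: dlg (f *: u) - f *: dlg u.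
Proof.
by move=> ff' ugen; rewrite ndfE (dual_inv_unit D ff' ugen) bmapZr.
Qed.

Lemma pi_exists : exists pi : forall U, {linear P0 U -> (A U)^o},
  [/\ forall (U V : opens X) (h : V `<=` U) s, rres A h (pi U s : A U) = pi V (mres P0 h s),
      forall U (u : L U), local_generator u -> pi U (dlg u) = 1
    & forall U (f : A U) (u : L U), local_generator u -> pi U (ndf f u) = 0].
Proof.
have [ev evE] := ev_exists; pose R := ring_module sepA glueA.
pose f U (s : pushforward p1 Q U) (w : D U) : R U := dual_pair (ev U s) w.
have fl (U : opens X) a (s s' : pushforward p1 Q U) (w : D U) :
    f U (a *: s + s') w = a *: f U s w + f U s' w.
  by rewrite /f linearP; exact: dual_linl.
have fr (U : opens X) a (s : pushforward p1 Q U) (w w' : D U) :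
    f U s (a *: w + w') = a *: f U s w + f U s w' by exact: dual_linr.
have fres (U V : opens X) (h : V `<=` U) (s : pushforward p1 Q U) (w : D U) :
    mres R h (f U s w) = f V (mres (pushforward p1 Q) h s) (mres D h w).
  by rewrite /f -mhom_res; exact: dual_res.
have [phi [phiE _]] := ntP (BilinearMap fl fr fres).
have phil U : linear (phi U : P0 U -> (A U)^o) by exact: linearP.
have evcls U (u : L U) g : ev U (cls u g) = rres A (@disq U) (sd (sq U) g) *: u.
  exact: evE.
exists (fun U => lin_fun (phil U)); split=> [U V h s|U u ugen|U a u ugen].
- by rewrite /= /lin_fun -(mhom_res phi).
- rewrite /= /lin_fun phiE /= /f evcls !rmorph1 scale1r; exact: dual_inv_pair.
- rewrite /= /lin_fun phiE /= /f evcls.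
  (* The pullbacks of [a] under the two projections agree on the diagonal. *)
  rewrite (_ : rres _ _ _ = 0).
    by rewrite dual_pairZl mul0r.
  rewrite !rmorphB /=; apply/eqP; rewrite subr_eq0; apply/eqP.
  have k1 : di (sq U) `<=` di (i1 U) by move=> x [].
  have k2 : di (sq U) `<=` di (i2 U) by move=> x [].
  have e2 : sd (sq U) (r2 U a) = rres A k2 (sd (i2 U) (s2 U a)).
    rewrite -(rhom_res (rmap_sharp dm) (@sq2 U)) /=.
    by congr (rres A _ _); exact: Prop_irrelevance.
  have e1 : sd (sq U) (r1 U a) = rres A k1 (sd (i1 U) (s1 U a)).
    rewrite -(rhom_res (rmap_sharp dm) (@sq1 U)) /=.
    by congr (rres A _ _); exact: Prop_irrelevance.
  have k3 : U `<=` di (i2 U) by move=> x /disq[].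
  have k4 : U `<=` U by [].
  rewrite e1 e2 (rres_comp _ _ (@di1 U)) sd1 (rres_comp _ _ k3) -(sd2 (@di2 U)).
  by rewrite (rres_comp _ _ k4) rres_id.
Qed.

Variable n : nat.

(* The coordinates are shifted to be units, so that [u] and the [y k *: u] are
   [n.+1] generators of [L] when [u] is one. *)
Definition coords_at x : Prop :=
  exists (V1 : opens X) (y : 'I_n -> A V1),
    [/\ V1 x, forall k, exists y', y k * y' = 1
      & forall (V : opens X) (g : B (sq V)), V x ->
        exists (V' : opens X) (h : V' `<=` V) (h1 : V' `<=` V1)
          (hs : sq V' `<=` sq V) (a : A V') (b : 'I_n -> A V'),
        V' x /\ I (rres B hs g - (r1 V' a + \sum_k r1 V' (b k) *
          (r2 V' (rres A h1 (y k)) - r1 V' (rres A h1 (y k)))))].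

Definition dlg_gens (V0 V : opens X) (h : V `<=` V0) (e : 'I_n.+1 -> L V0) :
  P0 V -> Prop := fun g => exists i, g = dlg (mres L h (e i)).

(** The generators are [u] and the [y k *: u]. Modulo [I] each function is a combination, with
    coefficients from [p1], of 1 and the p2^*y_k; these functions give [dlg u] and, up to the unit
    [y k], [dlg (y k *: u)]. *)
Lemma dlog_span x : coords_at x -> (exists (U : opens X) (u : L U), U x /\ local_generator u) ->
  exists (V0 : opens X) (e : 'I_n.+1 -> L V0),
    [/\ V0 x, forall i, local_generator (e i)
      & forall U (p : P0 U), U x -> exists (V : opens X) (h : V `<=` U) (h0 : V `<=` V0),
        V x /\ span (dlg_gens h0 e) (mres P0 h p)].
Proof.
move=> [V1 [y [V1x yu had]]] [U0 [u0 [U0x u0gen]]].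
pose V0 := opensI V1 U0.
have k1 : V0 `<=` V1 by move=> z [].
have k0 : V0 `<=` U0 by move=> z [].
pose u := mres L k0 u0; have ugen : local_generator u by exact: generator_res.
have V0x : V0 x by [].
pose Z k := rres A k1 (y k).
have [y' y'P] := choice yu; pose Z' k := rres A k1 (y' k).
have YY k : Z k * Z' k = 1 by rewrite /Z /Z' -rmorphM y'P rmorph1.
pose e (i : 'I_n.+1) : L V0 := if unlift ord0 i is Some k then Z k *: u else u.
have egen i : local_generator (e i).
  by rewrite /e; case: unlift => // k; exact: generator_unit (YY k) ugen.
exists V0, e; split=> //.
have gens_res (V V' : opens X) (h : V' `<=` V) (h0 : V `<=` V0) (h0' : V' `<=` V0) g :
    dlg_gens h0 e g -> dlg_gens h0' e (mres P0 h g).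
  move=> [i ->]; exists i; rewrite dlg_res; last exact: generator_res.
  by rewrite (mres_comp _ _ h0').
pose S (U : opens X) (p : P0 U) := U x ->
  exists (V : opens X) (h : V `<=` U) (h0 : V `<=` V0),
    V x /\ span (dlg_gens h0 e) (mres P0 h p).
have S0 (U : opens X) : S U 0.
  move=> Ux; have h : opensI U V0 `<=` U by move=> z [].
  have h0 : opensI U V0 `<=` V0 by move=> z [].
  by exists (opensI U V0), h, h0; split=> //; rewrite mres0; exact: span0.
have Slin (U : opens X) a (s t : P0 U) : S U s -> S U t -> S U (a *: s + t).
  move=> Ss St Ux; have [V [h [h0 [Vx sS]]]] := Ss Ux.
  have [V' [h' [h0' [V'x tS]]]] := St Ux.
  have k : opensI V V' `<=` V by move=> z [].
  have k' : opensI V V' `<=` V' by move=> z [].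
  have kU : opensI V V' `<=` U by move=> z /k/h.
  have kV : opensI V V' `<=` V0 by move=> z /k/h0.
  exists (opensI V V'), kU, kV; split=> //; rewrite mresD mresZ; apply: spanP.
    by rewrite -(mres_comp h k kU); apply: span_res sS; exact: gens_res.
  by rewrite -(mres_comp h' k' kU); apply: span_res tS; exact: gens_res.
have Sres (U V : opens X) (h : V `<=` U) (s : P0 U) : S U s -> S V (mres P0 h s).
  move=> Ss Vx; have [V' [h' [h0 [V'x sS]]]] := Ss (h _ Vx).
  have k : opensI V V' `<=` V by move=> z [].
  have k' : opensI V V' `<=` V' by move=> z [].
  have kU : opensI V V' `<=` U by move=> z /k/h.
  have kV : opensI V V' `<=` V0 by move=> z /k'/h0.
  exists (opensI V V'), k, kV; split=> //; rewrite (mres_comp _ _ kU).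
  by rewrite -(mres_comp h' k' kU); apply: span_res sS; exact: gens_res.
have Sloc (U : opens X) (s : P0 U) : (forall x, U x -> exists (V : opens X) (h : V `<=` U),
    V x /\ S V (mres P0 h s)) -> S U s.
  move=> loc Ux; have [V [h [Vx Ss]]] := loc _ Ux.
  have [V' [h' [h0 [V'x sS]]]] := Ss Vx.
  have kU : V' `<=` U by move=> z /h'/h.
  by exists V', kU, h0; split=> //; rewrite -(mres_comp h h' kU).
apply: (@tensor_ind _ _ _ _ _ _ (Subsheaf S0 Slin Sres Sloc) ntP) => U s w Ux.
have [V [hV [h0 [h1 [g [Vx sg]]]]]] := class_local ugen V0x s Ux.
have [V' [h [h1' [hs [a [b [V'x gI]]]]]]] := had V g Vx.
have kU : V' `<=` U by move=> z /h/hV.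
have kV0 : V' `<=` V0 by move=> z /h/h0.
have h1V : i1 V' `<=` i1 V by move=> z /h.
have h1U : i1 V' `<=` i1 U by move=> z /kU.
exists V', kU, kV0; split=> //.
set u' := mres L kV0 u; have u'gen : local_generator u' by exact: generator_res.
(* The dual section is a multiple of the inverse of [u'], so only the first tensor factor is left to
   analyse. *)
have -> : mres P0 kU (nt U s w) = dual_pair u' (mres D kU w) *:
    nt V' (mres (pushforward p1 Q) kU s) (dual_inv D u').
  by rewrite bmap_res {1}(dual_invE u'gen (mres D kU w)) bmapZr.
set G' := (X in _ - X) in gI.
have -> : mres (pushforward p1 Q) kU s = cls u' G'.
  apply: is_class_uniq (clsP _ _); apply: is_class_ker gI _.
  rewrite (mres_pushforward kU h1U) -(mres_comp h1 h1V h1U).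
  by rewrite /u' -(mres_comp h0 h kV0); exact: is_class_res.
pose Sp (g : B (sq V')) := span (dlg_gens kV0 e) (nt V' (cls u' g) (dual_inv D u')).
have Splin c g1 g2 : Sp g1 -> Sp g2 -> Sp (r1 V' c * g1 + g2).
  by rewrite /Sp cls_lin bmap_linl; exact: spanP.
have Sp0 : Sp 0 by rewrite /Sp cls0 bmap0l; exact: span0.
have Sp1 : Sp 1.
  apply: span_gen; exists ord0; rewrite /e unlift_none.
  by [].
(* The class of [u'] with p2^*y_k is the derivative of [y k *: u'], and the inverse of [u'] is [y k]
   times the inverse of [y k *: u']; hence this element is [y k] times a logarithmic derivative. *)
have Spk k : Sp (r2 V' (rres A h1' (y k))).
  rewrite /Sp -[r2 _ _]mulr1 -cls_scale.
  set yk := rres A h1' (y k).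
  have ykE : yk = rres A kV0 (Z k) by rewrite /Z (rres_comp _ _ h1').
  have yy : yk * rres A kV0 (Z' k) = 1 by rewrite ykE -rmorphM YY rmorph1.
  rewrite (dual_inv_unit D yy u'gen) bmapZr -[_ *: _]addr0; apply: span_lin.
    exists (lift ord0 k); rewrite /e liftK mresZ -ykE //.
  exact: span0.
rewrite -[_ *: _]addr0; apply: spanP; last exact: span0.
rewrite -/(Sp G') /G' -[r1 V' a]mulr1; apply: (Splin a) => //.
elim/big_rec: _ => [//|k z _ Sz]; apply: (Splin (b k)) => //.
have -> : r2 V' (rres A h1' (y k)) - r1 V' (rres A h1' (y k)) =
    r1 V' (- rres A h1' (y k)) * 1 + r2 V' (rres A h1' (y k)).
  by rewrite mulr1 !rmorphN addrC.
exact: (Splin _ _ _ Sp1).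
Qed.
End AbstractParts.

(** * The differential and its homotopy *)

Section HomEquality.
Variables (X : topologicalType) (A : ringPresheaf X).

Lemma hom_eq_tensor (F G T H : modSheaf A) (b : bilinearMap F G T) (phi psi : modHom T H) :
  is_tensor b -> (forall U s t, phi U (b U s t) = psi U (b U s t)) ->
  forall U x, phi U x = psi U x.
Proof.
move=> tb pp U x.
have fl (V : opens X) a (s s' : F V) t : phi V (b V (a *: s + s') t) = a *: phi V (b V s t) + phi V (b V s' t).
  by rewrite bmap_linl linearP.
have fr (V : opens X) a (s : F V) t t' : phi V (b V s (a *: t + t')) = a *: phi V (b V s t) + phi V (b V s t').
  by rewrite bmap_linr linearP.
have fres (V W : opens X) (h : W `<=` V) (s : F V) t :
    mres H h (phi V (b V s t)) = phi W (b W (mres F h s) (mres G h t)).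
  by rewrite mhom_res bmap_res.
have [chi [_ chiU]] := tb H (BilinearMap fl fr fres).
by rewrite (chiU phi)// (chiU psi)// => V s t; rewrite -pp.
Qed.

Definition addHom (F G : modSheaf A) (f g : modHom F G) : modHom F G.
Proof.
refine (@mkHom _ _ F G (fun U s => f U s + g U s) _ _) => [U a s t|U V h s].
  by rewrite !linearP scalerDr addrACA.
by rewrite mresD !mhom_res.
Defined.

Definition zeroHom (F G : modSheaf A) : modHom F G.
Proof.
refine (@mkHom _ _ F G (fun U s => 0) _ _) => [U a s t|U V h s].
  by rewrite scaler0 addr0.
by rewrite mres0.
Defined.
End HomEquality.

Section RconsFun.
Variable T : Type.

Lemma rcons_fun_max i (s : 'I_i -> T) x : rcons_fun s x ord_max = x.
Proof. by rewrite /rcons_fun unlift_none. Qed.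

Lemma rcons_fun_lift i (s : 'I_i -> T) x k : rcons_fun s x (lift ord_max k) = s k.
Proof. by rewrite /rcons_fun liftK. Qed.

Lemma rcons_fun_eta i (s : 'I_i -> T) x y :
  rcons_fun s x = [eta rcons_fun s y with ord_max |-> x].
Proof.
apply/funext => k; case: (unliftP ord_max k) => [l ->|->] /=.
  by rewrite eq_sym (negPf (neq_lift _ _)) !rcons_fun_lift.
by rewrite eqxx rcons_fun_max.
Qed.

Lemma rcons_fun_eta2 i (s : 'I_i -> T) x y z :
  rcons_fun (rcons_fun s x) z = [eta rcons_fun (rcons_fun s y) z with lift ord_max ord_max |-> x].
Proof.
apply/funext => k; case: (unliftP ord_max k) => [l ->|->] /=; last first.
  by rewrite (negPf (neq_lift _ _)) !rcons_fun_max.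
rewrite (inj_eq lift_inj) !rcons_fun_lift.
by rewrite (rcons_fun_eta s x y).
Qed.
End RconsFun.

Section AbstractComplex.
Variables (X : topologicalType) (A : ringPresheaf X).
Variables (L P0 : modSheaf A) (n j : nat).
Variable dlg : forall U : opens X, L U -> P0 U.
Variable ndf : forall U : opens X, A U -> L U -> P0 U.
Variable pi : forall U : opens X, {linear P0 U -> (A U)^o}.
Hypothesis pi_res : forall (U V : opens X) (h : V `<=` U) s,
  rres A h (pi U s : A U) = pi V (mres P0 h s).
Hypothesis pi_dlg : forall (U : opens X) (u : L U), local_generator u -> pi U (dlg u) = 1.
Hypothesis pi_ndf : forall (U : opens X) (f : A U) (u : L U),
  local_generator u -> pi U (ndf f u) = 0.
Hypothesis dlg_res : forall (U V : opens X) (h : V `<=` U) (u : L U),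
  local_generator u -> mres P0 h (dlg u) = dlg (mres L h u).
Hypothesis ndf_unit : forall (U : opens X) (f f' : A U) (u : L U), f * f' = 1 ->
  local_generator u -> ndf f u = f *: dlg (f *: u) - f *: dlg u.
Hypothesis spanning : forall x : X, exists (V0 : opens X) (e : 'I_n.+1 -> L V0),
  [/\ V0 x, forall i, local_generator (e i)
    & forall (U : opens X) (p : P0 U), U x ->
      exists (V : opens X) (h : V `<=` U) (h0 : V `<=` V0),
      V x /\ span (fun g => exists i, g = dlg (mres L h0 (e i))) (mres P0 h p)].
(* [d (d x)] can be computed directly only when the coefficient of [x] is a unit. *)
Hypothesis two_units : forall (U : opens X) (f : A U) x, U x ->
  exists (V : opens X) (h : V `<=` U) (f1 f2 : A V),
  [/\ V x, rres A h f = f1 + f2, f1 = 0 \/ (exists g, f1 * g = 1)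
    & f2 = 0 \/ exists g, f2 * g = 1].

Variables (ext : nat -> modSheaf A) (wedge : forall i, multilinearMap i P0 (ext i)).
Hypothesis wedgeP : forall i, is_exterior_power (wedge i).
Variables (pow : modSheaf A) (power : multilinearMap j L pow).
Hypothesis powerP : is_tensor_power power.
Variables (term : nat -> modSheaf A) (tens : forall i, bilinearMap (ext i) pow (term i)).
Hypothesis tensP : forall i, is_tensor (tens i).
Variable d : forall i (U : opens X), term i U -> term i.+1 U.
Hypothesis d_add : forall i U (x y : term i U), d (x + y) = d x + d y.
Hypothesis d_res : forall i (U V : opens X) (h : V `<=` U) (x : term i U),
  mres (term i.+1) h (d x) = d (mres (term i) h x).
Hypothesis dE : forall i, (i <= n)%N -> forall (U : opens X) (f : A U)
    (u : 'I_i -> L U) (v : L U),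
  (forall k, local_generator (u k)) -> local_generator v ->
  d (f *: tens i U (wedge i U (fun k => dlg (u k))) (power U (fun=> v))) =
  tens i.+1 U (wedge i.+1 U (rcons_fun (fun k => dlg (u k))
     (ndf f v + (j%:R * f) *: dlg v))) (power U (fun=> v)).

Lemma span_at (m : nat) (U : opens X) (s : 'I_m -> P0 U) (x : X) : U x ->
  exists (V : opens X) (h : V `<=` U) (e : 'I_n.+1 -> L V),
  [/\ V x, forall i, local_generator (e i)
    & forall k, span (fun g => exists i, g = dlg (e i)) (mres P0 h (s k))].
Proof.
move=> Ux; have [V0 [e [V0x egen sp]]] := spanning x.
have sp' k := sp U (s k) Ux.
have [V Vk] := choice sp'.
have [W [Wx WV]] := nbhs_opens (nbhs_forall (fun k => opens_nbhs
  (let: ex_intro _ (ex_intro _ (conj Vx _)) := Vk k in Vx)) : nbhs x _).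
have [W' [W'x W'A]] := nbhs_opens (filterI (opens_nbhs Wx) (filterI (opens_nbhs V0x) (opens_nbhs Ux))).
have hU : W' `<=` U by move=> y /W'A[_ []].
have h0 : W' `<=` V0 by move=> y /W'A[_ []].
exists W', hU, (fun i => mres L h0 (e i)); split=> // [i|k].
  exact: generator_res.
have [h [hV0 [Vx sk]]] := Vk k.
have hk : W' `<=` V k by move=> y /W'A[/WV/(_ k)].
rewrite -(mres_comp h hk hU); apply: span_res sk => _ [i ->]; exists i.
by rewrite dlg_res ?(mres_comp _ _ h0)//; exact: generator_res.
Qed.

(** Induction for additive statements. [Pr] need not be stable under multiplication by functions, so
    the three universal properties are applied to predicates that quantify over all coefficients
    [f], which are submodules. *)
Lemma term_ind i (Pr : forall U : opens X, term i U -> Prop) :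
  (forall U, Pr U 0) -> (forall U x y, Pr U x -> Pr U y -> Pr U (x + y)) ->
  (forall (U V : opens X) (h : V `<=` U) x, Pr U x -> Pr V (mres (term i) h x)) ->
  (forall (U : opens X) x, (forall p, U p -> exists (V : opens X) (h : V `<=` U),
     V p /\ Pr V (mres (term i) h x)) -> Pr U x) ->
  (forall (U : opens X) (f : A U) (u : 'I_i -> L U) (v : L U),
     (forall k, local_generator (u k)) -> local_generator v ->
     Pr U (f *: tens i U (wedge i U (fun k => dlg (u k))) (power U (fun=> v)))) ->
  forall U x, Pr U x.
Proof.
move=> P0' PD Pres Ploc Pgen.
(* The largest condition inside [Pr] that is stable under scalars and restriction. [S2] and [S3]
   likewise fix one factor of the tensor product and quantify over the other. *)
pose S1 (U : opens X) (x : term i U) := forall (V : opens X) (h : V `<=` U) (f : A V),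
  Pr V (f *: mres (term i) h x).
have S10 (U : opens X) : S1 U 0 by move=> V h f; rewrite mres0 scaler0.
have S1lin (U : opens X) a (x y : term i U) : S1 U x -> S1 U y -> S1 U (a *: x + y).
  move=> Sx Sy V h f; rewrite mresD mresZ scalerDr scalerA; apply: PD; first exact: Sx.
  exact: Sy.
have S1res (U V : opens X) (h : V `<=` U) (x : term i U) : S1 U x -> S1 V (mres _ h x).
  move=> Sx W k f; have kh : W `<=` U by move=> y /k/h.
  by rewrite (mres_comp _ _ kh); exact: Sx.
have S1loc (U : opens X) (x : term i U) : (forall p, U p -> exists (V : opens X) (h : V `<=` U),
    V p /\ S1 V (mres (term i) h x)) -> S1 U x.
  move=> loc V h f; apply: Ploc => p Vp; have [W [k [Wp Sx]]] := loc p (h p Vp).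
  have k1 : opensI V W `<=` V by move=> y [].
  have k2 : opensI V W `<=` W by move=> y [].
  have k3 : opensI V W `<=` U by move=> y [_ /k].
  exists (opensI V W), k1; split=> //.
  by rewrite mresZ (mres_comp _ _ k3) -(mres_comp k k2 k3); exact: Sx.
suff Sgen (V : opens X) (s : 'I_i -> P0 V) (v : 'I_j -> L V) :
    S1 V (tens i V (wedge i V s) (power V v)).
  move=> U x; have idU : U `<=` U by [].
  suff /(_ U idU 1) : S1 U x by rewrite scale1r mres_id.
  apply: (@tensor_ind _ _ _ _ _ _ (@Subsheaf _ _ _ S1 S10 S1lin S1res S1loc) (@tensP i) _ U x) => {x idU}U e p.
  pose S2 (U : opens X) (e : ext i U) := forall (V : opens X) (h : V `<=` U) (p : pow V),
    S1 V (tens i V (mres (ext i) h e) p).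
  have S20 (V : opens X) : S2 V 0 by move=> W h q; rewrite mres0 bmap0l; exact: S10.
  have S2lin (V : opens X) a (x y : ext i V) : S2 V x -> S2 V y -> S2 V (a *: x + y).
    move=> Sx Sy W h q; rewrite mresD mresZ bmap_linl; apply: S1lin; first exact: Sx.
    exact: Sy.
  have S2res (V W : opens X) (h : W `<=` V) (x : ext i V) : S2 V x -> S2 W (mres _ h x).
    move=> Sx W' k q; have kh : W' `<=` V by move=> y /k/h.
    by rewrite (mres_comp _ _ kh); exact: Sx.
  have S2loc (V : opens X) (x : ext i V) : (forall p, V p -> exists (W : opens X) (h : W `<=` V),
      W p /\ S2 W (mres (ext i) h x)) -> S2 V x.
    move=> loc W h q; apply: S1loc => z Wz; have [W' [k [W'z Sx]]] := loc z (h z Wz).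
    have k1 : opensI W W' `<=` W by move=> y [].
    have k2 : opensI W W' `<=` W' by move=> y [].
    have k3 : opensI W W' `<=` V by move=> y [_ /k].
    exists (opensI W W'), k1; split=> //.
    by rewrite bmap_res (mres_comp _ _ k3) -(mres_comp k k2 k3); exact: Sx.
  have idU : U `<=` U by [].
  suff /(_ U idU p) : S2 U e by rewrite mres_id.
  apply: (@exterior_power_ind _ _ _ _ _ _ (@Subsheaf _ _ _ S2 S20 S2lin S2res S2loc) (@wedgeP i) _ U e) => {e p idU}U s.
  move=> V h p; rewrite mmap_res; move: (fun k => mres P0 h (s k)) => {h}s {U}.
  pose S3 (U : opens X) (p : pow U) := forall (V : opens X) (h : V `<=` U) (s : 'I_i -> P0 V),
    S1 V (tens i V (wedge i V s) (mres pow h p)).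
  have S30 (U : opens X) : S3 U 0 by move=> W h q; rewrite mres0 bmap0r; exact: S10.
  have S3lin (U : opens X) a (x y : pow U) : S3 U x -> S3 U y -> S3 U (a *: x + y).
    move=> Sx Sy W h q; rewrite mresD mresZ bmap_linr; apply: S1lin; first exact: Sx.
    exact: Sy.
  have S3res (U W : opens X) (h : W `<=` U) (x : pow U) : S3 U x -> S3 W (mres _ h x).
    move=> Sx W' k q; have kh : W' `<=` U by move=> y /k/h.
    by rewrite (mres_comp _ _ kh); exact: Sx.
  have S3loc (U : opens X) (x : pow U) : (forall p, U p -> exists (W : opens X) (h : W `<=` U),
      W p /\ S3 W (mres pow h x)) -> S3 U x.
    move=> loc W h q; apply: S1loc => z Wz; have [W' [k [W'z Sx]]] := loc z (h z Wz).
    have k1 : opensI W W' `<=` W by move=> y [].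
    have k2 : opensI W W' `<=` W' by move=> y [].
    have k3 : opensI W W' `<=` U by move=> y [_ /k].
    exists (opensI W W'), k1; split=> //.
    by rewrite bmap_res mmap_res (mres_comp _ _ k3) -(mres_comp k k2 k3); exact: Sx.
  have idV : V `<=` V by [].
  suff /(_ V idV s) : S3 V p by rewrite mres_id.
  apply: (@tensor_power_ind _ _ _ _ _ _ (@Subsheaf _ _ _ S3 S30 S3lin S3res S3loc) powerP _ V p) => U v W h t.
  by rewrite mmap_res.
apply: S1loc => p Vp; have [W [h [e [Wp egen esp]]]] := span_at s Vp.
exists W, h; split=> //; rewrite bmap_res !mmap_res.
apply: (@mmap_span _ _ _ _ _ (wedge i) W _ (fun y => S1 W (tens i W y _))) esp.
- by rewrite bmap0l.
- by move=> a x y Sx Sy; rewrite bmap_linl; exact: S1lin.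
move=> t tg; have [c cE] := choice tg.
have {tg} -> : t = (fun k => dlg (e (c k))) by apply/funext.
(* All factors of the tensor power are multiples of one generator, which is why a single [v] occurs
   in the generators of the complex. *)
have vsp k : span (fun g => g = e ord0) (mres L h (v k)).
  have idW : W `<=` W by [].
  have [f fK fK'] := egen ord0 W idW; rewrite -(fK' (mres L h (v k))) mres_id.
  by rewrite -[_ *: _]addr0; apply: span_lin => //; exact: span0.
apply: (@mmap_span _ _ _ _ _ power W _ (fun y => S1 W (tens i W _ y))) vsp.
- by rewrite bmap0r.
- by move=> a x y Sx Sy; rewrite bmap_linr; exact: S1lin.
move=> r rE; have {rE r}-> : r = (fun=> e ord0) by apply/funext.
move=> U k f; rewrite bmap_res !mmap_res.
have -> : (fun l => mres P0 k (dlg (e (c l)))) = (fun l => dlg (mres L k (e (c l)))).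
  by apply/funext => l; rewrite dlg_res.
by apply: Pgen => [l|]; exact: generator_res.
Qed.

(** Pigeonhole: locally the arguments are combinations of [n.+1] logarithmic derivatives, and among
    [n.+2] of these two coincide. *)
Lemma wedge_top U (s : 'I_n.+2 -> P0 U) : wedge n.+2 U s = 0.
Proof.
apply: msec_separated => x Ux; have [V [h [e [Vx egen esp]]]] := span_at s Ux.
exists V, h; split=> //; rewrite mmap_res mres0.
apply: (@mmap_span _ _ _ _ _ (wedge n.+2) V _ (fun y => y = 0)) esp => //.
  by move=> a x' y -> ->; rewrite scaler0 addr0.
move=> t tg; have [c cE] := choice tg.
have [k [l kl ckl]] : exists k : 'I_n.+2, exists2 l, k != l & c k = c l.
  have /injectiveP : ~~ injectiveb c.
    by apply/negP => /injectiveP/leq_card; rewrite !card_ord ltnn.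
  move=> Nc; apply: contrapT => H; apply: Nc => k l ckl.
  by apply: contrapT => /eqP kl; apply: H; exists k, l.
by apply: (@wedgeP n.+2).1 kl _; rewrite !cE ckl.
Qed.

Lemma d_zero i U : d (0 : term i U) = 0.
Proof. by apply: (addrI (d 0)); rewrite -d_add !addr0. Qed.

Lemma d_opp i U (x : term i U) : d (- x) = - d x.
Proof. by apply: (addrI (d x)); rewrite -d_add !subrr d_zero. Qed.

Lemma d_sign i U m (x : term i U) : d ((-1) ^+ m *: x) = (-1) ^+ m *: d x.
Proof.
rewrite -signr_odd -[in RHS]signr_odd; case: (odd m); last by rewrite !scale1r.
by rewrite expr1 !scaleN1r d_opp.
Qed.

Lemma d_sum i U (T : Type) (r : seq T) (F : T -> term i U) :
  d (\sum_(k <- r) F k) = \sum_(k <- r) d (F k).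
Proof. by apply: (big_morph (@d i U)); [exact: d_add|exact: d_zero]. Qed.

Lemma d_natr i U m (x : term i U) : d (m%:R *: x) = m%:R *: d x.
Proof.
rewrite !scaler_nat; elim: m => [|m IH]; first by rewrite !mulr0n d_zero.
by rewrite !mulrS d_add IH.
Qed.

Definition dgen U (f : A U) (v : L U) : P0 U := ndf f v + (j%:R * f) *: dlg v.

Lemma contraction_terms : exists h : forall i, modHom (term i.+1) (term i),
  forall i U s (p : pow U),
    h i U (tens i.+1 U (wedge i.+1 U s) p) = tens i U (contract_fun wedge pi s) p.
Proof.
have [iota iotaE] := contraction_exists wedgeP pi_res.
have H i : exists h : modHom (term i.+1) (term i), forall U e (p : pow U),
    h U (tens i.+1 U e p) = tens i U (iota i U e) p.
  have fl (U : opens X) a (e e' : ext i.+1 U) (p : pow U) :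
    tens i U (iota i U (a *: e + e')) p = a *: tens i U (iota i U e) p + tens i U (iota i U e') p.
    by rewrite linearP bmap_linl.
  have fr (U : opens X) a (e : ext i.+1 U) (p p' : pow U) :
    tens i U (iota i U e) (a *: p + p') = a *: tens i U (iota i U e) p + tens i U (iota i U e) p'.
    by rewrite bmap_linr.
  have fres (U V : opens X) (k : V `<=` U) (e : ext i.+1 U) (p : pow U) :
    mres (term i) k (tens i U (iota i U e) p) = tens i V (iota i V (mres _ k e)) (mres _ k p).
    by rewrite bmap_res mhom_res.
  have [phi [phiE _]] := @tensP i.+1 _ (BilinearMap fl fr fres).
  by exists phi => U e p; rewrite phiE.
exists (fun i => projT1 (cid (H i))) => i U s p.
by rewrite (projT2 (cid (H i))) iotaE.
Qed.

(** * The homotopy formula, on generators and in general *)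

Section Homotopy.
Variable h : forall i, modHom (term i.+1) (term i).
Hypothesis hE : forall i U s (p : pow U),
  h i U (tens i.+1 U (wedge i.+1 U s) p) = tens i U (contract_fun wedge pi s) p.

Section Generator.
Variables (U : opens X) (f : A U) (v : L U).
Hypothesis vgen : local_generator v.
Let vj := power U (fun=> v).

Lemma pi_dgen : pi U (dgen f v) = j%:R * f :> A U.
Proof.
by rewrite linearD linearZ_LR /= pi_ndf// pi_dlg// add0r -[_ *: _]/(_ * _) mulr1.
Qed.

Lemma h_d0 (u : 'I_0 -> L U) : let x := f *: tens 0 U (wedge 0 U (fun k => dlg (u k))) vj in
  h 0 U (d x) = j%:R *: x.
Proof.
rewrite /= dE//; last by case.
by rewrite hE contract_rcons big_ord0 add0r pi_dgen bmapZl scalerA.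
Qed.

Variables (i : nat) (u : 'I_i.+1 -> L U).
Hypothesis (ugen : forall k, local_generator (u k)) (i_n : (i <= n)%N).
Let w k := dlg (u k).
Let x := f *: tens i.+1 U (wedge i.+1 U w) vj.
Let y : term i.+1 U := \sum_(k < i.+1) (-1) ^+ (i + k) *:
  tens i.+1 U (wedge i.+1 U (rcons_fun (fun l => w (lift k l)) (dgen f v))) vj.

(** Since [pi] is 1 on each [w k], contracting [x] yields generators with coefficient [f] up to
    sign, to which the formula for [d] applies although [d] is not linear over functions. *)
Lemma d_h_gen : d (h i U x) = y.
Proof.
rewrite /x linearZ_LR /= hE /contract_fun bmap_suml scaler_sumr d_sum.
apply: eq_bigr => k _; rewrite pi_dlg// mulr1 bmapZl scalerA mulrC -scalerA d_sign.
by rewrite dE.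
Qed.

(** Contracting the appended factor gives [j%:R *: x]. The other slots reproduce [y] with the
    opposite sign, because the exterior degree has gone up by one. *)
Lemma contract_gen : tens i.+1 U (contract_fun wedge pi (rcons_fun w (dgen f v))) vj =
  j%:R *: x - y.
Proof.
rewrite contract_rcons bmapDl addrC pi_dgen bmapZl; congr (_ + _).
  by rewrite /x scalerA.
rewrite bmap_suml /y -sumrN; apply: eq_bigr => k _.
rewrite pi_dlg// mulr1 bmapZl rcons_lift addSn exprS -scalerA scaleN1r.
by [].
Qed.

Lemma dh_hd_gen : (i < n)%N -> d (h i U x) + h i.+1 U (d x) = j%:R *: x.
Proof.
by move=> i1n; rewrite d_h_gen /x dE// hE contract_gen addrC subrK.
Qed.

(** The difference [j%:R *: x - y] is the contraction of a wedge of [n.+2] factors, which vanishes,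
    so no value of [d] beyond the top degree enters. *)
Lemma dh_top_gen : i = n -> d (h i U x) = j%:R *: x.
Proof.
move=> in_; rewrite d_h_gen; apply/eqP; rewrite eq_sym -subr_eq0 -contract_gen; apply/eqP.
have [iota iotaE] := contraction_exists wedgeP pi_res.
rewrite -iotaE.
have -> : wedge i.+2 U (rcons_fun w (dgen f v)) = 0.
  by move: (rcons_fun _ _); rewrite in_ => s; exact: wedge_top.
by rewrite linear0 bmap0l.
Qed.
End Generator.

Lemma h_res i (U V : opens X) (k : V `<=` U) (x : term i.+1 U) :
  mres (term i) k (h i U x) = h i V (mres (term i.+1) k x).
Proof. exact: mhom_res. Qed.

Lemma term_ext i (F : modSheaf A) (phi psi : forall U, term i U -> F U) :
  (forall U x y, phi U (x + y) = phi U x + phi U y) ->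
  (forall U x y, psi U (x + y) = psi U x + psi U y) ->
  (forall (U V : opens X) (k : V `<=` U) x, mres F k (phi U x) = phi V (mres (term i) k x)) ->
  (forall (U V : opens X) (k : V `<=` U) x, mres F k (psi U x) = psi V (mres (term i) k x)) ->
  (forall (U : opens X) (f : A U) (u : 'I_i -> L U) (v : L U),
     (forall k, local_generator (u k)) -> local_generator v ->
     let x := f *: tens i U (wedge i U (fun k => dlg (u k))) (power U (fun=> v)) in
     phi U x = psi U x) ->
  forall U x, phi U x = psi U x.
Proof.
move=> phiD psiD phiR psiR pp; apply: term_ind => //.
- move=> U; have e0 (chi : forall U, term i U -> F U) :
    (forall U x y, chi U (x + y) = chi U x + chi U y) -> chi U 0 = 0.
    by move=> chiD; apply: (addrI (chi U 0)); rewrite -chiD !addr0.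
  by rewrite !e0.
- by move=> U x y ex ey; rewrite phiD psiD ex ey.
- by move=> U V k x ex; rewrite -phiR -psiR ex.
- move=> U x loc; apply: msec_separated => p Up; have [V [k [Vp e]]] := loc p Up.
  by exists V, k; split=> //; rewrite phiR psiR.
Qed.

Lemma homotopy_bottom U (x : term 0 U) : h 0 U (d x) = j%:R *: x.
Proof.
move: U x; apply: term_ext => [U x y|U x y|U V k x|U V k x|U f u v ugen vgen].
- by rewrite d_add linearD.
- by rewrite scalerDr.
- by rewrite h_res d_res.
- by rewrite mresZ rmorph_nat.
- exact: h_d0.
Qed.

Lemma homotopy_middle i U (x : term i.+1 U) : (i < n)%N ->
  d (h i U x) + h i.+1 U (d x) = j%:R *: x.
Proof.
move=> i_n; move: U x; apply: term_ext => [U x y|U x y|U V k x|U V k x|U f u v ugen vgen].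
- by rewrite d_add !linearD /= d_add addrACA.
- by rewrite scalerDr.
- by rewrite mresD d_res !h_res d_res.
- by rewrite mresZ rmorph_nat.
- by apply: dh_hd_gen => //; exact: ltnW.
Qed.

Lemma homotopy_top U (x : term n.+1 U) : d (h n U x) = j%:R *: x.
Proof.
move: U x; apply: term_ext => [U x y|U x y|U V k x|U V k x|U f u v ugen vgen].
- by rewrite linearD /= d_add.
- by rewrite scalerDr.
- by rewrite d_res h_res.
- by rewrite mresZ rmorph_nat.
- exact: dh_top_gen.
Qed.
End Homotopy.

(** With [a = dlg (f *: v)] and [b = dlg v] the appended factor is [z = f a + (j - 1) f b]. Hence
    [d x] is a sum of two integer multiples of generators that have the same coefficient [f];
    applying [d] again appends [z] once more and leaves [(j - 1) f (T a b + T b a) = 0]. *)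
Lemma d_d_unit i U (f f' : A U) (u : 'I_i -> L U) (v : L U) : (i < n)%N -> (0 < j)%N ->
  f * f' = 1 -> (forall k, local_generator (u k)) -> local_generator v ->
  d (d (f *: tens i U (wedge i U (fun k => dlg (u k))) (power U (fun=> v)))) = 0.
Proof.
move=> i_n j0 ff' ugen vgen; set vj := power U _.
have fvgen : local_generator (f *: v) := generator_unit ff' vgen.
pose w k := dlg (u k); pose T a b := tens i.+2 U (wedge i.+2 U (rcons_fun (rcons_fun w a) b)) vj.
have TDr a b b' c : T a (c *: b + b') = c *: T a b + T a b'.
  rewrite /T (rcons_fun_eta _ (c *: b + b') 0) (rcons_fun_eta _ b 0) (rcons_fun_eta _ b' 0).
  by rewrite mmap_lin bmap_linl.
have TDl a a' b c : T (c *: a + a') b = c *: T a b + T a' b.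
  rewrite /T (rcons_fun_eta2 _ (c *: a + a') 0) (rcons_fun_eta2 _ a 0) (rcons_fun_eta2 _ a' 0).
  by rewrite mmap_lin bmap_linl.
have Tx a : T a a = 0.
  rewrite /T (_ : wedge _ _ _ = 0) ?bmap0l//.
  apply: ((@wedgeP i.+2).1 U _ ord_max (lift ord_max ord_max)).
    exact: neq_lift.
  by rewrite rcons_fun_lift !rcons_fun_max.
have Tanti a b : T a b + T b a = 0.
  have := Tx (1 *: a + b); rewrite TDl !scale1r.
  have -> : a + b = 1 *: a + b by rewrite scale1r.
  by rewrite !TDr !scale1r !Tx add0r addr0.
pose a := dlg (f *: v); pose b := dlg v.
have zE : dgen f v = f *: a + (j.-1%:R * f) *: b.
  rewrite /dgen (ndf_unit ff')// -addrA; congr (_ + _).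
  by rewrite -{1}(prednK j0) -natr1 mulrDl mul1r scalerDl addrC addrK.
have dT c : local_generator c -> d (f *: tens i.+1 U (wedge i.+1 U (rcons_fun w (dlg c))) vj)
    = T (dlg c) (dgen f v).
  move=> cgen; pose uc := rcons_fun u c.
  have ucE : rcons_fun w (dlg c) = (fun k => dlg (uc k)).
    apply/funext => k; rewrite /uc; case: (unliftP ord_max k) => [l ->|->].
      by rewrite !rcons_fun_lift.
    by rewrite !rcons_fun_max.
  rewrite /T ucE dE// => k; rewrite /uc; case: (unliftP ord_max k) => [l ->|->].
    by rewrite rcons_fun_lift.
  by rewrite rcons_fun_max.
rewrite dE ?(ltnW i_n)// -/(dgen f v) {1}zE.
have -> : tens i.+1 U (wedge i.+1 U (rcons_fun w (f *: a + (j.-1%:R * f) *: b))) vj =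
   f *: tens i.+1 U (wedge i.+1 U (rcons_fun w a)) vj +
   j.-1%:R *: (f *: tens i.+1 U (wedge i.+1 U (rcons_fun w b)) vj).
  rewrite scalerA (rcons_fun_eta _ (_ + _) 0) mmap_lin mmapZ bmapDl !bmapZl.
  by rewrite -!rcons_fun_eta.
have TD z : T z (f *: a + (j.-1%:R * f) *: b) = f *: T z a + (j.-1%:R * f) *: T z b.
  have T0 : T z 0 = 0 by rewrite /T (rcons_fun_eta _ 0 0) mmap0 bmap0l.
  by rewrite TDr -[_ *: b]addr0 TDr T0 addr0.
rewrite d_add d_natr !dT// zE -/a -/b !TD !Tx !scaler0 addr0 add0r.
by rewrite scalerA -scalerDr Tanti scaler0.
Qed.

Lemma d_d_eq0 i U (x : term i U) : (i < n)%N -> (0 < j)%N -> d (d x) = 0.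
Proof.
move=> i_n j0; move: U x; apply: term_ind.
- by move=> U; rewrite !d_zero.
- by move=> U x y ex ey; rewrite !d_add ex ey addr0.
- by move=> U V k x ex; rewrite -!d_res ex mres0.
- move=> U x loc; apply: msec_separated => p Up; have [V [k [Vp e]]] := loc p Up.
  by exists V, k; split=> //; rewrite !d_res e mres0.
move=> U f u v ugen vgen; apply: msec_separated => p Up.
have [V [k [f1 [f2 [Vp fE f1u f2u]]]]] := two_units f Up.
exists V, k; split=> //; rewrite !d_res mres0 mresZ bmap_res !mmap_res.
have -> : (fun l => mres P0 k (dlg (u l))) = (fun l => dlg (mres L k (u l))).
  by apply/funext => l; rewrite dlg_res.
have unitP g : g = 0 \/ (exists g', g * g' = 1) -> d (d (g *: tens i V
    (wedge i V (fun l => dlg (mres L k (u l)))) (power V (fun=> mres L k v)))) = 0.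
  move=> [->|[g' gg']]; first by rewrite scale0r !d_zero.
  by apply: (d_d_unit i_n j0 gg') => [l|]; exact: generator_res.
by rewrite fE scalerDl !d_add !unitP// addr0.
Qed.
End AbstractComplex.

(** * Tensoring the homotopy with S *)

Section Twisted.
Variables (X : topologicalType) (A : ringPresheaf X) (K : comPzRingType).
Variable kA : ringHom (const_ring X K) A.
Variables (n j : nat) (kj : K) (kjP : kj * j%:R = 1).
Variable term : nat -> modSheaf A.
Local Notation vs F := (restrict_scalars kA F).
Variable d : forall i, modHom (vs (term i)) (vs (term i.+1)).
Variable h : forall i, modHom (term i.+1) (term i).
Hypothesis hd0 : forall U (x : term 0 U), h 0 U (d 0 U x) = j%:R *: x.
Hypothesis dh_hd : forall i U (x : term i.+1 U), (i < n)%N ->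
  (d i U (h i U x) : term i.+1 U) + h i.+1 U (d i.+1 U x) = j%:R *: x.
Hypothesis dh_top : forall U (x : term n.+1 U), d n U (h n U x) = j%:R *: x :> term n.+1 U.
Hypothesis dd0 : forall i U (x : term i U), (i < n)%N -> d i.+1 U (d i U x) = 0.
Variables (S : modSheaf (const_ring X K)) (T : nat -> modSheaf (const_ring X K)).
Variable t : forall i, bilinearMap (vs (term i)) S (T i).
Hypothesis tP : forall i, is_tensor (t i).
Variable D : forall i, modHom (T i) (T i.+1).
Hypothesis DE : forall i U (a : vs (term i) U) (s : S U),
  D i U (t i U a s) = t i.+1 U (d i U a) s.

Lemma twisted_homotopy : exists H : forall i, modHom (T i.+1) (T i),
  forall i U (a : vs (term i.+1) U) s, H i U (t i.+1 U a s) = kj *: t i U (h i U a) s.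
Proof.
have HH i : exists H : modHom (T i.+1) (T i), forall U (a : vs (term i.+1) U) s,
    H U (t i.+1 U a s) = kj *: t i U (h i U a) s.
  have hl U (c : K) (a a' : vs (term i.+1) U) :
      h i U (c *: a + a') = c *: (h i U a : vs (term i) U) + (h i U a' : vs (term i) U).
    exact: (linearP (h i U) (kA U c) a a').
  have fl (U : opens X) (c : const_ring X K U) (a a' : vs (term i.+1) U) (s : S U) :
    kj *: t i U (h i U (c *: a + a')) s = c *: (kj *: t i U (h i U a) s) + kj *: t i U (h i U a') s.
    rewrite hl bmap_linl scalerDr !scalerA; congr (_ *: _ + _).
    exact: mulrC.
  have fr (U : opens X) (c : const_ring X K U) (a : vs (term i.+1) U) (s s' : S U) :
    kj *: t i U (h i U a) (c *: s + s') = c *: (kj *: t i U (h i U a) s) + kj *: t i U (h i U a) s'.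
    rewrite bmap_linr scalerDr !scalerA; congr (_ *: _ + _).
    exact: mulrC.
  have fres (U V : opens X) (k : V `<=` U) (a : vs (term i.+1) U) (s : S U) :
    mres (T i) k (kj *: t i U (h i U a) s) = kj *: t i V (h i V (mres (vs (term i.+1)) k a)) (mres S k s).
    rewrite mresZ bmap_res; congr (_ *: t i V _ _).
    exact: (mhom_res (h i) k a).
  have [phi [phiE _]] := @tP i.+1 _ (BilinearMap fl fr fres).
  by exists phi => U a s; rewrite phiE.
by exists (fun i => projT1 (cid (HH i))) => i; exact: (projT2 (cid (HH i))).
Qed.

Lemma nat_scale i U (a : vs (term i) U) s :
  kj *: t i U (j%:R *: (a : term i U)) s = t i U a s.
Proof.
have -> : j%:R *: (a : term i U) = (j%:R : K) *: a :> vs (term i) U.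
  by rewrite -[RHS]/(kA U j%:R *: (a : term i U)) rmorph_nat.
by rewrite bmapZl scalerA [_ * _]kjP scale1r.
Qed.

(** All identities are equalities of morphisms out of a tensor product, so they are checked on
    [a (x) s]. A cocycle [s] is the boundary of [H i U s] over all of [U], so no smaller open set
    has to be chosen for local exactness. *)
Lemma twisted_exact : null_homotopic n D /\ exact_complex n D.
Proof.
have [H HE] := twisted_homotopy.
have e0 U s : H 0 U (D 0 U s) = s.
  rewrite -[LHS]/(compHom (H 0) (D 0) U s) -[RHS]/(idHom (T 0) U s).
  apply: (hom_eq_tensor (@tP 0)) => V a r /=; rewrite /lin_fun DE HE hd0.
  exact: nat_scale.
have e1 i : (i < n)%N -> forall U s, D i U (H i U s) + H i.+1 U (D i.+1 U s) = s.
  move=> i_n U s.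
  rewrite -[LHS]/(addHom (compHom (D i) (H i)) (compHom (H i.+1) (D i.+1)) U s).
  rewrite -[RHS]/(idHom (T i.+1) U s).
  apply: (hom_eq_tensor (@tP i.+1)) => V a r /=; rewrite /lin_fun /= /lin_fun.
  rewrite HE !DE HE linearZ_LR /= DE -scalerDr -bmapDl.
  by have := dh_hd a i_n; rewrite -[X in _ -> kj *: t _ _ X _ = _]/(_ + _) => ->; exact: nat_scale.
have e2 U s : D n U (H n U s) = s.
  rewrite -[LHS]/(compHom (D n) (H n) U s) -[RHS]/(idHom (T n.+1) U s).
  apply: (hom_eq_tensor (@tP n.+1)) => V a r /=; rewrite /lin_fun HE linearZ_LR /= DE dh_top.
  exact: nat_scale.
have DD i : (i < n)%N -> forall U s, D i.+1 U (D i U s) = 0.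
  move=> i_n U s.
  rewrite -[LHS]/(compHom (D i.+1) (D i) U s) -[RHS]/(zeroHom (T i) (T i.+2) U s).
  apply: (hom_eq_tensor (@tP i)) => V a r /=; rewrite /lin_fun !DE dd0//.
  exact: bmap0l.
split; first by exists H.
split=> [U s Ds|i i_n U s|U s].
- by rewrite -(e0 U s) Ds linear0.
- split=> [Ds x Ux|loc].
    have idU : U `<=` U by [].
    exists U, idU, (H i U s); split=> //.
    by rewrite mres_id -[RHS](e1 i i_n) Ds linear0 addr0.
  apply: msec_separated => x /loc[V [k [r [Vx rE]]]]; exists V, k; split=> //.
  by rewrite mhom_res -rE DD// mres0.
- move=> x Ux; have idU : U `<=` U by [].
  by exists U, idU, (H n U s); split=> //; rewrite mres_id e2.
Qed.
End Twisted.

(** * Jets along the diagonal of a manifold *)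

Section StructureModule.
Variables (K : archiNumFieldType) (n : nat) (X : manifold K n).

Lemma hol_glue (U : opens X) (I : Type) (c : I -> opens X)
    (h : forall i, c i `<=` U) (s : forall i, OX X (c i)) :
  (forall x, U x -> exists i, c i x) ->
  (forall i j (W : opens X) (hi : W `<=` c i) (hj : W `<=` c j),
     rres (OX X) hi (s i) = rres (OX X) hj (s j)) ->
  exists t : OX X U, forall i, rres (OX X) (h i) t = s i.
Proof.
move=> cov comp.
have sij i j x (ci : c i x) (cj : c j x) :
    (s i : hol _ _) (exist _ x ci) = (s j : hol _ _) (exist _ x cj).
  have hi : opensI (c i) (c j) `<=` c i by move=> y [].
  have hj : opensI (c i) (c j) `<=` c j by move=> y [].
  have xij : opensI (c i) (c j) x by [].
  have /(congr1 (fun f : OX X _ => (f : hol _ _) (exist _ x xij))) := comp i j _ hi hj.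
  rewrite !hol_res => e.
  by rewrite (hol_eq _ ci (hi x xij)) e; apply: hol_eq.
pose t (y : {x : X | U x}) : K := let i := cid (cov (sval y) (proj2_sig y)) in
  (s (projT1 i) : hol _ _) (exist _ (sval y) (projT2 i)).
have tE i x (Ux : U x) (cx : c i x) : t (exist _ x Ux) = (s i : hol _ _) (exist _ x cx).
  exact: sij.
have ht : holomorphic (@atlas _ _ X) t.
  move=> d dE x Ux dx; have [i cx] := cov x Ux.
  have [g [ag sg]] := holP (s i) dE cx dx.
  exists g; split=> //; apply: filterS2 (opens_nbhs cx) sg => y cy yg Uy.
  by rewrite (tE i y Uy cy).
exists (mkhol ht) => i; apply: hol_ext => x cx.
by rewrite hol_res; exact: tE.
Qed.

Lemma hol_separated (U : opens X) (f g : OX X U) : (forall x, U x ->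
    exists (V : opens X) (h : V `<=` U), V x /\ rres (OX X) h f = rres (OX X) h g) -> f = g.
Proof.
move=> fg; apply: hol_ext => x Ux.
have [V [h [Vx /(congr1 (fun f : OX X _ => (f : hol _ _) (exist _ x Vx)))]]] := fg x Ux.
by rewrite !hol_res (hol_eq f (h x Vx) Ux) (hol_eq g (h x Vx) Ux).
Qed.
End StructureModule.

Section Diagonal.
Variables (K : archiNumFieldType) (HK : geo_complete K).
Variables (n : nat) (X : manifold K n).
Local Notation O := (OX X).
Local Notation OO := (OXX X).

Definition diag_sharp : ringHom OO (direct_image_ring (@diag_continuous _ _ X) O).
Proof.
refine (@RingHom _ OO (direct_image_ring (@diag_continuous _ _ X) O)
  (fun W => hol_pull (preserves_hol_diag HK (X := X))
     (fun y (Wy : preim_opens (@diag_continuous _ _ X) W y) => Wy)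
     : {rmorphism OO W -> O (preim_opens (@diag_continuous _ _ X) W)}) _).
by move=> U V h f; apply/val_inj/funext => -[x Ux]; rewrite /= /pull /=; exact: hol_eq.
Defined.

Definition diagM : ringedMap OO O := RingedMap diag_sharp.
Definition diag_inv (W : opens (X * X)%type) : opens X :=
  preim_opens (@rmap_continuous _ _ _ _ diagM) W.

Lemma diag_sharpE W (g : OO W) x (Wx : diag_inv W x) :
  (diag_sharp W g : hol _ _) (exist _ x Wx) = (g : hol _ _) (exist _ (x, x) Wx).
Proof. by rewrite /= /pull /=; exact: hol_eq. Qed.

Lemma diag_ideal_sq W (g : OO W) x (Wx : W (x, x)) :
  ideal_sq (@diag_ideal _ _ _ (@atlas _ _ X)) g -> (g : hol _ _) (exist _ (x, x) Wx) = 0.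
Proof.
move=> /(_ _ Wx)[V [h [Vx [k [a [b [abJ gE]]]]]]].
have := congr1 (fun f : OO V => (f : hol _ _) (exist _ (x, x) Vx)) gE.
rewrite hol_res (hol_eq _ (h _ Vx) Wx) => ->.
elim/big_ind: _ => [//|f f' f0 f'0|i _]; first by rewrite holD f0 f'0 addr0.
by rewrite holM; have [/(_ x Vx)-> _] := abJ i; rewrite mul0r.
Qed.

Section Jets.
Variables (J : modSheaf OO).
Variable q : quotientMap (ideal_sq (@diag_ideal _ _ _ (@atlas _ _ X))) J.

(** A jet is only locally the image of a function [g]. Two such functions differ by an element of
    [I^2], which vanishes on the diagonal, so their values there agree; near a point the values are
    those of one [g], hence holomorphic. *)
Lemma jet_value (W : opens (X * X)%type) (t : J W) : exists v : O (diag_inv W),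
  forall (V : opens (X * X)%type) (h : V `<=` W) (g : OO V), q V g = mres J h t ->
  forall x (Wx : diag_inv W x) (Vx : V (x, x)),
    (v : hol _ _) (exist _ x Wx) = (g : hol _ _) (exist _ (x, x) Vx).
Proof.
have uniq (V : opens (X * X)%type) (h : V `<=` W) (g : OO V) (V' : opens (X * X)%type) (h' : V' `<=` W) (g' : OO V') x
    (Vx : V (x, x)) (V'x : V' (x, x)) : q V g = mres J h t -> q V' g' = mres J h' t ->
    (g : hol _ _) (exist _ (x, x) Vx) = (g' : hol _ _) (exist _ (x, x) V'x).
  move=> gt gt'; pose VV := opensI V V'.
  have k : VV `<=` V by move=> y [].
  have k' : VV `<=` V' by move=> y [].
  have kW : VV `<=` W by move=> y /k/h.
  have VVx : VV (x, x) by [].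
  have : q VV (rres OO k g - rres OO k' g') = 0.
    by rewrite linearB -!qmap_res gt gt' !(mres_comp _ _ kW) subrr.
  move=> /(qmap_ker q)/(diag_ideal_sq VVx); rewrite holD holN !hol_res.
  rewrite (hol_eq g _ Vx) (hol_eq g' _ V'x) => /eqP; rewrite subr_eq0 => /eqP.
  exact.
have H (y : {x : X | diag_inv W x}) : exists v : K, exists (V : opens (X * X)%type) (h : V `<=` W) (g : OO V) (Vx : V (sval y, sval y)), q V g = mres J h t /\
    v = (g : hol _ _) (exist _ _ Vx).
  have [V [h [g [Vx gt]]]] := qmap_surj q t (proj2_sig y).
  by exists ((g : hol _ _) (exist _ _ Vx)), V, h, g, Vx.
have [v vP] := choice H.
have vE (V : opens (X * X)%type) (h : V `<=` W) (g : OO V) x (Wx : diag_inv W x) (Vx : V (x, x)) :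
   q V g = mres J h t -> v (exist _ x Wx) = (g : hol _ _) (exist _ (x, x) Vx).
  move=> gt; have [V' [h' [g' [V'x [gt' ->]]]]] := vP (exist _ x Wx).
  exact: uniq gt' gt.
have hv : holomorphic (@atlas _ _ X) v.
  move=> d dE x Wx dx; have [V [h [g [Vx gt]]]] := qmap_surj q t Wx.
  have [f [af fg]] := holP (diag_sharp V g) dE (Vx : diag_inv V x) dx.
  exists f; split=> //; apply: filterS2 (opens_nbhs (Vx : diag_inv V x)) fg => y Vy yf Wy.
  by rewrite (vE V h g y Wy Vy gt) -yf diag_sharpE.
by exists (mkhol hv) => V h g gt x Wx Vx; exact: vE.
Qed.

Lemma jet_diag : exists rho : forall W, J W -> O (diag_inv W),
  [/\ forall W (a : OO W) (t t' : J W),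
        rho W (a *: t + t') = (diag_sharp W a : O (diag_inv W)) * rho W t + rho W t',
      forall (V W : opens (X * X)%type) (h : W `<=` V)
        (h' : diag_inv W `<=` diag_inv V) (t : J V),
        rres O h' (rho V t) = rho W (mres J h t)
    & forall W g, rho W (q W g) = diag_sharp W g].
Proof.
have [r rP] : exists r : forall W, J W -> O (diag_inv W), forall W (t : J W) (V : opens (X * X)%type) (h : V `<=` W) (g : OO V), q V g = mres J h t ->
  forall x (Wx : diag_inv W x) (Vx : V (x, x)),
    (r W t : hol _ _) (exist _ x Wx) = (g : hol _ _) (exist _ (x, x) Vx).
  exists (fun W t => projT1 (cid (jet_value t))) => W t.
  exact: (projT2 (cid (jet_value t))).
exists r; split=> [W a s t|U V h h' s|W g].
- apply: hol_ext => x Wx.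
  have [V [h [g [Vx gs]]]] := qmap_surj q s (Wx : W (x, x)).
  have [V' [h' [g' [V'x gt]]]] := qmap_surj q t (Wx : W (x, x)).
  pose VV := opensI V V'.
  have k : VV `<=` V by move=> y [].
  have k' : VV `<=` V' by move=> y [].
  have kW : VV `<=` W by move=> y /k/h.
  have VVx : VV (x, x) by [].
  have gs' : q VV (rres OO k g) = mres J kW s by rewrite -qmap_res gs (mres_comp _ _ kW).
  have gt' : q VV (rres OO k' g') = mres J kW t by rewrite -qmap_res gt (mres_comp _ _ kW).
  have gst : q VV (rres OO kW a * rres OO k g + rres OO k' g') = mres J kW (a *: s + t).
    by rewrite mresD mresZ -gs' -gt'; exact: linearP.
  rewrite (rP _ _ _ _ _ gst _ _ VVx) !holD !holM diag_sharpE.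
  rewrite (rP _ _ _ _ _ gs' _ _ VVx) (rP _ _ _ _ _ gt' _ _ VVx).
  by rewrite !hol_res (hol_eq a _ Wx).
- apply: hol_ext => x Vx; rewrite hol_res.
  have [W [k [g [Wx gs]]]] := qmap_surj q s (h _ Vx).
  pose VV := opensI V W.
  have k1 : VV `<=` V by move=> y [].
  have k2 : VV `<=` W by move=> y [].
  have kU : VV `<=` U by move=> y /k1/h.
  have VVx : VV (x, x) by [].
  have g1 : q VV (rres OO k2 g) = mres J kU s by rewrite -qmap_res gs (mres_comp _ _ kU).
  have g2 : q VV (rres OO k2 g) = mres J k1 (mres J h s) by rewrite (mres_comp _ _ kU).
  by rewrite (rP _ _ _ _ _ g1 _ _ VVx) (rP _ _ _ _ _ g2 _ _ VVx).
- apply: hol_ext => x Wx; have h : W `<=` W by [].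
  by rewrite (rP W (q W g) W h g _ x Wx Wx) ?mres_id// diag_sharpE.
Qed.

Lemma jet_off_diagonal (W : opens (X * X)%type) :
  (forall x, ~ W (diagM x)) -> forall t : J W, t = 0.
Proof.
move=> Wo t; apply: msec_separated => y Wy.
have [V [h [g [Vy gt]]]] := qmap_surj q t Wy; exists V, h; split=> //.
rewrite -gt mres0; apply/(qmap_ker q) => z Vz.
have idV : V `<=` V by [].
(* On an open set that misses the diagonal every function lies in the ideal, so [g = g * 1] is a
   product of two of its elements. *)
exists V, idV; split=> //; exists 1%N, (fun=> g), (fun=> 1).
split; last by rewrite big_ord1 mulr1 rres_id.
by move=> i; split=> x Vx; case: (Wo x (h _ Vx)).
Qed.
End Jets.

Lemma off_diagonal_nbhs (y : X * X) : (forall x, diagM x <> y) ->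
  exists N : opens (X * X)%type, N y /\ forall x, ~ N (diagM x).
Proof.
case: y => a b ab; have aNb : a != b.
  by apply/eqP => e; apply: (ab a); rewrite e.
have := @manifold_hausdorff _ _ X; rewrite open_hausdorff => /(_ a b aNb).
move=> [[U V] [/= aU bV] [oU oV /eqP UV]].
exists (opensI (p1_inv (Opens U oU)) (p2_inv (Opens V oV))); split.
  by split; [move: aU; rewrite inE|move: bV; rewrite inE].
by move=> x [/= Ux Vx]; have : set0 x by rewrite -UV.
Qed.

Lemma square_nbhs (W : opens (X * X)%type) x : W (diagM x) ->
  exists V : opens X, V x /\ square V `<=` W.
Proof.
move=> /opens_nbhs[[A B] [/= xA xB] AB].
have [V [Vx VA]] := nbhs_opens (filterI xA xB).
exists V; split=> // -[z w] [/VA[/= Az _] /VA[/= _ Bw]].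
exact: (AB (z, w) (conj Az Bw)).
Qed.

Lemma hol_sum (Y : topologicalType) m (E : set (chart K m Y)) (U : opens Y) k
    (f : 'I_k -> hol_sheaf E U) y :
  ((\sum_i f i : hol_sheaf E U) : hol E U) y = \sum_i (f i : hol E U) y.
Proof. by apply: (big_morph (fun f : hol_sheaf E U => (f : hol E U) y)). Qed.

Lemma p1_sharpE U (a : O U) z w (h : p1_inv U (z, w)) (Uz : U z) :
  (rmap_sharp (@p1 _ _ X) U a : hol _ _) (exist _ (z, w) h) = (a : hol _ _) (exist _ z Uz).
Proof. by rewrite /= /pull /=; exact: hol_eq. Qed.

Lemma p2_sharpE U (a : O U) z w (h : p2_inv U (z, w)) (Uw : U w) :
  (rmap_sharp (@p2 _ _ X) U a : hol _ _) (exist _ (z, w) h) = (a : hol _ _) (exist _ w Uw).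
Proof. by rewrite /= /pull /=; exact: hol_eq. Qed.

Lemma hol_unit_near (U : opens X) (f : O U) x (Ux : U x) :
  (f : hol _ _) (exist _ x Ux) != 0 ->
  exists (V : opens X) (h : V `<=` U) (g : O V), V x /\ rres O h f * g = 1.
Proof.
have [c cE cx] := atlas_cover x.
exact: (hol_unit HK (@atlas_chart_continuous _ _ X) (@atlas_chart_holomorphic _ _ X) cE cx).
Qed.

(** The splitting is [f = (f - f(x) + 1) + (f(x) - 1)]: the first summand has value 1 at [x], and
    the second is a constant. *)
Lemma hol_two_units (U : opens X) (f : O U) x : U x ->
  exists (V : opens X) (h : V `<=` U) (f1 f2 : O V),
  [/\ V x, rres O h f = f1 + f2, f1 = 0 \/ (exists g, f1 * g = 1)
    & f2 = 0 \/ exists g, f2 * g = 1].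
Proof.
move=> Ux; pose c0 := (f : hol _ _) (exist _ x Ux).
pose cst (V : opens X) (a : K) : O V := hol_cst (@atlas _ _ X) V a.
pose f1 := f - cst U c0 + 1.
have f1x : (f1 : hol _ _) (exist _ x Ux) != 0.
  by rewrite /f1 !holD holN /= subrr add0r oner_eq0.
have [V [h [g [Vx fg]]]] := hol_unit_near f1x.
exists V, h, (rres O h f1), (cst V (c0 - 1)); split=> //.
- apply: hol_ext => y Vy; rewrite holD !hol_res /f1 !holD holN /=.
  by rewrite addrACA subrr addr0 -addrA addNr addr0.
- by right; exists g.
have [e|e] := eqVneq (c0 - 1) 0; [left|right].
  by rewrite e; apply: hol_ext.
by exists (cst V (c0 - 1)^-1); apply: hol_ext => y Vy; rewrite holM /= mulfV.
Qed.

(** Applying Hadamard's lemma to [g] minus its value on the diagonal gives coefficients [q k] that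
    depend on both variables. Replacing them by their restrictions to the diagonal costs an error
    that lies in [I^2]. *)
Lemma manifold_coords x :
  exists (V1 : opens X) (y : 'I_n -> O V1),
    [/\ V1 x, forall k, exists y', y k * y' = 1
      & forall (V : opens X) (g : OO (square V)), V x ->
        exists (V' : opens X) (h : V' `<=` V) (h1 : V' `<=` V1)
          (hs : square V' `<=` square V) (a : O V') (b : 'I_n -> O V'),
        V' x /\ forall (s1 : square V' `<=` p1_inv V') (s2 : square V' `<=` p2_inv V'),
          ideal_sq (@diag_ideal _ _ _ (@atlas _ _ X)) (rres OO hs g - (rres OO s1 (rmap_sharp (@p1 _ _ X) V' a) +
          \sum_k rres OO s1 (rmap_sharp (@p1 _ _ X) V' (b k)) *
          (rres OO s2 (rmap_sharp (@p2 _ _ X) V' (rres O h1 (y k))) -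
           rres OO s1 (rmap_sharp (@p1 _ _ X) V' (rres O h1 (y k))))))].
Proof.
have [c cE cx] := atlas_cover x.
pose cst (V : opens X) (a : K) : O V := hol_cst (@atlas _ _ X) V a.
(* The shift makes the value at [x] equal to 1, so [z k] is invertible near [x]; it drops out of all
   differences. *)
pose z k : O (chart_dom c) := mkhol (atlas_transition cE k) - cst _ (chart_coord c x 0 k - 1).
have zE k y (cy : chart_dom c y) : (z k : hol _ _) (exist _ y cy) =
    chart_coord c y 0 k - (chart_coord c x 0 k - 1) by [].
have zu k : exists (V : opens X) (h : V `<=` chart_dom c) (g : O V),
    V x /\ rres O h (z k) * g = 1.
  apply: (@hol_unit_near _ _ x cx).
  by rewrite zE opprB addrC subrK oner_eq0.
have [Vk VkP] := choice zu.
have Vkx k : nbhs x (Vk k) by have [h [g [/opens_nbhs]]] := VkP k.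
have [V1 [V1x V1A]] := nbhs_opens (filterI (opens_nbhs cx) (nbhs_forall Vkx)).
have V1c : V1 `<=` chart_dom c by move=> y /V1A[].
have V1k k : V1 `<=` Vk k by move=> y /V1A[_ /(_ k)].
exists V1, (fun k => rres O V1c (z k)); split=> // [k|V g Vx].
  have [h [g [_ zg]]] := VkP k; exists (rres O (V1k k) g).
  by rewrite -(rres_comp h (V1k k) V1c) -rmorphM zg rmorph1.
have di : V `<=` diag_inv (square V) by [].
pose a0 : O V := rres O di (diag_sharp (square V) g).
pose f0 := g - rres OO (@square_p1 _ _ _ V) (rmap_sharp (@p1 _ _ X) V a0).
have f0E u v (uv : square V (u, v)) (Vu : V u) (uu : square V (u, u)) :
    (f0 : hol _ _) (exist _ (u, v) uv) =
    (g : hol _ _) (exist _ (u, v) uv) - (g : hol _ _) (exist _ (u, u) uu).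
  rewrite holD holN; congr (_ - _).
  rewrite hol_res (p1_sharpE _ _ Vu) hol_res diag_sharpE.
  exact: hol_eq.
have f0I : diag_ideal f0.
  by move=> u uu; rewrite (f0E u u uu uu.1 uu) subrr.
have [V2 [h2 [q [V2x V2c fq]]]] := diag_hadamard HK f0I (conj Vx Vx : square V (x, x)) cE cx.
pose V' := opensI (opensI V2 V1) V.
have hV : V' `<=` V by move=> y [].
have h1 : V' `<=` V1 by move=> y [[]].
have hV2 : V' `<=` V2 by move=> y [[]].
have hs : square V' `<=` square V by move=> [u v] [/hV ? /hV ?].
have hs2 : square V' `<=` square V2 by move=> [u v] [/hV2 ? /hV2 ?].
have di' : V' `<=` diag_inv (square V2) by move=> y /hV2.
pose b k : O V' := rres O di' (diag_sharp (square V2) (q k)).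
exists V', hV, h1, hs, (rres O hV a0), b; split=> // s1 s2.
(* The error is the sum of the products [al k * be k]: a coordinate difference times the change of
   [q k] from its value on the diagonal. Both factors vanish on the diagonal. *)
pose al k := rres OO s2 (rmap_sharp (@p2 _ _ X) V' (rres O h1 (rres O V1c (z k)))) -
  rres OO s1 (rmap_sharp (@p1 _ _ X) V' (rres O h1 (rres O V1c (z k)))).
pose be k := rres OO hs2 (q k) - rres OO s1 (rmap_sharp (@p1 _ _ X) V' (b k)).
have alE k u v (uv : square V' (u, v)) : (al k : hol _ _) (exist _ (u, v) uv) =
    chart_coord c v 0 k - chart_coord c u 0 k.
  have Vu : V' u by case: uv.
  have Vv : V' v by case: uv.
  rewrite holD holN !hol_res (p1_sharpE _ _ Vu) (p2_sharpE _ _ Vv) !hol_res !zE.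
  by ring.
have beE k u v (uv : square V' (u, v)) (V2uv : square V2 (u, v)) (V2uu : square V2 (u, u)) :
    (be k : hol _ _) (exist _ (u, v) uv) =
    (q k : hol _ _) (exist _ (u, v) V2uv) - (q k : hol _ _) (exist _ (u, u) V2uu).
  have Vu : V' u by case: uv.
  have Vv : V' v by case: uv.
  rewrite holD holN !hol_res (p1_sharpE _ _ Vu) hol_res diag_sharpE.
  by congr (_ - _); apply: hol_eq.
move=> y V'y; have idV' : square V' `<=` square V' by [].
exists (square V'), idV'; split=> //; exists n, al, be; split.
  move=> k; split=> u uu; first by rewrite alE subrr.
  by rewrite (beE k u u uu (hs2 _ uu) (hs2 _ uu)) subrr.
rewrite rres_id; apply: hol_ext => -[u v] uv; have Vu : V' u by case: uv.
  have Vv : V' v by case: uv.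
have Vuv := hs _ uv; have Vuu := hs _ (conj Vu Vu : square V' (u, u)).
have V2uv := hs2 _ uv; have V2uu := hs2 _ (conj Vu Vu : square V' (u, u)).
rewrite holD holN holD !hol_res !hol_sum (p1_sharpE _ _ Vu) hol_res hol_res diag_sharpE.
rewrite (hol_eq g _ Vuv).
have -> : (g : hol _ _) (exist _ (u, v) Vuv) =
  (f0 : hol _ _) (exist _ (u, v) Vuv) + (g : hol _ _) (exist _ (u, u) Vuu).
  by rewrite (f0E _ _ _ (hV u Vu) Vuu) subrK.
rewrite (hol_eq f0 Vuv (h2 _ V2uv)) fq (hol_eq g (di u (hV u Vu)) Vuu).
rewrite opprD addrA addrK -sumrB.
apply: eq_bigr => k _.
rewrite !holM -/(al k) alE (beE k u v uv V2uv V2uu) hol_res (p1_sharpE _ _ Vu) hol_res diag_sharpE.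
by rewrite (hol_eq (q k) (di' u Vu) V2uu); ring.
Qed.

Lemma rres_irr (Y : topologicalType) (C : ringPresheaf Y) (U V : opens Y)
    (h h' : V `<=` U) (f : C U) : rres C h f = rres C h' f.
Proof. by congr (rres C _ f); exact: Prop_irrelevance. Qed.

Lemma p1_diag (x : X) : (@p1 _ _ X) (diagM x) = x. Proof. by []. Qed.
Lemma p2_diag (x : X) : (@p2 _ _ X) (diagM x) = x. Proof. by []. Qed.

Lemma p1_diag_sharp (U : opens X) (h : U `<=` diag_inv (p1_inv U)) (a : O U) :
  rres O h (rmap_sharp diagM (p1_inv U) (rmap_sharp (@p1 _ _ X) U a : OO (p1_inv U)) : O (diag_inv (p1_inv U))) = a.
Proof.
apply: hol_ext => x Ux; rewrite hol_res.
by rewrite [LHS]diag_sharpE (p1_sharpE _ _ Ux).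
Qed.

Lemma p2_diag_sharp (U : opens X) (h : diag_inv (p2_inv U) `<=` U) (a : O U) :
  rres O h a = (rmap_sharp diagM (p2_inv U) (rmap_sharp (@p2 _ _ X) U a : OO (p2_inv U)) : O (diag_inv (p2_inv U))).
Proof.
apply: hol_ext => x Ux; rewrite hol_res.
by rewrite [RHS]diag_sharpE (p2_sharpE _ _ (h x Ux)).
Qed.

(** * Normalized principal parts of an invertible sheaf on a manifold *)

Section NormalizedParts.
Variables (L : modSheaf O) (hL : invertible L) (P0 : normalizedParts L).
Let P := np_parts P0.
Let cls : forall U : opens X, L U -> OO (square U) -> pp_sheaf P U := fun U u g => pp_class P u g.

Lemma pp_classP (U : opens X) (u : L U) (g : OO (square U)) :
  is_class (pp_unit P) (pp_quot P) (pp_tens P) u g (cls u g).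
Proof.
exact: (is_class_xget p1_diag p2_diag (pp_unit P) (pp_quot P) (@pp_tensP _ _ _ _ P)
  (jet_off_diagonal (pp_quot P)) off_diagonal_nbhs u g (@square_p1 _ _ _ U) (@square_p2 _ _ _ U)).
Qed.

Lemma np_differentialE (U : opens X) (f : O U) (u : L U) :
  np_differential P0 f u = ndf (np_tens P0) cls f u.
Proof.
rewrite /np_differential /pp_differential /ndf /cls.
by rewrite (rres_irr (@sq1 _ _ _ _ _ _ U) (@square_p1 _ _ _ U)) (rres_irr (@sq2 _ _ _ _ _ _ U) (@square_p2 _ _ _ U)).
Qed.

Lemma dlog_pi : exists pi : forall U, {linear P0 U -> (O U)^o},
  [/\ forall (U V : opens X) (h : V `<=` U) s, rres O h (pi U s : O U) = pi V (mres P0 h s),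
      forall U (u : L U), local_generator u -> pi U (dlog P0 u) = 1
    & forall U (f : O U) (u : L U), local_generator u -> pi U (np_differential P0 f u) = 0].
Proof.
have [rho [rho_lin rho_res rhoq]] := jet_diag (pp_quot P).
have [pi [pi_res pi_dlg pi_ndf]] := pi_exists p1_diag p2_diag p1_diag_sharp p2_diag_sharp
  (@pp_pullP _ _ _ _ P) rho_lin rho_res rhoq (@pp_tensP _ _ _ _ P) (@hol_separated _ _ X) (@hol_glue _ _ X)
  (@np_tensP _ _ _ _ P0) pp_classP.
exists pi; split=> // U f u ugen.
by rewrite np_differentialE; exact: pi_ndf.
Qed.

Lemma dlog_res (U V : opens X) (h : V `<=` U) (u : L U) : local_generator u ->
  mres P0 h (dlog P0 u) = dlog P0 (mres L h u).
Proof.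
exact: (dlg_res p1_diag p2_diag (@pp_tensP _ _ _ _ P) (jet_off_diagonal (pp_quot P))
  off_diagonal_nbhs (np_tens P0) pp_classP h).
Qed.

Lemma np_differential_unit (U : opens X) (f f' : O U) (u : L U) : f * f' = 1 ->
  local_generator u ->
  np_differential P0 f u = f *: dlog P0 (f *: u) - f *: dlog P0 u.
Proof.
move=> ff' ugen; rewrite np_differentialE.
exact: (ndf_unit p1_diag p2_diag (@pp_tensP _ _ _ _ P) (jet_off_diagonal (pp_quot P))
  off_diagonal_nbhs (np_tens P0) pp_classP ff' ugen).
Qed.

Lemma dlog_spanning (x : X) : exists (V0 : opens X) (e : 'I_n.+1 -> L V0),
  [/\ V0 x, forall i, local_generator (e i)
    & forall (U : opens X) (p : P0 U), U x ->
      exists (V : opens X) (h : V `<=` U) (h0 : V `<=` V0),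
      V x /\ span (fun g => exists i, g = dlog P0 (mres L h0 (e i))) (mres P0 h p)].
Proof.
have coords : coords_at (@p1 _ _ X) (@p2 _ _ X) (ideal_sq (@diag_ideal _ _ _ (@atlas _ _ X))) n x.
  have [V1 [y [V1x yu had]]] := manifold_coords x.
  exists V1, y; split=> // V g Vx.
  have [V' [h [h1 [hs [a [b [V'x H]]]]]]] := had V g Vx.
  by exists V', h, h1, hs, a, b; split.
exact: (dlog_span p1_diag p2_diag (@pp_pullP _ _ _ _ P) (@pp_tensP _ _ _ _ P) (jet_off_diagonal (pp_quot P))
  off_diagonal_nbhs square_nbhs (@np_tensP _ _ _ _ P0) pp_classP coords (hL x)).
Qed.
End NormalizedParts.

Lemma twisted_complex_exact (L : modSheaf O) (hL : invertible L)
    (S : modSheaf (const_ring X K)) (j : nat) (j0 : (0 < j)%N)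
    (C : ppComplex L j) (T : twistedComplex C S) :
  null_homotopic n (tw_d T) /\ exact_complex n (tw_d T).
Proof.
have [pi [pi_res pi_dlg pi_ndf]] := dlog_pi (ppc_parts C).
pose d i (U : opens X) (x : ppc_term C i U) : ppc_term C i.+1 U := ppc_d C i U x.
have d_add i U (x y : ppc_term C i U) : d i U (x + y) = d i U x + d i U y.
  exact: (linearD (ppc_d C i U) x y).
have d_res i (U V : opens X) (h : V `<=` U) (x : ppc_term C i U) :
    mres (ppc_term C i.+1) h (d i U x) = d i V (mres (ppc_term C i) h x).
  exact: (mhom_res (ppc_d C i) h x).
have [h hE] := contraction_terms pi_res (@ppc_wedgeP _ _ _ _ _ C) (@ppc_tensP _ _ _ _ _ C).
have j0K : (j%:R : K) != 0 by rewrite pnatr_eq0 -lt0n.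
apply: (@twisted_exact _ _ _ (cst_hol (@atlas _ _ X)) n j (j%:R^-1) (mulVf j0K)
  (ppc_term C) (ppc_d C) h) => [U x|i U x i_n|U x|i U x i_n||i U a s].
- exact: (homotopy_bottom pi_dlg pi_ndf (@dlog_res L (ppc_parts C)) (dlog_spanning hL (ppc_parts C))
    (@ppc_wedgeP _ _ _ _ _ C) (@ppc_powerP _ _ _ _ _ C) (@ppc_tensP _ _ _ _ _ C) d_add d_res (@ppc_dE _ _ _ _ _ C) hE x).
- exact: (homotopy_middle pi_dlg pi_ndf (@dlog_res L (ppc_parts C)) (dlog_spanning hL (ppc_parts C))
    (@ppc_wedgeP _ _ _ _ _ C) (@ppc_powerP _ _ _ _ _ C) (@ppc_tensP _ _ _ _ _ C) d_add d_res (@ppc_dE _ _ _ _ _ C) hE x i_n).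
- exact: (homotopy_top pi_res pi_dlg pi_ndf (@dlog_res L (ppc_parts C)) (dlog_spanning hL (ppc_parts C))
    (@ppc_wedgeP _ _ _ _ _ C) (@ppc_powerP _ _ _ _ _ C) (@ppc_tensP _ _ _ _ _ C) d_add d_res (@ppc_dE _ _ _ _ _ C) hE x).
- exact: (d_d_eq0 (@dlog_res L (ppc_parts C)) (@np_differential_unit L (ppc_parts C))
    (dlog_spanning hL (ppc_parts C)) hol_two_units
    (@ppc_wedgeP _ _ _ _ _ C) (@ppc_powerP _ _ _ _ _ C) (@ppc_tensP _ _ _ _ _ C) d_add d_res (@ppc_dE _ _ _ _ _ C) x i_n j0).
- exact: (@tw_tensP _ _ _ _ _ _ _ T).
- exact: tw_dE.
Qed.
End Diagonal.

Theorem proposition1 (R : realType) (n : nat) (X : complexManifold R n)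
    (L : modSheaf (OX X)) (hL : invertible L)
    (S : modSheaf (const_ring X R[i])) (hS : local_system S)
    (j : nat) (hj : (0 < j)%N)
    (C : ppComplex L j) (T : twistedComplex C S) :
  null_homotopic n (tw_d T) /\ exact_complex n (tw_d T).
Proof. exact: (twisted_complex_exact (@complex_geo_complete R) hL hj). Qed.
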